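(* Let $0<\alpha<1$ and let $\rho_G(x)=\frac{\alpha}{\Gamma(1-\alpha)}x^{-\alpha-1}e^{-x}$, $x>0$. For each $\theta>0$, the distribution $\mathbf{PK}^{(\theta/\alpha)}(\rho_G)$ is the same law as the two-parameter Poisson-Dirichlet distribution $\mathbf{PD}(\alpha,\theta)$.
   Context: Negative binomial Poisson-Kingman law: for $r>0$ and a density $\rho$ on $(0,\infty)$ such that $\Pi(dx)=\rho(x)dx$ satisfies $\Pi\{(0,\infty)\}=\infty$, $\Pi\{(x,\infty)\}<\infty$ for $x>0$ and $\int_0^1x\,\Pi(dx)<\infty$, a negative binomial point process $\mathbb{B}^{(r)}\sim\mathcal{BN}(r,\rho)$ is a point process on $(0,\infty)$ with Laplace functional $\mathbb{E}(e^{-\mathbb{B}^{(r)}(f)})=\big(1+\int_0^\infty(1-e^{-f(x)})\Pi(dx)\big)^{-r}$ for all nonnegative measurable $f$; equivalently, a Poisson point process with randomised intensity measure $\Gamma_r\Pi$, $\Gamma_r$ an independent Gamma$(r,1)$ variable. With its ordered points $J_{(1)}\ge J_{(2)}\ge\cdots$ and $T(\mathbb{B}^{(r)})=\sum_iJ_{(i)}$, $\mathbf{PK}^{(r)}(\rho)$ is the law of $\big(J_{(1)}/T(\mathbb{B}^{(r)}),J_{(2)}/T(\mathbb{B}^{(r)}),\ldots\big)$. Two-parameter Poisson-Dirichlet law: a random decreasing sequence $\mathbf{V}=(V_i)_{i\ge1}$ of positive numbers summing to $1$ has law $\mathbf{PD}(\alpha,\theta)$ if its size-biased permutation $(\tilde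 V_i)_{i\ge1}$ has the representation $\tilde V_n=U_n\prod_{i=1}^{n-1}(1-U_i)$, $n\in\mathbb{N}$, with $U_i$ independent and $U_i\sim$ Beta$(1-\alpha,\theta+i\alpha)$. Here the size-biased permutation is obtained by sampling the terms of $\mathbf{V}$ successively without replacement, each time picking a remaining term with probability proportional to its size. Beta$(a,b)$ has density proportional to $u^{a-1}(1-u)^{b-1}$ on $(0,1)$. *)

(* Defs.v *)
From mathcomp Require Import all_boot all_order all_algebra.
From mathcomp Require Import all_classical all_reals all_analysis.

Set Implicit Arguments.
Unset Strict Implicit.
Unset Printing Implicit Defensive.

Import Order.TTheory GRing.Theory Num.Theory.
Import numFieldNormedType.Exports.

Local Open Scope classical_set_scope.
Local Open Scope ring_scope.

(* Indices of sequences start at 0: what is usually written x_1, x_2, ...     *)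
(* is x 0, x 1, ...                                                           *)

Definition seq_cylinders (R : realType) : set (set (nat -> R)) :=
  \bigcup_i preimage_set_system setT (fun v : nat -> R => v i) measurable.

(* R^nat with its product sigma-algebra. *)
Definition rseq (R : realType) := g_sigma_algebraType (@seq_cylinders R).

Section laws.
Context {R : realType}.

(* The functions underlying two measures may differ outside of the            *)
(* sigma-algebra, so laws are compared on measurable sets only.               *)
Definition same_law (mu nu : probability (rseq R) R) : Prop :=
  forall A, measurable A -> mu A = nu A.

Definition has_law d (T : measurableType d) (P : probability T R)
    (V : T -> rseq R) (mu : probability (rseq R) R) : Prop :=
  measurable_fun setT V /\ forall A, measurable A -> mu A = P (V @^-1` A).

Definition mutually_independent d (T : measurableType d) (P : probability T R)
    (X : nat -> {RV P >-> R}) : Prop :=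
  forall (s : seq nat) (A : nat -> set R), uniq s ->
    (forall i, measurable (A i)) ->
    P (\bigcap_(i in [set` s]) (X i @^-1` A i)) =
    (\prod_(i <- s) P (X i @^-1` A i))%E.

Definition beta_weight (a b : R) (u : R) : R :=
  u `^ (a - 1) * (1 - u) `^ (b - 1).

(* Beta(a, b) with real parameters; the library's beta_prob only has natural  *)
(* number parameters.                                                         *)
Definition beta_distributed d (T : measurableType d) (P : probability T R)
    (X : {RV P >-> R}) (a b : R) : Prop :=
  forall A : set R, measurable A ->
    P (X @^-1` A) =
    (\int[lebesgue_measure]_(u in A `&` `]0%R, 1%R[) (beta_weight a b u)%:E /
     \int[lebesgue_measure]_(u in `]0%R, 1%R[) (beta_weight a b u)%:E)%E.

Definition Gamma_fun (a : R) : R :=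
  \int[lebesgue_measure]_(x in `]0, +oo[) (x `^ (a - 1) * expR (- x)).

Definition rho_G (alpha : R) (x : R) : R :=
  alpha / Gamma_fun (1 - alpha) * x `^ (- alpha - 1) * expR (- x).

End laws.

Section negative_binomial_Poisson_Kingman.
Context {R : realType}.

(* A random measure is a kernel from the sample space to the real line: its   *)
(* values are measures B w such that w |-> B w A is measurable for every      *)
(* measurable A. A point process on (0, +oo) is an integer-valued random      *)
(* measure carried by (0, +oo); its points may only accumulate at 0.          *)
Definition point_process d (T : measurableType d) (P : probability T R)
    (B : R.-ker T ~> measurableTypeR R) : Prop :=
  {ae P, forall w,
    [/\ B w `]-oo, 0]%classic = 0%E,
        forall x : R, 0 < x -> (B w `]x, +oo[%classic < +oo)%E &
        forall A : set R, measurable A ->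
          B w A = +oo%E \/ exists n : nat, B w A = n%:R%:E]}.

(* BN(r, rho), through its Laplace functional. This is meant for r > 0 and    *)
(* Pi(dx) = rho(x)dx with Pi(0, +oo) = +oo, Pi(x, +oo) < +oo for x > 0 and    *)
(* a finite integral of x against Pi over (0, 1]. Here e^{-oo} = 0 on the    *)
(* left and (+oo)^{-r} = 0 on the right; the power is written as an inverse   *)
(* because poweR gives +oo, not 0, at +oo for a negative exponent.            *)
Definition negative_binomial_process d (T : measurableType d)
    (P : probability T R) (r : R) (rho : R -> R)
    (B : R.-ker T ~> measurableTypeR R) : Prop :=
  point_process P B /\
  forall f : R -> R, measurable_fun setT f -> (forall x, 0 <= f x) ->
    (\int[P]_w expeR (- \int[B w]_(x in `]0%R, +oo[) (f x)%:E) =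
     (poweR (1 + \int[lebesgue_measure]_(x in `]0%R, +oo[)
                   ((1 - expR (- f x)) * rho x)%:E) r)^-1)%E.

(* The points of B, with multiplicity, listed in nonincreasing order. *)
Definition ordered_points d (T : measurableType d) (P : probability T R)
    (B : R.-ker T ~> measurableTypeR R) (J : nat -> {RV P >-> R}) : Prop :=
  {ae P, forall w,
    [/\ forall i, 0 < J i w,
        forall i, J i.+1 w <= J i w &
        forall A : set R, measurable A ->
          B w A = (\sum_(0 <= i <oo) \d_(J i w) A)%E]}.

Definition total_mass (x : nat -> R) : \bar R :=
  (\sum_(0 <= i <oo) (x i)%:E)%E.

(* mu is the law PK^(r)(rho). Under the conditions on rho recalled above, the *)
(* total mass is almost surely positive and finite, so the junk value of fine *)
(* at +oo does not matter.                                                    *)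
Definition PK_law (r : R) (rho : R -> R) (mu : probability (rseq R) R) : Prop :=
  exists (d : measure_display) (T : measurableType d) (P : probability T R)
    (B : R.-ker T ~> measurableTypeR R) (J : nat -> {RV P >-> R}),
    [/\ negative_binomial_process P r rho B,
        ordered_points B J &
        has_law P (fun w i => J i w / fine (total_mass (fun k => J k w))) mu].

End negative_binomial_Poisson_Kingman.

Section Poisson_Dirichlet.
Context {R : realType}.

Definition decreasing_partition_of_unity (v : nat -> R) : Prop :=
  [/\ forall i, 0 < v i,
      forall i, v i.+1 <= v i &
      (\sum_(0 <= i <oo) (v i)%:E = 1)%E].

(* s n w is the index of the n-th term picked, so that the size-biased        *)
(* permutation of V is n |-> V w (s n w). The identity says that, given V and *)
(* given that the indices h were picked in the first `size h` steps, the next *)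
(* index is i with probability 0 if i is in h, and otherwise with probability *)
(* V_i divided by what remains of the total mass 1 of V.                      *)
Definition size_biased_order d (T : measurableType d) (P : probability T R)
    (V : T -> rseq R) (s : nat -> {RV P >-> nat}) : Prop :=
  forall (h : seq nat) (i : nat) (A : set (rseq R)), measurable A ->
    let E := [set w | V w \in A /\ mkseq (fun k => s k w) (size h) = h] in
    P (E `&` [set w | s (size h) w = i]) =
    (\int[P]_(w in E)
       (if i \in h then 0 else V w i / (1 - \sum_(j <- h) V w j))%:E)%E.

(* nu is the law PD(alpha, theta). The sample space is allowed to be any one  *)
(* carrying V together with the extra randomness of its size-biased           *)
(* permutation. As U 0, U 1, ... stand for U_1, U_2, ..., U i has law         *)
(* Beta(1 - alpha, theta + (i + 1) alpha).                                    *)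
Definition PD_law (alpha theta : R) (nu : probability (rseq R) R) : Prop :=
  exists (d : measure_display) (T : measurableType d) (P : probability T R)
    (V : T -> rseq R) (s : nat -> {RV P >-> nat}) (U : nat -> {RV P >-> R}),
    [/\ has_law P V nu,
        {ae P, forall w, decreasing_partition_of_unity (V w)},
        size_biased_order V s,
        mutually_independent U /\
        forall i, beta_distributed (U i) (1 - alpha) (theta + i.+1%:R * alpha) &
        {ae P, forall w, forall n,
           V w (s n w) = U n w * \prod_(i < n) (1 - U i w)}].

End Poisson_Dirichlet.

(* Main.v *)
Require Import Defs.
From HB Require Import structures.
From mathcomp Require Import all_boot all_order all_algebra.
From mathcomp Require Import all_classical all_reals all_analysis.
From mathcomp Require Import measurable_realfun.
From mathcomp Require Import ring lra.
Import Order.TTheory GRing.Theory Num.Theory.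
Import numFieldNormedType.Exports.

Set Implicit Arguments.
Unset Strict Implicit.
Unset Printing Implicit Defensive.

Local Open Scope classical_set_scope.
Local Open Scope ring_scope.

(* Let q = theta / alpha. The Laplace exponent of rho_G is                    *)
(* (1 + l)^alpha - 1, so the total mass of BN(q, rho_G) has the Laplace       *)
(* transform (1 + l)^(- alpha q), and hence the law Gamma(alpha q), because   *)
(* the moments of e^{-T} determine the law of T. By Palm's formula, removing  *)
(* a point picked with weight g turns BN(q) into a multiple of BN(q + 1);     *)
(* with g(x) = x, the size y of the picked point and the remaining mass t     *)
(* have a joint law proportional to that of independent Gamma(1 - alpha) and  *)
(* Gamma(alpha (q + 1)) variables, weighted by 1 / (y + t). So y / (y + t) is *)
(* Beta(1 - alpha, alpha (q + 1)), independent of y + t, and the induction    *)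
(* goes on with BN(q + 1). This computes the law of the successive ratios in  *)
(* a size-biased permutation of the points; that permutation is realised with *)
(* one additional uniform variable, which gives PD(alpha, theta).             *)
(*                                                                            *)
(* Conversely PD(alpha, theta) determines its law: a size-biased permutation  *)
(* exhausts all indices almost surely, so V_i exceeds x if and only if more   *)
(* than i sticks exceed x, and the sticks are functions of independent beta   *)
(* variables.                                                                 *)

(** * Images, mixtures and laws of sequences *)

(** The equivalence splits into existence and uniqueness, with q = theta / alpha.

    Existence ([PD_law_of_PK]) reduces to the joint law of the fractions taken by successive
    size-biased picks from the points. The inductive statement is [pick_law_integral]: under c times
    a BN(q) law, the fractions are independent Beta(1 - alpha, alpha (q + k)), k = 1, 2, ..., and
    independent of the total, which is Gamma(alpha q). Its induction step combines
    [negbin_points_palm] (removing a picked point leads to a multiple of BN(q + 1)),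
    [integral_Pi_id] (size-biasing the measure of [rho_G] gives a Gamma(1 - alpha) law) and
    [integral_gam_gam] (ratio and sum of independent Gamma variables). The base case is
    [negbin_rtotal_law], where [laplace_Pi] and [moments_determine] identify the law of the total.
    Unnormalised measures are used throughout, so that a Palm measure can be fed back into the
    induction. Fractions do not change under scaling ([pick_law_scale]), so their laws pass to the
    normalised sequence; [integral_hits] and [sampling_size_biased] then realise the permutation on
    the product of the sequence space with a uniform variable.

    Uniqueness ([PD_law_unique]): by [size_biased_inj] and [size_biased_surj] the order of picking
    is almost surely a bijection of the indices, so V is the decreasing rearrangement of the sticks.
    [ray_box_stick_box] thus expresses the law of V on a generating pi-system through the joint law
    of the fractions, which independence and the beta laws determine. *)

Section weighted_pushforward.
Local Open Scope ereal_scope.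
Context d1 d2 (X : measurableType d1) (Y : measurableType d2) (R : realType).
Variables (M : {measure set X -> \bar R}) (g : X -> \bar R) (z : X -> Y).

(** Image under [z] of the measure with density [g]. The three proofs are arguments so that the
    measure structure can be inferred from the term. *)
Definition wpush (g0 : forall x, 0 <= g x) (mg : measurable_fun setT g)
    (mz : measurable_fun setT z) : set Y -> \bar R :=
  fun D => \int[M]_(x in z @^-1` D) g x.

Hypotheses (g0 : forall x, 0 <= g x) (mg : measurable_fun setT g)
  (mz : measurable_fun setT z).

Let mpre D : measurable D -> measurable (z @^-1` D).
Proof. by move=> mD; rewrite -[X in measurable X]setTI; exact: mz. Qed.

Let wpush0 : wpush g0 mg mz set0 = 0.
Proof. by rewrite /wpush preimage_set0 integral_set0. Qed.

Let wpush_ge0 D : 0 <= wpush g0 mg mz D.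
Proof. exact: integral_ge0. Qed.

Let wpush_sigma_additive : semi_sigma_additive (wpush g0 mg mz).
Proof.
move=> F mF tF mUF; rewrite /wpush preimage_bigcup ge0_integral_bigcup//=.
- by apply: is_cvg_nneseries => n _ _; exact: integral_ge0.
- by move=> k; exact: mpre.
- exact: measurable_funTS.
- by apply/trivIsetP => i j _ _ ij; rewrite -preimage_setI;
    move/trivIsetP : tF => ->//; rewrite preimage_set0.
Qed.

HB.instance Definition _ := isMeasure.Build _ _ _ (wpush g0 mg mz)
  wpush0 wpush_ge0 wpush_sigma_additive.

Import HBNNSimple.

Lemma integral_wpush (F : Y -> \bar R) : (forall y, 0 <= F y) ->
  measurable_fun setT F ->
  \int[wpush g0 mg mz]_y F y = \int[M]_x (F (z x) * g x).
Proof.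
move=> F0 mF.
have ind D : measurable D ->
    \int[M]_x ((\1_D (z x))%:E * g x) = wpush g0 mg mz D.
  move=> mD; rewrite /wpush [in RHS]integral_mkcond; apply: eq_integral => x _.
  rewrite patchE indicE; case: ifPn => zD.
    by rewrite mem_set ?mul1e//; move: zD; rewrite inE.
  by rewrite memNset ?mul0e//; move: zD; rewrite notin_setE.
have mind D : measurable D ->
    measurable_fun setT (fun x => (\1_D (z x))%:E * g x).
  move=> mD; apply: emeasurable_funM => //; apply/measurable_EFinP.
  by apply: measurableT_comp => //; exact: measurable_indic.
pose f_ := nnsfun_approx measurableT mF.
have mono (y : Y) : {homo (fun n => (f_ n y)%:E) : a b / (a <= b)%N >-> a <= b}.
  by move=> a b ab; rewrite lee_fin; exact/lefP/nd_nnsfun_approx.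
transitivity (limn (fun n => \int[wpush g0 mg mz]_x (f_ n x)%:E)).
  rewrite -monotone_convergence//.
  - apply: eq_integral => y _; apply/esym/cvg_lim => //.
    exact: cvg_nnsfun_approx.
  - by move=> n; exact/measurable_EFinP/measurable_funP.
  - by move=> n y _; rewrite lee_fin.
rewrite [X in limn X](_ : _ = (fun n => \int[M]_x ((f_ n (z x))%:E * g x))).
  rewrite -monotone_convergence//; last 3 first.
    - move=> n; apply: emeasurable_funM => //; apply/measurable_EFinP.
      by apply: measurableT_comp => //; exact: measurable_funP.
    - by move=> n x _; rewrite mule_ge0// lee_fin.
    - by move=> x _ a b ab; rewrite lee_wpmul2r//; exact: mono.
  apply: eq_integral => x _; apply/cvg_lim => //.
  have cf : (f_ n (z x))%:E @[n --> \oo] --> F (z x) by exact: cvg_nnsfun_approx.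
  (* [g x] may be +oo, where multiplication is not continuous at 0; hence the separate treatment of
     [F (z x) = 0], of [g x = 0], of finite [g x] and of infinite [g x]. *)
  have [Fz0|Fz0] := eqVneq (F (z x)) 0.
    rewrite Fz0 mul0e; apply: cvg_near_cst; apply: nearW => n.
    have : (f_ n (z x))%:E <= 0.
      rewrite -Fz0 -(cvg_lim _ cf)// (cvg_lim _ (ereal_nondecreasing_cvgn _))//.
      by apply: ereal_sup_ubound; exists n.
    rewrite lee_fin => fle; suff -> : f_ n (z x) = 0%R by rewrite mul0e.
    by apply/eqP; rewrite eq_le fle/=.
  have [->|gx0] := eqVneq (g x) 0.
    by under eq_fun do rewrite mule0; rewrite mule0; exact: cvg_cst.
  have := g0 x; case: (g x) gx0 => [r| |] // gx0 g0x.
    rewrite muleC; under eq_fun do rewrite muleC.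
    by apply: cvgeZl => //.
  rewrite gt0_muley; last by rewrite lt_neqAle eq_sym Fz0/=.
  have Fpos : 0 < F (z x) by rewrite lt_neqAle eq_sym Fz0/=.
  have [n fn] : exists n, 0 < (f_ n (z x))%:E.
    apply: contrapT => /forallNP fle; move: Fpos; rewrite ltNge => /negP; apply.
    by apply: (cvge_le _ cf); apply: nearW => n; rewrite leNgt; exact/negP/fle.
  apply: cvg_near_cst; near=> m; rewrite gt0_muley//.
  by apply: (lt_le_trans fn); apply: mono; near: m; exact: nbhs_infty_ge.
apply/funext => n.
under [in LHS]eq_integral do rewrite fimfunE -fsumEFin//.
rewrite ge0_integral_fsum//; last 2 first.
- by move=> y; exact/measurable_EFinP/measurable_funM.
- by move=> y x _; rewrite nnfun_muleindic_ge0.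
transitivity (\int[M]_x \sum_(k \in range (f_ n))
    (k%:E * ((\1_(f_ n @^-1` [set k]) (z x))%:E * g x))); last first.
  apply: eq_integral => x _; rewrite fimfunE -fsumEFin// ge0_mule_fsuml//.
    by apply: eq_fsbigr => k _; rewrite EFinM muleA.
  by move=> k; rewrite nnfun_muleindic_ge0.
have aux k x : 0 <= k%:E * ((\1_(f_ n @^-1` [set k]) (z x))%:E * g x).
  by rewrite muleA mule_ge0// -EFinM nnfun_muleindic_ge0.
rewrite ge0_integral_fsum//; last first.
- by move=> k; apply: measurable_funeM; exact: mind.
apply: eq_fsbigr => r _; rewrite integralZl_indic_nnsfun// integral_indic// setIT.
have [r0|r0] := leP 0%R r.
  rewrite ge0_integralZl//; first by rewrite ind.
  - exact: mind.
  - by move=> x _; rewrite mule_ge0// lee_fin.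
rewrite preimage_nnfun0// measure0 mule0 integral0_eq// => x _.
by rewrite indic0 mul0e mule0.
Unshelve. all: by end_near. Qed.

End weighted_pushforward.

Section image_measure.
Local Open Scope ereal_scope.
Context d1 d2 (X : measurableType d1) (Y : measurableType d2) (R : realType).
Variables (M : {measure set X -> \bar R}) (z : X -> Y).
Hypothesis mz : measurable_fun setT z.

Definition image_measure : {measure set Y -> \bar R} :=
  wpush M (fun _ => @lee01 R) (measurable_cst 1) mz.

Lemma image_measureE D : measurable D -> image_measure D = M (z @^-1` D).
Proof.
move=> mD; rewrite [LHS]integral_cst ?mul1e//.
by rewrite -[X in measurable X]setTI; exact: mz.
Qed.

Lemma integral_image_measure (F : Y -> \bar R) : (forall y, 0 <= F y) ->
  measurable_fun setT F ->
  \int[image_measure]_y F y = \int[M]_x F (z x).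
Proof.
by move=> F0 mF; rewrite integral_wpush//; apply: eq_integral => x _; rewrite mule1.
Qed.

End image_measure.

Section mixture.
Local Open Scope ereal_scope.
Context d1 d2 (X : measurableType d1) (Y : measurableType d2) (R : realType).
Variables (M : {measure set X -> \bar R}) (g : nat -> X -> \bar R)
  (z : nat -> X -> Y).
Hypotheses (g0 : forall i x, 0 <= g i x)
  (mg : forall i, measurable_fun setT (g i))
  (mz : forall i, measurable_fun setT (z i)).

(** Describes picking an index i with weight [g i x] and keeping only [z i x]. The weights need not
    sum to 1. *)
Definition mixture : {measure set Y -> \bar R} :=
  mseries (fun i => wpush M (g0 i) (mg i) (mz i)) 0.

Lemma integral_mixture (F : Y -> \bar R) : (forall y, 0 <= F y) ->
  measurable_fun setT F ->
  \int[mixture]_y F y = \int[M]_x \sum_(i <oo) (F (z i x) * g i x).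
Proof.
move=> F0 mF; rewrite ge0_integral_measure_series// integral_nneseries//.
- by apply: eq_eseriesr => i _; rewrite -(integral_wpush M (g0 i) (mg i) (mz i)).
- by move=> i; apply: emeasurable_funM => //; exact: measurableT_comp.
- by move=> i x _; rewrite mule_ge0.
Qed.

End mixture.

Section rseq.
Context {R : realType}.

Lemma measurable_coord i : measurable_fun [set: rseq R] (fun v => v i).
Proof.
move=> _ B mB; rewrite setTI; apply: sub_sigma_algebra.
by exists i => //; exists B => //; rewrite setTI.
Qed.

Lemma measurable_to_rseq d (T : measurableType d) (F : T -> rseq R) :
  (forall i, measurable_fun [set: T] (fun x => F x i)) ->
  measurable_fun [set: T] F.
Proof.
move=> mF; apply: (@measurability _ _ T (rseq R) setT F (@seq_cylinders R)) => //.
move=> _ [_ [i _ [B mB <-]] <-]; rewrite !setTI.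
by have := mF i measurableT _ mB; rewrite setTI.
Qed.

(** Bounds in the extended reals let -oo stand for no constraint. Strict lower bounds are used
    because they can be read off a decreasing rearrangement, see [many_above]. *)
Definition ray_box (k : nat) (x : nat -> \bar R) : set (rseq R) :=
  [set v | forall i, (i < k)%N -> (x i < (v i)%:E)%E].

Definition ray_boxes : set (set (rseq R)) :=
  [set A | exists k x, A = ray_box k x].

Lemma measurable_ray_box k x : measurable (ray_box k x).
Proof.
rewrite (_ : ray_box k x =
    \bigcap_(i in `I_k) ((fun v : rseq R => (v i)%:E) @^-1` `]x i, +oo[)).
  apply: bigcap_measurableType => i _.
  rewrite -[X in measurable X]setTI.
  have : measurable_fun [set: rseq R] (fun v : rseq R => (v i)%:E).
    by apply/measurable_EFinP; exact: measurable_coord.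
  by apply => //; exact: emeasurable_itv.
by apply/seteqP; split => v /= H i ik; have := H i ik; rewrite /= ?in_itv/= ?andbT.
Qed.

Lemma measurable_rseqE : @measurable _ (rseq R) = <<s ray_boxes >>.
Proof.
apply/seteqP; split; last first.
  apply: smallest_sub; first exact: sigma_algebra_measurable.
  by move=> _ [k [x ->]]; exact: measurable_ray_box.
apply: smallest_sub; first exact: smallest_sigma_algebra.
move=> _ [i _ [B mB <-]]; rewrite setTI.
pose S : measurableType _ := g_sigma_algebraType ray_boxes.
suff : measurable_fun [set: S] (fun v : S => (v : nat -> R) i : R).
  by move=> /(_ measurableT B mB); rewrite setTI.
apply: (measurability (@RGenOInfty.G R)).
  exact: RGenOInfty.measurableE.
move=> _ [_ [r ->] <-]; rewrite setTI; apply: sub_sigma_algebra.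
exists i.+1, (fun j => if j == i then r%:E else -oo%E).
apply/seteqP; split => v /=.
  rewrite in_itv/= andbT => rv j ji; case: eqVneq => [->|_]; last exact: ltNyr.
  by rewrite lte_fin.
by move=> /(_ i); rewrite ltnSn eqxx lte_fin in_itv/= andbT; exact.
Qed.

Lemma rseq_measure_unique (m1 m2 : {measure set (rseq R) -> \bar R}) :
  (m1 setT < +oo)%E ->
  (forall k x, m1 (ray_box k x) = m2 (ray_box k x)) ->
  forall A, measurable A -> m1 A = m2 A.
Proof.
move=> m1oo m12 A mA.
have boxT : ray_box 0 (cst -oo%E) = setT by apply/seteqP; split.
apply: (measure_unique ray_boxes (fun=> setT)) => //.
- exact: measurable_rseqE.
- move=> _ _ [k [x ->]] [l [y ->]].
  (* The shorter list of bounds is padded with -oo. *)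
  exists (maxn k l), (fun i => maxe (if (i < k)%N then x i else -oo)
    (if (i < l)%N then y i else -oo))%E.
  apply/seteqP; split => v /=.
    move=> [xv yv] i; rewrite leq_max gt_max => ikl.
    by apply/andP; split; case: ifPn => // il; rewrite ?ltNyr// (xv,yv).
  by move=> H; split=> i ik; move/(_ i): H; rewrite leq_max ik ?orbT gt_max;
     move=> /(_ isT)/andP[].
- by move=> _; exists 0%N, (cst -oo%E); rewrite boxT.
- by rewrite bigcup_const//; exists 0%N.
- by move=> _ [k [x ->]].
Qed.

End rseq.

(** * Gamma and beta integrals *)

Section affine.
Context {R : realType}.
Local Notation mu := (@lebesgue_measure R).
Local Open Scope ereal_scope.

(** The image of a times Lebesgue measure under x |-> a x + b gives each half-open interval its
    length, so it is Lebesgue measure. *)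
Lemma integral_affine (F : R -> \bar R) (a b : R) : (0 < a)%R ->
  (forall x, 0 <= F x) -> measurable_fun setT F ->
  \int[mu]_x F x = \int[mu]_x (F (a * x + b)%R * a%:E).
Proof.
move=> a0 F0 mF.
have g0 (x : measurableTypeR R) : 0 <= a%:E by rewrite lee_fin ltW.
have mg : measurable_fun [set: measurableTypeR R] (fun=> a%:E).
  exact: measurable_cst.
have mz : measurable_fun [set: measurableTypeR R]
    (fun x => (a * x + b)%R : measurableTypeR R).
  by apply: measurable_funD => //; exact: measurable_funM.
rewrite -(integral_wpush mu g0 mg mz)//.
apply: eq_measure_integral => A mA _; apply: lebesgue_measure_unique => //.
move=> _ [[c d] _ <-]; rewrite /= /wpush integral_cst//=; last first.
  rewrite -[X in measurable X]setTI; exact: mz.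
rewrite (_ : _ @^-1` _ = `](c - b) / a, (d - b) / a]%classic)%R; last first.
  by apply/seteqP; split => x /=;
    rewrite !in_itv/= ltr_pdivrMr// ler_pdivlMr// ltrBlDr lerBrDr (mulrC x).
rewrite !lebesgue_measure_itv/= !lte_fin ltr_pM2r ?invr_gt0// ltrD2r.
case: ifPn => cd; last by rewrite mule0.
by rewrite -!EFinD -EFinM; congr EFin; field; rewrite gt_eqF.
Qed.

End affine.

Section powers.
Context {R : realType}.
Local Notation mu := (@lebesgue_measure R).

Lemma integral_derive (F f : R -> R) (c d : R) : c < d ->
  (forall x, c <= x <= d -> is_derive x 1 F (f x)) ->
  (forall x, c <= x <= d -> {for x, continuous f}) ->
  (\int[mu]_(x in `[c, d]) (f x)%:E = (F d - F c)%:E)%E.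
Proof.
move=> cd dF cf.
have cF x : c <= x <= d -> {for x, continuous F}.
  move=> /dF dFx; apply: differentiable_continuous.
  by apply/derivable1_diffP; exact: ex_derive.
rewrite EFinB; apply: continuous_FTC2 => //.
- apply: continuous_in_subspaceT => x; rewrite mem_setE in_itv/=.
  exact: cf.
- split.
  + by move=> x; rewrite in_itv/= => /andP[/ltW cx /ltW xd];
      have /dF [] : c <= x <= d by rewrite cx.
  + by apply: cvg_at_right_filter; apply: cF; rewrite lexx ltW.
  + by apply: cvg_at_left_filter; apply: cF; rewrite lexx ltW.
- move=> x; rewrite in_itv/= => /andP[/ltW cx /ltW xd].
  have /dF [_ <-] : c <= x <= d by rewrite cx.
  by rewrite derive1E.
Qed.

Lemma continuous_powR_pos (a x : R) : 0 < x ->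
  {for x, continuous (fun y : R => y `^ a)}.
Proof.
move=> x0; apply: differentiable_continuous; apply/derivable1_diffP.
by apply: derivable_powR; rewrite in_itv/= andbT.
Qed.

Lemma integral_powR_0_1_lty (a : R) : 0 < a ->
  (\int[mu]_(x in `]0%R, 1%R]) (x `^ (a - 1))%:E < +oo)%E.
Proof.
move=> a0.
(* The power is smooth on these intervals, which exhaust ]0, 1]; [n.+2] keeps the left end strictly
   below 1. Their integrals stay below 1 / a. *)
pose F (n : nat) : set R := `[n.+2%:R^-1, 1]%classic.
have -> : `]0%R, 1%R]%classic = \bigcup_n F n.
  apply/seteqP; split => x /=.
    rewrite in_itv/= => /andP[x0 x1]; exists (Num.truncn x^-1) => //.
    rewrite /F/= in_itv/= x1 andbT invf_ple ?posrE// ltW//.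
    by apply: (lt_le_trans (truncnS_gt _)); rewrite ler_nat.
  move=> [n _]; rewrite /F/= !in_itv/= => /andP[nx ->]; rewrite andbT.
  exact: lt_le_trans nx.
have mF n : measurable (F n) by exact: measurable_itv.
have mp : measurable_fun setT (fun x : R => (x `^ (a - 1))%:E).
  by apply/measurable_EFinP; exact: measurable_powR.
have ndF : nondecreasing_seq F.
  move=> m n mn; apply/subsetPset => x; rewrite /F/= !in_itv/= => /andP[mx ->].
  by rewrite andbT (le_trans _ mx)// lef_pV2 ?posrE// ler_nat !ltnS.
have cvF : (\int[mu]_(x in F n) (x `^ (a - 1))%:E @[n --> \oo] -->
    \int[mu]_(x in \bigcup_n F n) (x `^ (a - 1))%:E)%E.
  apply: ge0_nondecreasing_set_cvg_integral => //.
  - by move=> n; exact: measurable_funTS.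
  - by move=> n x _; rewrite lee_fin powR_ge0.
apply: (@le_lt_trans _ _ (a^-1)%:E); last exact: ltry.
apply: (cvge_le _ cvF); apply: nearW => n.
rewrite (_ : (\int[mu]_(x in F n) _)%E =
    (a^-1 * 1 `^ a - a^-1 * n.+2%:R^-1 `^ a)%:E); last first.
  apply: (integral_derive (F := fun x => a^-1 * x `^ a)).
  - by rewrite invf_lt1// ltr1n.
  - move=> x /andP[nx _]; have x0 : 0 < x by exact: lt_le_trans nx.
    have -> : x `^ (a - 1) = a^-1 *: (a * x `^ (a - 1)).
      by rewrite /GRing.scale/= mulrA mulVf ?gt_eqF// mul1r.
    by have dp := is_derive1_powR a x0; apply: is_derive_eq.
  - by move=> x /andP[nx _]; apply: continuous_powR_pos; exact: lt_le_trans nx.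
rewrite powR1 mulr1 lee_fin gerBl mulr_ge0// ?powR_ge0//.
by rewrite invr_ge0 ltW.
Qed.

End powers.

Section gamma.
Context {R : realType}.
Local Notation mu := (@lebesgue_measure R).
Local Open Scope ereal_scope.

(** Extended by 0 off (0, +oo), so that integrals run over the whole line and changes of variables
    do not move the domain. *)
Definition gamma_weight (a x : R) : R :=
  if (0 < x)%R then (x `^ (a - 1) * expR (- x))%R else 0%R.

Lemma gamma_weight_ge0 a x : (0 <= gamma_weight a x)%R.
Proof.
by rewrite /gamma_weight; case: ifPn => // _; rewrite mulr_ge0 ?powR_ge0 ?expR_ge0.
Qed.

Lemma measurable_gamma_weight a : measurable_fun setT (gamma_weight a).
Proof.
apply: measurable_fun_ifT => //; first exact: measurable_fun_ltr.
apply: measurable_funM; first exact: measurable_powR.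
by apply: measurableT_comp; [exact: measurable_expR|exact: measurable_funN].
Qed.

Let gamma_weight_ge0e a x : 0 <= (gamma_weight a x)%:E.
Proof. by rewrite lee_fin gamma_weight_ge0. Qed.

Let measurable_gamma_weighte a :
  measurable_fun [set: measurableTypeR R] (fun x => (gamma_weight a x)%:E).
Proof. by apply/measurable_EFinP; exact: measurable_gamma_weight. Qed.

Let measurable_idR : measurable_fun [set: measurableTypeR R] (@id (measurableTypeR R)).
Proof. exact: measurable_id. Qed.

(** Unnormalised Gamma(a) law; for a > 0 its mass is [Gamma_fun a]. *)
Definition gam a : {measure set (measurableTypeR R) -> \bar R} :=
  wpush mu (gamma_weight_ge0e a) (@measurable_gamma_weighte a) measurable_idR.

Lemma gamE a D : gam a D = \int[mu]_(x in D) (gamma_weight a x)%:E.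
Proof. by []. Qed.

Lemma integral_gam a (F : R -> \bar R) : (forall x, 0 <= F x) ->
  measurable_fun setT F ->
  \int[gam a]_x F x = \int[mu]_x (F x * (gamma_weight a x)%:E).
Proof. by move=> F0 mF; rewrite /gam integral_wpush. Qed.

Lemma gamT_lty a : (0 < a)%R -> gam a setT < +oo.
Proof.
move=> a0; rewrite gamE.
pose n := Num.truncn a.
(* For x > 1, x^(a-1) <= x^(n+1) <= (n+1)! 2^(n+1) e^(x/2) by the exponential series; the extra 2
   cancels the rate 1/2 in the exponential density. *)
pose C : R := (2 * (n.+1`!%:R * 2 ^+ n.+1))%R.
have C0 : (0 <= C)%R by rewrite !mulr_ge0.
pose p1 := (fun x : R => (x `^ (a - 1))%:E) \_ `]0%R, 1%R].
have mp1 : measurable_fun [set: measurableTypeR R] p1.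
  apply/(measurable_restrictT _ _).1; first exact: measurable_itv.
  by apply: measurable_funTS; apply/measurable_EFinP; exact: measurable_powR.
have p10 x : 0 <= p1 x.
  by rewrite /p1 patchE; case: ifPn => // _; rewrite lee_fin powR_ge0.
pose p2 := fun x : R => (exponential_pdf (2^-1 : R) x)%:E.
have mp2 : measurable_fun [set: measurableTypeR R] p2.
  by apply/measurable_EFinP; exact: measurable_exponential_pdf.
have p20 x : 0 <= p2 x by rewrite lee_fin exponential_pdf_ge0.
have intp2 : \int[mu]_x p2 x = 1 by apply: integral_exponential_pdf; rewrite invr_gt0.
apply: (@le_lt_trans _ _ (\int[mu]_x (p1 x + C%:E * p2 x))).
  apply: ge0_le_integral => //.
  - by apply: emeasurable_funD => //; exact: measurable_funeM.
  - move=> x _; rewrite /gamma_weight; case: ifPn => x0; last first.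
      by rewrite adde_ge0// mule_ge0.
    have [x1|x1] := leP x 1%R.
      rewrite /p1 patchE mem_set/= ?in_itv/= ?x0//.
      apply: (@le_trans _ _ (x `^ (a - 1))%:E).
        rewrite lee_fin ler_piMr ?powR_ge0// -expR0 ler_expR.
        by rewrite oppr_le0 ltW.
      by rewrite leeDl// mule_ge0.
    apply: (@le_trans _ _ (C%:E * p2 x)); last by rewrite leeDr.
    rewrite /p2 -EFinM lee_fin exponential_pdfE; last exact: ltW.
    have -> : (expR (- x) = expR (- 2^-1 * x) * expR (- 2^-1 * x))%R.
      by rewrite -expRD; congr expR; lra.
    rewrite /= !mulrA ler_wpM2r ?expR_ge0//.
    rewrite -ler_pdivlMr ?expR_gt0// -expRN mulNr opprK.
    have xn : (x `^ (a - 1) <= x ^+ n.+1)%R.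
      rewrite -(powR_mulrn _ (ltW x0)) (ler_powR (ltW x1))//.
      by apply: (@le_trans _ _ a); [rewrite gerBl|apply/ltW/truncnS_gt].
    apply: (le_trans xn).
    have h2 : (0 <= 2^-1 * x)%R by rewrite mulr_ge0 ?invr_ge0// ltW.
    have := expR_ge1Dxn n h2.
    have f0 : (0 < n.+1`!%:R :> R)%R by rewrite ltr0n fact_gt0.
    move=> h3; have {}h3 : ((2^-1 * x) ^+ n.+1 / n.+1`!%:R <= expR (2^-1 * x))%R.
      by apply: le_trans h3; rewrite lerDr.
    move: h3; rewrite ler_pdivrMr// exprMn exprVn ler_pdivrMl ?exprn_gt0//.
    move=> /le_trans; apply.
    by rewrite /C [leLHS](_ : _ = 2 * (n.+1`!%:R * 2 ^+ n.+1) * 2^-1 * expR (2^-1 * x))%R//; field.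
rewrite ge0_integralD//; last 2 first.
- by move=> x _; rewrite mule_ge0.
- exact: measurable_funeM.
rewrite ge0_integralZl// intp2 mule1 lte_add_pinfty ?ltry//.
by rewrite -integral_mkcond; exact: integral_powR_0_1_lty.
Qed.

Lemma gamT_gt0 a : 0 < gam a setT.
Proof.
rewrite lt_neqAle measure_ge0 andbT eq_sym; apply/eqP => g0.
have : \int[mu]_x `|(gamma_weight a x)%:E| = 0.
  by rewrite -[RHS]g0 gamE; apply: eq_integral => x _; rewrite gee0_abs.
move/ae_eq_integral_abs => /(_ measurableT (measurable_gamma_weighte a)) [N [mN N0 sN]].
suff : mu `]0%R, 1%R[%classic <= mu N.
  by rewrite N0 lebesgue_measure_itv/= lte_fin ltr01 oppr0 adde0 lee_fin ler10.
apply: le_measure; rewrite ?inE//.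
move=> x /=; rewrite in_itv/= => /andP[x0 x1]; apply: sN => /= /(_ I).
rewrite /gamma_weight x0 => -[] /eqP; rewrite mulf_eq0 gt_eqF ?powR_gt0//=.
by rewrite gt_eqF ?expR_gt0.
Qed.

Lemma Gamma_funE a : Gamma_fun a = fine (gam a setT).
Proof.
rewrite /Gamma_fun /Rintegral gamE; congr fine.
rewrite [LHS]integral_mkcond; apply: eq_integral => x _.
rewrite patchE /gamma_weight mem_setE in_itv/= andbT.
by case: ifP.
Qed.

Lemma EFin_Gamma_fun a : (0 < a)%R -> (Gamma_fun a)%:E = gam a setT.
Proof.
move=> a0; rewrite Gamma_funE fineK// ge0_fin_numE; first exact: gamT_lty.
exact: measure_ge0.
Qed.

Lemma Gamma_fun_gt0 (a : R) : (0 < a)%R -> (0 < Gamma_fun a)%R.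
Proof. by move=> a0; rewrite -lte_fin EFin_Gamma_fun// gamT_gt0. Qed.

Lemma gamma_weight_scale a (l x : R) : (0 < l)%R ->
  (gamma_weight a (l * x) * l = l `^ a *
    (if 0 < x then x `^ (a - 1) * expR (- (l * x)) else 0))%R.
Proof.
move=> l0; rewrite /gamma_weight pmulr_rgt0//; case: ifPn => x0; last first.
  by rewrite mul0r mulr0.
have -> : (l `^ a = l * l `^ (a - 1))%R.
  have := @powRD R l 1 (a - 1); rewrite (gt_eqF l0) implybT powRr1 ?ltW//.
  by move=> <-//; rewrite addrC subrK.
by rewrite powRM ?ltW//; ring.
Qed.

Lemma laplace_gam a (l : R) : (0 <= l)%R ->
  \int[gam a]_x (expR (- (l * x)))%:E = ((1 + l) `^ (- a))%:E * gam a setT.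
Proof.
move=> l0; have l1 : (0 < 1 + l)%R by lra.
rewrite integral_gam; last 2 first.
- by move=> x; rewrite lee_fin expR_ge0.
- apply/measurable_EFinP; apply: measurableT_comp; first exact: measurable_expR.
  by apply: measurable_funN; exact: measurable_funM.
rewrite gamE (integral_affine (F := fun x => (gamma_weight a x)%:E) 0 l1)//.
have -> : \int[mu]_x ((gamma_weight a ((1 + l) * x + 0))%:E * (1 + l)%:E) =
    ((1 + l) `^ a)%:E * \int[mu]_x ((expR (- (l * x)))%:E * (gamma_weight a x)%:E).
  rewrite -ge0_integralZl//; last 3 first.
  - apply: emeasurable_funM => //; apply/measurable_EFinP.
    apply: measurableT_comp; first exact: measurable_expR.
    by apply: measurable_funN; exact: measurable_funM.
  - by move=> x _; rewrite mule_ge0// lee_fin expR_ge0.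
  - by rewrite lee_fin powR_ge0.
  apply: eq_integral => x _; rewrite addr0 -!EFinM gamma_weight_scale//.
  rewrite /gamma_weight; congr (_ * _)%:E; case: ifPn; rewrite ?mulr0// => x0.
  by rewrite mulrCA -expRD; congr (_ * expR _)%R; ring.
rewrite muleA -EFinM -powRD; last by rewrite (gt_eqF l1) implybT.
  by rewrite addNr powRr0 mul1e.
exact: measurable_gamma_weighte.
Qed.

End gamma.

Section beta_gamma.
Context {R : realType}.
Local Notation mu := (@lebesgue_measure R).
Local Open Scope ereal_scope.

Lemma measurable_inv : measurable_fun [set: R] (@GRing.inv R).
Proof.
rewrite (_ : @GRing.inv R = fun x => if (0 <= x)%R then (x `^ (-1))%R
    else (- ((- x) `^ (-1)))%R); last first.
  apply/funext => x; case: ifPn => x0; first by rewrite powR_inv1.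
  by rewrite powR_inv1 ?invrN ?opprK// oppr_ge0 ltW// ltNge.
apply: measurable_fun_ifT; first exact: measurable_fun_ler.
  exact: measurable_powR.
apply: measurable_funN; apply: (measurableT_comp (measurable_powR (-1))).
exact: measurable_funN.
Qed.

Lemma measurable_funV d (T : measurableType d) (f : T -> R) :
  measurable_fun setT f -> measurable_fun setT (fun x => (f x)^-1%R).
Proof. by move=> mf; exact: (measurableT_comp measurable_inv). Qed.

Definition beta_density (a b u : R) : R :=
  if (0 < u < 1)%R then beta_weight a b u else 0%R.

Lemma beta_weight_ge0 (a b u : R) : (0 <= beta_weight a b u)%R.
Proof. by rewrite mulr_ge0// powR_ge0. Qed.

Lemma measurable_beta_weight (a b : R) : measurable_fun setT (beta_weight a b).
Proof.
apply: measurable_funM; first exact: measurable_powR.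
apply: (measurableT_comp (measurable_powR (b - 1))).
exact: measurable_funB.
Qed.

(** Substituting x = s u and t = s (1 - u), with Jacobian s, factors the joint density of two Gamma
    variables into a function of the sum s and a function of the ratio u. *)
Lemma gamma_weight_split (a b s u : R) : (0 < s)%R ->
  (gamma_weight b (s - s * u) * gamma_weight a (s * u) * s =
   gamma_weight (a + b) s * beta_density a b u)%R.
Proof.
move=> s0; rewrite /gamma_weight /beta_density s0 pmulr_rgt0// subr_gt0 gtr_pMr//.
case: ifPn => [u1|]; case: ifPn => u0; rewrite ?andbF ?mulr0 ?mul0r//= ?mulr0 ?mul0r//.
rewrite /beta_weight.
have -> : (s - s * u = s * (1 - u))%R by ring.
have u1' : (0 <= 1 - u)%R by rewrite subr_ge0 ltW.
rewrite !powRM ?(ltW s0) ?(ltW u0) ?u1'//.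
have -> : (s `^ (a + b - 1) = s `^ (a - 1) * s `^ (b - 1) * s)%R.
  rewrite (_ : a + b - 1 = (a - 1) + (b - 1) + 1)%R; last ring.
  by rewrite !powRD ?(gt_eqF s0) ?implybT// (powRr1 (ltW s0)).
have -> : (expR (- s) = expR (- (s * (1 - u))) * expR (- (s * u)))%R.
  by rewrite -expRD; congr expR; ring.
ring.
Qed.

(** Unnormalised form of a classical fact: for independent Gamma(a) and Gamma(b) variables, the
    ratio of the first to the sum is Beta(a, b) and independent of the sum, which is Gamma(a + b).
    The inner variable is shifted to s = x + t, Tonelli exchanges the integrals, and x = s u brings
    in [gamma_weight_split]. *)
Lemma integral_gam_gam (a b : R) (F G : R -> \bar R) :
  (forall x, 0 <= F x) -> measurable_fun setT F ->
  (forall x, 0 <= G x) -> measurable_fun setT G ->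
  \int[gam a]_x \int[gam b]_t (F (x / (x + t))%R * G (x + t)%R) =
  (\int[mu]_(u in `]0%R, 1%R[) (F u * (beta_weight a b u)%:E)) *
  \int[gam (a + b)]_s G s.
Proof.
move=> F0 mF G0 mG.
have w0 c x : 0 <= (gamma_weight c x)%:E :> \bar R.
  by rewrite lee_fin gamma_weight_ge0.
have mw c : measurable_fun setT (fun x : R => (gamma_weight c x)%:E).
  by apply/measurable_EFinP; exact: measurable_gamma_weight.
pose K' (z : measurableTypeR R * measurableTypeR R) : \bar R :=
  F (z.1 / z.2)%R * G z.2 * (gamma_weight b (z.2 - z.1))%:E.
have K'0 z : 0 <= K' z by rewrite !mule_ge0.
have mK' : measurable_fun setT K'.
  apply: emeasurable_funM; last first.
    apply: (measurableT_comp (mw b)).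
    by apply: measurable_funB; [exact: measurable_snd|exact: measurable_fst].
  apply: emeasurable_funM; last first.
    by apply: (measurableT_comp mG); exact: measurable_snd.
  apply: (measurableT_comp mF); apply: measurable_funM.
    exact: measurable_fst.
  by apply: measurable_funV; exact: measurable_snd.
pose K z := K' z * (gamma_weight a z.1)%:E.
have K0 z : 0 <= K z by rewrite mule_ge0.
have mK : measurable_fun setT K.
  apply: emeasurable_funM => //.
  by apply: (measurableT_comp (mw a)); exact: measurable_fst.
have mH x : measurable_fun [set: R]
    (fun t => F (x / (x + t))%R * G (x + t)%R).
  apply: emeasurable_funM.
    apply: (measurableT_comp mF); apply: measurable_funM => //.
    by apply: measurable_funV; exact: measurable_funD.
  by apply: (measurableT_comp mG); exact: measurable_funD.
have inner x : \int[gam b]_t (F (x / (x + t))%R * G (x + t)%R) =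
    \int[mu]_s (F (x / s)%R * G s * (gamma_weight b (s - x))%:E).
  rewrite integral_gam//; last by move=> t; rewrite mule_ge0.
  rewrite (integral_affine (F := fun t => F (x / (x + t))%R * G (x + t)%R *
    (gamma_weight b t)%:E) (- x)%R (@ltr01 R)).
  - apply: eq_integral => s _; rewrite mule1 mul1r.
    by have -> : (x + (s - x) = s)%R by ring.
  - by move=> t; rewrite !mule_ge0.
  - by apply: emeasurable_funM.
under eq_integral do rewrite inner.
have mI x : measurable_fun [set: R]
    (fun s => F (x / s)%R * G s * (gamma_weight b (s - x))%:E).
  apply: emeasurable_funM; last first.
    by apply: (measurableT_comp (mw b)); exact: measurable_funB.
  apply: emeasurable_funM => //; apply: (measurableT_comp mF).
  apply: measurable_funM => //; exact: measurable_funV.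
have I0 x s : 0 <= F (x / s)%R * G s * (gamma_weight b (s - x))%:E.
  by rewrite !mule_ge0.
rewrite [in LHS]integral_gam; last 2 first.
- by move=> x; apply: integral_ge0 => s _; exact: I0.
- exact: (measurable_fun_fubini_tonelli_F (m2 := mu) _ mK' K'0).
transitivity (\int[mu]_x \int[mu]_s K (x, s)).
  by apply: eq_integral => x _; rewrite -ge0_integralZr//; exact: mI.
rewrite (fubini_tonelli (m1 := mu) (m2 := mu) _ mK K0).
have mGw : measurable_fun [set: R] (fun s => G s * (gamma_weight (a + b) s)%:E).
  exact: emeasurable_funM.
have mFb : measurable_fun [set: R] (fun u => F u * (beta_weight a b u)%:E).
  apply: emeasurable_funM => //.
  by apply/measurable_EFinP; exact: measurable_beta_weight.
rewrite integral_gam// muleC -ge0_integralZr//; last 2 first.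
- by move=> x _; rewrite mule_ge0.
- by apply: integral_ge0 => u _; rewrite mule_ge0// lee_fin beta_weight_ge0.
apply: eq_integral => s _.
have [s0|s0] := ltP 0%R s; last first.
  rewrite [in RHS]/gamma_weight ltNge s0/= mule0 mul0e integral0_eq// => x _.
  rewrite /K/K'/= /gamma_weight subr_gt0.
  case: ifPn => xs; last by rewrite mule0 mul0e.
  by rewrite ltNge (le_trans (ltW xs) s0)/= mule0.
rewrite (integral_affine (F := fun x => K (x, s)) 0%R s0)//; last first.
  exact: (measurable_fun_pair1 s mK).
rewrite -ge0_integralZl//; last 3 first.
- by apply: measurable_funTS; exact: mFb.
- by move=> u _; rewrite mule_ge0// lee_fin beta_weight_ge0.
- by rewrite mule_ge0.
rewrite [in RHS]integral_mkcond.
apply: eq_integral => u _; rewrite addr0 /K/K'/=.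
have -> : (s * u / s = u)%R by field; rewrite gt_eqF.
rewrite -!muleA -!EFinM mulrA gamma_weight_split// patchE mem_setE in_itv/=.
rewrite /beta_density; case: ifPn => _; last by rewrite !mulr0 !mule0.
by rewrite EFinM [RHS]muleCA -!muleA.
Qed.

End beta_gamma.

(** * The Laplace exponent of rho_G *)

Section exp_average.
Context {R : realType}.
Local Notation mu := (@lebesgue_measure R).
Local Open Scope ereal_scope.

(** For x > 0 and l > 0 this is (1 - e^{-l x}) / x; as an integral over s it lets Tonelli reduce
    everything to Laplace transforms of Gamma laws. *)
Definition exp_average (l x : R) : \bar R :=
  \int[mu]_(s in `[0%R, l]) (expR (- (s * x)))%:E.

Lemma exp_average_ge0 l x : 0 <= exp_average l x.
Proof. by apply: integral_ge0 => s _; rewrite lee_fin expR_ge0. Qed.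

Lemma exp_averageE (l x : R) : (0 < l)%R ->
  (1 - expR (- (l * Num.max x 0)))%:E = (Num.max x 0)%:E * exp_average l x.
Proof.
move=> l0; have [x0|x0] := ltP 0%R x; last first.
  by rewrite mulr0 oppr0 expR0 subrr mul0e.
rewrite /exp_average.
have -> : \int[mu]_(s in `[0%R, l]) (expR (- (s * x)))%:E =
    (- x^-1 * expR (- x * l) - - x^-1 * expR (- x * 0))%:E.
  apply: (integral_derive (F := fun s => - x^-1 * expR (- x * s))%R) => //.
  - move=> s _.
    have d1 : is_derive s 1%R (fun s => - x * s)%R (- x)%R.
      by apply: (is_derive_eq (is_deriveZ _ _)); rewrite /GRing.scale/= mulr1.
    have d2 := is_derive1_comp (is_derive_expR (- x * s)%R) d1.
    apply: (is_derive_eq (is_deriveZ (- x^-1)%R d2)).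
    rewrite /GRing.scale/= mulrCA mulrNN mulVf ?gt_eqF// mulr1.
    by congr expR; ring.
  - move=> s _.
    apply: (continuous_comp (f := fun s : R => (- (s * x))%R)).
      by apply: cvgN; apply: cvgM; [exact: cvg_id|exact: cvg_cst].
    exact: continuous_expR.
rewrite mulr0 expR0 -EFinM !mulNr (mulrC x l); congr EFin.
by field; rewrite gt_eqF.
Qed.

Let E l (z : measurableTypeR R * measurableTypeR R) : \bar R :=
  (expR (- (z.2 * z.1)) * \1_(`[0%R, l]%classic : set R) z.2)%:E.

Let E0 l z : 0 <= E l z.
Proof. by rewrite lee_fin mulr_ge0 ?expR_ge0. Qed.

Let mE l : measurable_fun setT (E l).
Proof.
apply/measurable_EFinP; apply: measurable_funM.
  apply: (measurableT_comp (@measurable_expR R)); apply: measurable_funN.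
  by apply: measurable_funM; [exact: measurable_snd|exact: measurable_fst].
by apply: measurableT_comp; [exact: measurable_indic|exact: measurable_snd].
Qed.

Let exp_averageET l : exp_average l = fun x => \int[mu]_s E l (x, s).
Proof.
apply/funext => x; rewrite /exp_average integral_mkcond.
apply: eq_integral => s _.
by rewrite patchE /E/= indicE mem_setE; case: ifPn; rewrite ?mulr1 ?mulr0.
Qed.

Lemma measurable_exp_average l : measurable_fun [set: R] (exp_average l).
Proof.
rewrite exp_averageET.
exact: (measurable_fun_fubini_tonelli_F (m2 := mu) _ (@mE l) (@E0 l)).
Qed.

(** By Tonelli and [laplace_gam] this is the integral of (1 + s)^(-a) over [0, l] times the mass of
    [gam a]; a = 1 would give a logarithm. *)
Lemma integral_gam_exp_average (a l : R) : (0 < l)%R -> a != 1%R ->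
  \int[gam a]_x exp_average l x =
  (((1 + l) `^ (1 - a) - 1) / (1 - a))%:E * gam a setT.
Proof.
move=> l0 a1; have a1' : (1 - a != 0)%R by rewrite subr_eq0 eq_sym.
have mw : measurable_fun [set: R] (fun x => (gamma_weight a x)%:E).
  by apply/measurable_EFinP; exact: measurable_gamma_weight.
rewrite integral_gam; last 2 first.
- by move=> x; exact: exp_average_ge0.
- exact: measurable_exp_average.
have mEw : measurable_fun setT
    (fun z : measurableTypeR R * measurableTypeR R =>
       E l z * (gamma_weight a z.1)%:E).
  apply: emeasurable_funM => //.
  by apply: (measurableT_comp mw); exact: measurable_fst.
have Ew0 z : 0 <= E l z * (gamma_weight a z.1)%:E.
  by rewrite mule_ge0// lee_fin gamma_weight_ge0.
transitivity (\int[mu]_x \int[mu]_s (E l (x, s) * (gamma_weight a x)%:E)).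
  apply: eq_integral => x _; rewrite exp_averageET.
  rewrite -ge0_integralZr//; last by rewrite lee_fin gamma_weight_ge0.
  exact: (measurable_fun_pair2 x (@mE l)).
rewrite (fubini_tonelli (m1 := mu) (m2 := mu) _ mEw Ew0)/=.
transitivity (\int[mu]_(s in `[0%R, l]) (gam a setT * ((1 + s) `^ (- a))%:E)).
  rewrite [RHS]integral_mkcond; apply: eq_integral => s _.
  rewrite patchE mem_setE in_itv/=; case: ifPn => sl; last first.
    rewrite integral0_eq// => x _.
    by rewrite /E/= indicE mem_setE in_itv/= (negbTE sl) mulr0 mul0e.
  have s0 : (0 <= s)%R by case/andP : sl.
  rewrite muleC -laplace_gam// integral_gam; last 2 first.
  - by move=> x; rewrite lee_fin expR_ge0.
  - apply/measurable_EFinP; apply: (measurableT_comp (@measurable_expR R)).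
    by apply: measurable_funN; exact: measurable_funM.
  apply: eq_integral => x _.
  by rewrite /E/= indicE mem_setE in_itv/= sl mulr1.
rewrite ge0_integralZl//; last 2 first.
- apply/measurable_EFinP; apply: measurable_funTS.
  apply: (measurableT_comp (measurable_powR (- a))).
  exact: measurable_funD.
- by move=> s _; rewrite lee_fin powR_ge0.
rewrite muleC; congr (_ * _).
have -> : \int[mu]_(s in `[0%R, l]) ((1 + s) `^ (- a))%:E =
    ((1 - a)^-1 * (1 + l) `^ (1 - a) - (1 - a)^-1 * (1 + 0) `^ (1 - a))%:E.
  apply: (integral_derive (F := fun s => (1 - a)^-1 * (1 + s) `^ (1 - a))%R) => //.
  - move=> s /andP[s0 _]; have s1 : (0 < 1 + s)%R by lra.
    have d1 : is_derive s 1%R (fun s => 1 + s)%R 1%R.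
      have -> : (fun s : R => 1 + s)%R = (cst 1 + id)%R by apply/funext.
      by apply: is_derive_eq; rewrite add0r.
    have d2 := is_derive1_comp (is_derive1_powR (1 - a)%R s1) d1.
    apply: (is_derive_eq (is_deriveZ (1 - a)^-1%R d2)).
    rewrite /GRing.scale/= mulr1 mulrA mulVf// mul1r.
    by congr (_ `^ _)%R; ring.
  - move=> s /andP[s0 _]; have s1 : (0 < 1 + s)%R by lra.
    apply: (continuous_comp (f := fun s : R => (1 + s)%R)
      (g := fun y => y `^ (- a))%R).
      by apply: cvgD; [exact: cvg_cst|exact: cvg_id].
    exact: continuous_powR_pos.
by rewrite addr0 powR1; congr EFin; field.
Qed.

Lemma gamma_weightS (a x : R) :
  gamma_weight (a + 1) x = (Num.max x 0 * gamma_weight a x)%R.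
Proof.
rewrite /gamma_weight; case: ifPn => x0; last by rewrite mulr0.
rewrite (max_idPl (ltW x0)) mulrA; congr (_ * _)%R.
have := @powRD _ x 1 (a - 1); rewrite (gt_eqF x0) implybT => /(_ isT).
by rewrite (powRr1 (ltW x0)) => <-; congr (x `^ _)%R; ring.
Qed.

(** Compute the integral of (1 - e^{-x}) against [gam a] in two ways: directly it is (1 - 2^(-a))
    Gamma(a); moving a factor x into the density, it is the integral of [exp_average 1] against
    [gam (a + 1)], that is (1 - 2^(-a)) / a times Gamma(a + 1). *)
Lemma Gamma_funS (a : R) : (0 < a)%R ->
  (Gamma_fun (a + 1) = a * Gamma_fun a)%R.
Proof.
move=> a0; have a10 : (0 < a + 1)%R by lra.
have := @integral_gam_exp_average (a + 1) 1 ltr01.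
have -> : (a + 1 != 1)%R by rewrite -subr_eq0 addrK gt_eqF.
move=> /(_ isT).
rewrite integral_gam; last 2 first.
- by move=> x; exact: exp_average_ge0.
- exact: measurable_exp_average.
pose p x := (1 - expR (- (1 * Num.max x 0)))%R : R.
have p0 x : (0 <= p x)%R.
  by rewrite /p mul1r subr_ge0 -expR0 ler_expR oppr_le0 le_max lexx orbT.
have mp : measurable_fun [set: R] p.
  apply: measurable_funB => //; apply: (measurableT_comp (@measurable_expR R)).
  by apply: measurable_funN; apply: measurable_funM => //; exact: measurable_maxr.
have -> : \int[mu]_x (exp_average 1 x * (gamma_weight (a + 1) x)%:E) =
    \int[gam a]_x (p x)%:E.
  rewrite integral_gam//; last exact/measurable_EFinP.
  apply: eq_integral => x _.
  by rewrite /p exp_averageE// gamma_weightS EFinM muleA; congr (_ * _); rewrite muleC.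
have : \int[gam a]_x (p x)%:E + \int[gam a]_x (expR (- (1 * x)))%:E = gam a setT.
  have me : measurable_fun [set: R] (fun x : R => (expR (- (1 * x)))%:E).
    apply/measurable_EFinP; apply: (measurableT_comp (@measurable_expR R)).
    by apply: measurable_funN; exact: measurable_funM.
  have mw : measurable_fun [set: R] (fun x => (gamma_weight a x)%:E).
    by apply/measurable_EFinP; exact: measurable_gamma_weight.
  have mpe : measurable_fun [set: R] (fun x => (p x)%:E) by exact/measurable_EFinP.
  rewrite !integral_gam//.
  rewrite gamE -ge0_integralD//.
  - apply: eq_integral => x _; rewrite -!EFinM -EFinD; congr EFin.
    rewrite /p /gamma_weight; case: ifPn => x0; last by rewrite !mulr0 addr0.
    by rewrite (max_idPl (ltW x0)); ring.
  - by move=> x _; apply: mule_ge0; rewrite lee_fin// gamma_weight_ge0.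
  - exact: emeasurable_funM.
  - by move=> x _; apply: mule_ge0; rewrite lee_fin ?expR_ge0 ?gamma_weight_ge0.
  - exact: emeasurable_funM.
rewrite laplace_gam// => + h; rewrite h -!EFin_Gamma_fun// -!EFinM -EFinD.
move=> [].
have -> : (1 - (a + 1) = - a)%R by ring.
have n0 : (1 - (1 + 1) `^ (- a) != 0)%R.
  rewrite subr_eq0 eq_sym powRN lt_eqF// invf_lt1 ?powR_gt0//.
  have := @gt0_ltr_powR R a a0 1%R (1 + 1)%R; rewrite powR1 !nnegrE.
  by apply; lra.
rewrite addrC => e; apply: (mulfI n0).
have -> : ((1 - (1 + 1) `^ (- a)) * Gamma_fun (a + 1) =
    a * (((1 + 1) `^ (- a) - 1) / (- a) * Gamma_fun (a + 1)))%R.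
  by field; rewrite gt_eqF.
by rewrite (canRL (addKr _) e); ring.
Qed.

End exp_average.

Section levy_measure.
Context {R : realType}.
Local Notation mu := (@lebesgue_measure R).
Local Open Scope ereal_scope.
Variable alpha : R.

Definition levy_weight (x : R) : R := if (0 < x)%R then rho_G alpha x else 0%R.

Hypotheses (alpha_gt0 : (0 < alpha)%R) (alpha_lt1 : (alpha < 1)%R).

Let alpha1 : (0 < 1 - alpha)%R. Proof. by rewrite subr_gt0. Qed.

Lemma levy_coef_ge0 : (0 <= alpha / Gamma_fun (1 - alpha))%R.
Proof. by rewrite divr_ge0// ltW// Gamma_fun_gt0. Qed.

Lemma levy_weight_ge0 x : (0 <= levy_weight x)%R.
Proof.
rewrite /levy_weight; case: ifPn => // _.
by rewrite !mulr_ge0 ?powR_ge0 ?expR_ge0// ltW// invr_gt0 Gamma_fun_gt0.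
Qed.

Lemma measurable_levy_weight : measurable_fun setT levy_weight.
Proof.
apply: measurable_fun_ifT => //; first exact: measurable_fun_ltr.
apply: measurable_funM.
  by apply: measurable_funM => //; exact: measurable_powR.
by apply: measurableT_comp; [exact: measurable_expR|exact: measurable_funN].
Qed.

Let levy_weight_ge0e (x : measurableTypeR R) : 0 <= (levy_weight x)%:E.
Proof. by rewrite lee_fin levy_weight_ge0. Qed.

Let measurable_levy_weighte :
  measurable_fun [set: measurableTypeR R] (fun x => (levy_weight x)%:E).
Proof. by apply/measurable_EFinP; exact: measurable_levy_weight. Qed.

Let measurable_idR :
  measurable_fun [set: measurableTypeR R] (@id (measurableTypeR R)).
Proof. exact: measurable_id. Qed.

Definition Pi : {measure set (measurableTypeR R) -> \bar R} :=
  wpush mu levy_weight_ge0e measurable_levy_weighte measurable_idR.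

Lemma integral_Pi (F : R -> \bar R) : (forall x, 0 <= F x) ->
  measurable_fun setT F ->
  \int[Pi]_x F x = \int[mu]_x (F x * (levy_weight x)%:E).
Proof. by move=> F0 mF; rewrite /Pi integral_wpush. Qed.

Lemma integral_Pi_rho (f : R -> R) : (forall x, 0 <= f x)%R ->
  measurable_fun setT f ->
  \int[Pi]_x (f x)%:E = \int[mu]_(x in `]0%R, +oo[) (f x * rho_G alpha x)%:E.
Proof.
move=> f0 mf; rewrite integral_Pi//; last exact/measurable_EFinP.
rewrite [RHS]integral_mkcond; apply: eq_integral => x _.
rewrite patchE mem_setE in_itv/= andbT /levy_weight.
by case: ifPn => _; rewrite ?mule0// EFinM.
Qed.

(** x [rho_G](x) is proportional to the Gamma(1 - alpha) density. This is the source of the first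
    parameter of the beta laws. *)
Lemma integral_Pi_id (h : R -> \bar R) : (forall x, 0 <= h x) ->
  measurable_fun setT h ->
  \int[Pi]_x ((Num.max x 0)%:E * h x) =
  (alpha / Gamma_fun (1 - alpha))%:E * \int[gam (1 - alpha)]_x h x.
Proof.
move=> h0 mh.
have mm : measurable_fun [set: R] (fun x : R => (Num.max x 0)%:E).
  by apply/measurable_EFinP; exact: measurable_maxr.
have mw : measurable_fun [set: R]
    (fun x => h x * (gamma_weight (1 - alpha) x)%:E).
  apply: emeasurable_funM => //.
  by apply/measurable_EFinP; exact: measurable_gamma_weight.
rewrite integral_Pi; last 2 first.
- by move=> x; rewrite mule_ge0// lee_fin le_max lexx orbT.
- exact: emeasurable_funM.
rewrite integral_gam// -ge0_integralZl//; last 2 first.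
- by move=> x _; rewrite mule_ge0// lee_fin gamma_weight_ge0.
- by rewrite lee_fin levy_coef_ge0.
apply: eq_integral => x _.
rewrite /levy_weight /gamma_weight; case: ifPn => x0; last by rewrite !mule0.
rewrite (max_idPl (ltW x0)) muleAC -EFinM [RHS]muleCA muleC -EFinM.
congr (_ * _%:E).
have -> : (x `^ (1 - alpha - 1) = x * x `^ (- alpha - 1))%R.
  have := @powRD _ x 1 (- alpha - 1); rewrite (gt_eqF x0) implybT => /(_ isT).
  by rewrite (powRr1 (ltW x0)) => <-; congr (x `^ _)%R; ring.
by rewrite /rho_G; ring.
Qed.

Lemma laplace_Pi (l : R) : (0 <= l)%R ->
  \int[Pi]_x (1 - expR (- (l * Num.max x 0)))%:E = ((1 + l) `^ alpha - 1)%:E.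
Proof.
rewrite le_eqVlt => /predU1P[<-|l0].
  rewrite addr0 powR1 subrr integral0_eq// => x _.
  by rewrite mul0r oppr0 expR0 subrr.
under eq_integral do rewrite exp_averageE//.
rewrite integral_Pi_id//; last 2 first.
- by move=> x; exact: exp_average_ge0.
- exact: measurable_exp_average.
rewrite (integral_gam_exp_average l0); last first.
  by rewrite -subr_eq0 addrAC subrr sub0r oppr_eq0 gt_eqF.
rewrite -EFin_Gamma_fun// -!EFinM; congr EFin.
have -> : (1 - (1 - alpha) = alpha)%R by ring.
by field; rewrite !gt_eqF// Gamma_fun_gt0.
Qed.

End levy_measure.

(** * Moments determine a law on the unit interval *)

Section bernstein.
Context {R : realType}.

(** Bernstein polynomial: the mean of [g] at a Binomial(n, y) variable, computed by conditioning on
    one trial. The recursion is the one that mixed moments satisfy. *)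
Fixpoint bernstein (n : nat) (g : nat -> R) (y : R) : R :=
  if n is m.+1 then (1 - y) * bernstein m g y + y * bernstein m (g \o S) y
  else g 0%N.

Lemma bernstein_le n g1 g2 y : 0 <= y <= 1 -> (forall j, g1 j <= g2 j) ->
  bernstein n g1 y <= bernstein n g2 y.
Proof.
move=> /andP[y0 y1]; elim: n g1 g2 => [|n IH] g1 g2 g12 /=; first exact: g12.
by apply: lerD; apply: ler_wpM2l; rewrite ?subr_ge0 ?IH// => j; exact: g12.
Qed.

Lemma bernstein_ge0 n g y : 0 <= y <= 1 -> (forall j, 0 <= g j) ->
  0 <= bernstein n g y.
Proof.
move=> /andP[y0 y1]; elim: n g => [|n IH] g g0 /=; first exact: g0.
by apply: addr_ge0; apply: mulr_ge0; rewrite ?subr_ge0 ?IH// => j; exact: g0.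
Qed.

(** Second moment of a binomial variable about [c]: variance n y (1 - y) plus squared bias. *)
Lemma bernstein_quadratic n (a b c y : R) :
  bernstein n (fun j => a + b * (j%:R - c) ^+ 2) y =
  a + b * (n%:R * y * (1 - y) + (n%:R * y - c) ^+ 2).
Proof.
elim: n c => [|n IH] c /=; first by rewrite !mul0r !add0r.
have -> : (fun j => a + b * (j%:R - c) ^+ 2) \o S =
    (fun j => a + b * (j%:R - (c - 1)) ^+ 2).
  by apply/funext => j /=; rewrite -natr1; ring.
by rewrite !IH -(natr1 n); ring.
Qed.

Lemma measurable_bernstein n g : measurable_fun setT (bernstein n g).
Proof.
elim: n g => [|n IH] g //=.
apply: measurable_funD; apply: measurable_funM => //.
exact: measurable_funB.
Qed.

(** For d > 0, a continuous substitute for the indicator of ]-oo, x]: 1 up to x, 0 from x + d on,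
    with slope -1/d in between. *)
Definition ramp (x d y : R) : R := Num.max 0 (Num.min 1 ((x + d - y) / d)).

Lemma ramp_ge0 x d y : 0 <= ramp x d y.
Proof. by rewrite /ramp le_max lexx. Qed.

Lemma ramp_ge1 x d y : 0 < d -> y <= x -> 1 <= ramp x d y.
Proof.
move=> d0 yx; rewrite /ramp le_max le_min lexx/=; apply/orP; right.
by rewrite ler_pdivlMr// mul1r; lra.
Qed.

Lemma ramp_le x d y : 0 < d -> ramp x d y <= (y <= x + d)%R%:R.
Proof.
move=> d0; rewrite /ramp; case: (leP y (x + d)) => h.
  by rewrite /= ge_max ler01/= ge_min lexx.
rewrite ge_max lexx/= ge_min ler_pdivrMr// mul0r; apply/orP; right.
lra.
Qed.

Lemma ramp_lip x d u v : 0 < d -> ramp x d u <= ramp x d v + `|u - v| / d.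
Proof.
move=> d0; rewrite /ramp.
have e0 : 0 <= `|u - v| / d by rewrite divr_ge0// ltW.
have e1 : (x + d - u) / d <= (x + d - v) / d + `|u - v| / d.
  rewrite -mulrDl ler_pM2r ?invr_gt0//; have := ler_norm (v - u).
  by rewrite distrC; lra.
move: e0 e1; set a := _ / d; set b := (x + d - v) / d; set c := _ / d => c0 ab.
rewrite ge_max; apply/andP; split.
  by rewrite addr_ge0// le_max lexx.
rewrite ge_min; have [b1|b1] := leP 1 b.
  by rewrite (max_r ler01) lerDl c0.
apply/orP; right; rewrite (le_trans ab)// lerD2r.
by rewrite le_max lexx orbT.
Qed.

(** Bernstein's argument: the error at z is at most the mean of |j/n - z| / d, which is bounded by a
    quadratic whose mean is known. *)
Lemma ramp_bernstein x d e : 0 < d -> 0 < e -> exists n : nat,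
  forall z : R, 0 <= z <= 1 ->
    bernstein n (fun j => ramp x d (j%:R / n%:R)) z <= ramp x d z + e /\
    ramp x d z <= bernstein n (fun j => ramp x d (j%:R / n%:R)) z + e.
Proof.
(* n > 1 / (d e)^2 makes the variance term [b] n z (1 - z) at most e / 2. *)
move=> d0 e0; pose n := (Num.truncn ((d * e) ^+ 2)^-1).+1; exists n => z z01.
have de0 : 0 < (d * e) ^+ 2 by rewrite exprn_gt0// mulr_gt0.
have n0 : 0 < n%:R :> R by rewrite ltr0n.
(* The value that turns the difference of the two sides of [amgm] into the square (|t| / d - e)^2 /
   (2 e). *)
pose b := (2 * d ^+ 2 * e * n%:R ^+ 2)^-1.
have amgm (j : nat) : `|j%:R / n%:R - z| / d <= e / 2 + b * (j%:R - n%:R * z) ^+ 2.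
  set t := j%:R / n%:R - z.
  have -> : (j%:R - n%:R * z) ^+ 2 = n%:R ^+ 2 * `|t| ^+ 2.
    by rewrite real_normK ?num_real// /t; field; rewrite gt_eqF.
  rewrite -subr_ge0.
  have -> : e / 2 + b * (n%:R ^+ 2 * `|t| ^+ 2) - `|t| / d =
      (`|t| / d - e) ^+ 2 / (2 * e).
    by rewrite /b; field; rewrite !gt_eqF.
  by rewrite divr_ge0 ?sqr_ge0// mulr_ge0// ltW.
have small : e / 2 + b * (n%:R * z * (1 - z) + (n%:R * z - n%:R * z) ^+ 2) <= e.
  have zz : z * (1 - z) <= 1 by move: z01 => /andP[z0 z1]; nra.
  have h : b * n%:R <= e / 2.
    have -> : b * n%:R = (2 * d ^+ 2 * e * n%:R)^-1.
      by rewrite /b; field; rewrite !gt_eqF.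
    rewrite invf_ple ?posrE ?divr_gt0 ?mulr_gt0 ?exprn_gt0//.
    rewrite -(ler_pM2r (_ : 0 < e / 2)) ?divr_gt0// mulVf ?gt_eqF ?divr_gt0//.
    have -> : 2 * d ^+ 2 * e * n%:R * (e / 2) = (d * e) ^+ 2 * n%:R by field.
    by rewrite mulrC -ler_pdivrMr// div1r ltW// truncnS_gt.
  rewrite subrr expr0n/= addr0 -mulrA [b * _]mulrA.
  rewrite -lerBrDl (le_trans _ (_ : e / 2 <= _))//; last by lra.
  rewrite (le_trans _ h)// ler_piMr// mulr_ge0// ?invr_ge0 ?ltW//.
  by rewrite !mulr_gt0// exprn_gt0.
have le1 (j : nat) : ramp x d (j%:R / n%:R) <=
    ramp x d z + e / 2 + b * (j%:R - n%:R * z) ^+ 2.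
  by rewrite (le_trans (ramp_lip _ _ z d0))// -addrA lerD2l.
have le2 (j : nat) : ramp x d z - e / 2 + (- b) * (j%:R - n%:R * z) ^+ 2 <=
    ramp x d (j%:R / n%:R).
  rewrite mulNr -addrA -opprD lerBlDr (le_trans (ramp_lip _ _ (j%:R / n%:R) d0))//.
  by rewrite lerD2l distrC.
split.
- apply: (le_trans (bernstein_le n z01 le1)).
  by rewrite bernstein_quadratic -addrA lerD2l.
- rewrite -lerBlDr; apply: (le_trans _ (bernstein_le n z01 le2)).
  rewrite bernstein_quadratic mulNr -addrA -opprD lerD2l lerN2.
  exact: small.
Qed.

End bernstein.

Section moments.
Local Open Scope ereal_scope.
Context {R : realType}.

Definition unit_valued d (X : measurableType d) (Y : X -> R) :=
  measurable_fun setT Y /\ forall x, (0 <= Y x <= 1)%R.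

Definition same_moments d d' (X : measurableType d) (X' : measurableType d')
    (M : {measure set X -> \bar R}) (M' : {measure set X' -> \bar R})
    (Y : X -> R) (Y' : X' -> R) :=
  forall k, \int[M]_x (Y x ^+ k)%:E = \int[M']_x (Y' x ^+ k)%:E.

Section polynomial_integrals.
Context d (X : measurableType d) (M : {measure set X -> \bar R}) (Y : X -> R).
Hypothesis Y01 : unit_valued Y.
Hypothesis Mfin : M setT < +oo.

Let w (k l : nat) (x : X) : R := (Y x ^+ k * (1 - Y x) ^+ l)%R.

Let w0 k l x : (0 <= w k l x)%R.
Proof.
by have /andP[y0 y1] := Y01.2 x; rewrite mulr_ge0 ?exprn_ge0 ?subr_ge0.
Qed.

Let w1 k l x : (w k l x <= 1)%R.
Proof.
have /andP[y0 y1] := Y01.2 x; rewrite mulr_ile1 ?exprn_ge0 ?subr_ge0//.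
  exact: exprn_ile1.
by apply: exprn_ile1; rewrite ?subr_ge0// gerBl.
Qed.

Let mw k l : measurable_fun setT (w k l).
Proof.
apply: measurable_funM; first exact: measurable_funX Y01.1.
by apply: measurable_funX; apply: measurable_funB => //; exact: Y01.1.
Qed.

Let int_w_lty k l : \int[M]_x (w k l x)%:E < +oo.
Proof.
apply: (@le_lt_trans _ _ (\int[M]_x (cst 1 x))); last first.
  by rewrite integral_cst// mul1e.
apply: ge0_le_integral => //.
- by move=> x _; rewrite lee_fin.
- exact/measurable_EFinP.
- by move=> x _; rewrite lee_fin.
Qed.

Lemma integral_weight_fin k l : \int[M]_x (w k l x)%:E \is a fin_num.
Proof.
by rewrite ge0_fin_numE// integral_ge0// => x _; rewrite lee_fin.
Qed.

Lemma integral_bernstein_rec k l n g : (forall j, 0 <= g j)%R ->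
  \int[M]_x (Y x ^+ k * (1 - Y x) ^+ l * bernstein n.+1 g (Y x))%:E =
  \int[M]_x (Y x ^+ k * (1 - Y x) ^+ l.+1 * bernstein n g (Y x))%:E +
  \int[M]_x (Y x ^+ k.+1 * (1 - Y x) ^+ l * bernstein n (g \o S) (Y x))%:E.
Proof.
move=> g0.
have mb m h : measurable_fun setT (fun x => bernstein m h (Y x)).
  exact: (measurableT_comp (measurable_bernstein m h) Y01.1).
rewrite -ge0_integralD//.
- by apply: eq_integral => x _; rewrite -EFinD; congr EFin => /=; rewrite !exprS; ring.
- by move=> x _; rewrite lee_fin mulr_ge0 ?w0// bernstein_ge0// Y01.2.
- by apply/measurable_EFinP; apply: measurable_funM => //; exact: mw.
- move=> x _; rewrite lee_fin mulr_ge0 ?w0// bernstein_ge0// ?Y01.2//.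
  by move=> j; exact: g0.
- by apply/measurable_EFinP; apply: measurable_funM => //; exact: mw.
Qed.

Lemma integral_weight_rec k l :
  \int[M]_x (Y x ^+ k * (1 - Y x) ^+ l)%:E =
  \int[M]_x (Y x ^+ k * (1 - Y x) ^+ l.+1)%:E +
  \int[M]_x (Y x ^+ k.+1 * (1 - Y x) ^+ l)%:E.
Proof.
rewrite -ge0_integralD//.
- by apply: eq_integral => x _; rewrite -EFinD; congr EFin => /=; rewrite !exprS; ring.
- by move=> x _; rewrite lee_fin; exact: w0.
- by apply/measurable_EFinP; exact: mw.
- by move=> x _; rewrite lee_fin; exact: w0.
- by apply/measurable_EFinP; exact: mw.
Qed.

Lemma integral_weight0 k l c : (0 <= c)%R ->
  \int[M]_x (Y x ^+ k * (1 - Y x) ^+ l * c)%:E =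
  c%:E * \int[M]_x (Y x ^+ k * (1 - Y x) ^+ l)%:E.
Proof.
move=> c0; rewrite -ge0_integralZl//.
- by apply: eq_integral => x _; rewrite -EFinM mulrC.
- by apply/measurable_EFinP; exact: mw.
- by move=> x _; rewrite lee_fin; exact: w0.
Qed.

End polynomial_integrals.

Section bernstein_moments.
Context d d' (X : measurableType d) (X' : measurableType d').
Variables (M : {measure set X -> \bar R}) (M' : {measure set X' -> \bar R})
  (Y : X -> R) (Y' : X' -> R).
Hypotheses (Y01 : unit_valued Y) (Y'01 : unit_valued Y')
  (Mfin : M setT < +oo) (M'fin : M' setT < +oo)
  (eqm : same_moments M M' Y Y').

(** Induction on l through y^k (1-y)^l = y^k (1-y)^(l+1) + y^(k+1) (1-y)^l; finiteness of the
    measures allows the subtraction. *)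
Lemma same_weight_integrals k l :
  \int[M]_x (Y x ^+ k * (1 - Y x) ^+ l)%:E =
  \int[M']_x (Y' x ^+ k * (1 - Y' x) ^+ l)%:E.
Proof.
elim: l k => [|l IH] k.
  by under eq_integral do rewrite mulr1; under [RHS]eq_integral do rewrite mulr1.
have fin := integral_weight_fin Y'01 M'fin k.+1 l.
rewrite -[LHS](addeK _ fin) -[RHS](addeK _ fin) -{1}IH.
by rewrite -(integral_weight_rec M Y01) -(integral_weight_rec M' Y'01) IH.
Qed.

Lemma same_bernstein_integrals n g k l : (forall j, 0 <= g j)%R ->
  \int[M]_x (Y x ^+ k * (1 - Y x) ^+ l * bernstein n g (Y x))%:E =
  \int[M']_x (Y' x ^+ k * (1 - Y' x) ^+ l * bernstein n g (Y' x))%:E.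
Proof.
elim: n g k l => [|n IH] g k l g0 /=.
  by rewrite !integral_weight0// same_weight_integrals.
rewrite (integral_bernstein_rec _ Y01)// (integral_bernstein_rec _ Y'01)//.
by rewrite IH// IH// => j; exact: g0.
Qed.

Lemma le_integral_ramp x0 dd e : (0 < dd)%R -> (0 < e)%R ->
  \int[M]_x (ramp x0 dd (Y x))%:E <=
  \int[M']_x (ramp x0 dd (Y' x))%:E + e%:E * (M setT + M' setT).
Proof.
move=> d0 e0; have [n hn] := ramp_bernstein x0 d0 e0.
pose g j := ramp x0 dd (j%:R / n%:R).
have g0 j : (0 <= g j)%R by exact: ramp_ge0.
have mb m h : measurable_fun setT (fun x => bernstein m h (Y x)).
  exact: (measurableT_comp (measurable_bernstein m h) Y01.1).
have mb' m h : measurable_fun setT (fun x => bernstein m h (Y' x)).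
  exact: (measurableT_comp (measurable_bernstein m h) Y'01.1).
have mr : measurable_fun setT (@ramp R x0 dd).
  apply: measurable_maxr => //; apply: measurable_minr => //.
  by apply: measurable_funM => //; exact: measurable_funB.
have b0 x : (0 <= bernstein n g (Y x))%R by rewrite bernstein_ge0// Y01.2.
have b'0 x : (0 <= bernstein n g (Y' x))%R by rewrite bernstein_ge0// Y'01.2.
apply: (@le_trans _ _ (\int[M]_x ((bernstein n g (Y x))%:E + (cst e%:E) x))).
  apply: ge0_le_integral => //.
  - by move=> x _; rewrite lee_fin ramp_ge0.
  - by apply/measurable_EFinP; exact: (measurableT_comp mr Y01.1).
  - by apply: emeasurable_funD => //; apply/measurable_EFinP.
  - by move=> x _; rewrite -EFinD lee_fin; have [] := hn _ (Y01.2 x).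
rewrite ge0_integralD//; last 3 first.
- by move=> x _; rewrite lee_fin.
- by apply/measurable_EFinP.
- by move=> x _; rewrite lee_fin ltW.
rewrite integral_cst//.
have := same_bernstein_integrals n 0 0 g0.
under eq_integral do rewrite !mul1r; under [X in _ = X]eq_integral do rewrite !mul1r.
move=> ->; rewrite muleDr//; last by rewrite ge0_adde_def// inE measure_ge0.
rewrite [in leRHS](addeC (e%:E * M setT)) addeA leeD2r//.
apply: (@le_trans _ _ (\int[M']_x ((ramp x0 dd (Y' x))%:E + (cst e%:E) x))).
  apply: ge0_le_integral => //.
  - by move=> x _; rewrite lee_fin.
  - by apply/measurable_EFinP.
  - apply: emeasurable_funD => //; apply/measurable_EFinP.
    exact: (measurableT_comp mr Y'01.1).
  - by move=> x _; rewrite -EFinD lee_fin; have [] := hn _ (Y'01.2 x).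
rewrite ge0_integralD//; last 3 first.
- by move=> x _; rewrite lee_fin ramp_ge0.
- by apply/measurable_EFinP; exact: (measurableT_comp mr Y'01.1).
- by move=> x _; rewrite lee_fin ltW.
by rewrite integral_cst.
Qed.

(** The hypotheses are symmetric, so one inequality suffices. The indicator of ]-oo, x0] lies below
    a ramp, which lies below the indicator of ]-oo, x0 + dd]; the integral of the ramp is
    transferred up to e times the masses, and then dd and e tend to 0. *)
Lemma le_measure_le x0 : M (Y @^-1` `]-oo, x0]) <= M' (Y' @^-1` `]-oo, x0]).
Proof.
have mpre t : measurable (Y @^-1` `]-oo, t]).
  by rewrite -[X in measurable X]setTI; apply: Y01.1 => //; exact: measurable_itv.
have mpre' t : measurable (Y' @^-1` `]-oo, t]).
  by rewrite -[X in measurable X]setTI; apply: Y'01.1 => //; exact: measurable_itv.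
have mr dd : measurable_fun setT (@ramp R x0 dd).
  apply: measurable_maxr => //; apply: measurable_minr => //.
  by apply: measurable_funM => //; exact: measurable_funB.
have step dd e : (0 < dd)%R -> (0 < e)%R ->
    M (Y @^-1` `]-oo, x0]) <=
    M' (Y' @^-1` `]-oo, (x0 + dd)%R]) + e%:E * (M setT + M' setT).
  move=> d0 e0; apply: le_trans (le_trans (le_integral_ramp x0 d0 e0) _).
    rewrite -[leLHS]mul1e -integral_cst// integral_mkcond.
    apply: ge0_le_integral => //.
    - by move=> x _; rewrite patchE; case: ifPn.
    - apply/(measurable_restrictT _ _).1 => //.
    - by apply/measurable_EFinP; exact: (measurableT_comp (mr dd) Y01.1).
    - move=> x _; rewrite patchE; case: ifPn => [|_].
        by rewrite inE/= in_itv/= => yx; rewrite lee_fin ramp_ge1.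
      by rewrite lee_fin ramp_ge0.
  rewrite leeD2r// -[leRHS]mul1e -integral_cst// [in leRHS]integral_mkcond.
  apply: ge0_le_integral => //.
  - by move=> x _; rewrite lee_fin ramp_ge0.
  - by apply/measurable_EFinP; exact: (measurableT_comp (mr dd) Y'01.1).
  - by apply/(measurable_restrictT _ _).1.
  - move=> x _; rewrite patchE.
    apply: (@le_trans _ _ ((Y' x <= x0 + dd)%R%:R)%:E).
      by rewrite lee_fin ramp_le.
    have [h|h] := leP (Y' x) (x0 + dd)%R; last by case: ifP.
    by rewrite mem_set//= in_itv.
have cv : M' (Y' @^-1` `]-oo, (x0 + n.+1%:R^-1)%R]) @[n --> \oo] -->
    M' (Y' @^-1` `]-oo, x0]).
  have -> : Y' @^-1` `]-oo, x0] =
      \bigcap_n (Y' @^-1` `]-oo, (x0 + n.+1%:R^-1)%R]).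
    apply/seteqP; split => x /=; rewrite ?in_itv/=.
      by move=> h n _; rewrite /= in_itv/= (le_trans h)// lerDl invr_ge0.
    move=> h; apply/ler_addgt0Pl => e e0.
    have := h (Num.truncn e^-1) I; rewrite /= in_itv/= => /le_trans; apply.
    rewrite addrC lerD2r invf_ple ?posrE// ltW//; exact: truncnS_gt.
  apply: nonincreasing_cvg_mu => //.
  - apply: le_lt_trans M'fin; apply: le_measure; rewrite ?inE//.
  - by apply: bigcap_measurableType => n _.
  - move=> m n mn; apply/subsetPset => x /=; rewrite !in_itv/= => /le_trans; apply.
    by rewrite lerD2l lef_pV2 ?posrE// ler_nat ltnS.
apply/lee_addgt0Pr => e e0.
(* With tolerance e / K the error is at most e; the 1 keeps K positive. *)
pose K := (fine (M setT) + fine (M' setT) + 1)%R.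
have Mfin' : M setT = (fine (M setT))%:E by rewrite fineK// ge0_fin_numE.
have M'fin' : M' setT = (fine (M' setT))%:E by rewrite fineK// ge0_fin_numE.
have K0 : (0 < K)%R by rewrite ltr_wpDl// addr_ge0// fine_ge0.
have bound n : M (Y @^-1` `]-oo, x0]) <=
    M' (Y' @^-1` `]-oo, (x0 + n.+1%:R^-1)%R]) + e%:E.
  have n0 : (0 < n.+1%:R^-1 :> R)%R by rewrite invr_gt0.
  apply: (le_trans (step _ (e / K)%R n0 (divr_gt0 e0 K0))).
  rewrite leeD2l// Mfin' M'fin' -EFinD -EFinM lee_fin -mulrA ler_piMr//.
    exact: ltW.
  by rewrite ler_pdivrMl// mulr1 /K lerDl.
have cv2 : M' (Y' @^-1` `]-oo, (x0 + n.+1%:R^-1)%R]) + e%:E @[n --> \oo] -->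
    M' (Y' @^-1` `]-oo, x0]) + e%:E.
  apply: cvgeD => //; last exact: cvg_cst.
  by rewrite ge0_adde_def// inE ?measure_ge0// lee_fin ltW.
by apply: (cvge_ge _ cv2); exact: nearW.
Qed.

End bernstein_moments.

(** Uniqueness in the Hausdorff moment problem, for finite measures on possibly different spaces:
    equal moments give equal distribution functions, hence equality on the pi-system of open
    rays. *)
Theorem moments_determine d d' (X : measurableType d) (X' : measurableType d')
    (M : {measure set X -> \bar R}) (M' : {measure set X' -> \bar R})
    (Y : X -> R) (Y' : X' -> R) :
  unit_valued Y -> unit_valued Y' -> M setT < +oo -> M' setT < +oo ->
  same_moments M M' Y Y' ->
  forall A, measurable A -> M (Y @^-1` A) = M' (Y' @^-1` A).
Proof.
move=> Y01 Y'01 Mfin M'fin eqm A mA.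
have g0 dd (Z : measurableType dd) (x : Z) : 0 <= 1 :> \bar R by [].
pose m1 : {measure set R -> \bar R} := wpush M (g0 _ X) (measurable_cst _) Y01.1.
pose m2 : {measure set R -> \bar R} := wpush M' (g0 _ X') (measurable_cst _) Y'01.1.
have m1E B : measurable B -> m1 B = M (Y @^-1` B).
  move=> mB; rewrite /m1/= /wpush integral_cst ?mul1e//.
  by rewrite -[X in measurable X]setTI; exact: Y01.1.
have m2E B : measurable B -> m2 B = M' (Y' @^-1` B).
  move=> mB; rewrite /m2/= /wpush integral_cst ?mul1e//.
  by rewrite -[X in measurable X]setTI; exact: Y'01.1.
rewrite -m1E// -m2E//.
have m12T : m1 setT = m2 setT.
  rewrite m1E// m2E//= !preimage_setT; have := eqm 0%N.
  under eq_integral do rewrite expr0; under [X in _ = X]eq_integral do rewrite expr0.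
  by rewrite !integral_cst// !mul1e.
have m1T : m1 setT < +oo by rewrite m1E.
have m12le x : m1 `]-oo, x]%classic = m2 `]-oo, x]%classic.
  by apply: le_anti; rewrite m1E// m2E// !le_measure_le// => k; exact/esym/eqm.
have split_ray (m : {measure set R -> \bar R}) x :
    m setT = m `]x, +oo[%classic + m `]-oo, x]%classic.
  rewrite -measureU//.
    congr (m _); apply/seteqP; split => // y _ /=; rewrite !in_itv/= andbT.
    by case: (leP y x) => h; [right|left].
  apply/seteqP; split => // y /=; rewrite !in_itv/= andbT => -[xy].
  by rewrite leNgt xy.
apply: (measure_unique (T := R) (@RGenOInfty.G R) (fun n => `](- n%:R)%R, +oo[%classic)) => //.
- exact: RGenOInfty.measurableE.
- move=> _ _ [x ->] [y ->]; exists (Num.max x y).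
  apply/seteqP; split => z /=; rewrite !in_itv/= !andbT gt_max.
    by move=> [-> ->].
  by move=> /andP.
- by move=> n; exists (- n%:R)%R.
- apply/seteqP; split => // x _; exists (Num.truncn `|x|).+1 => //=.
  rewrite in_itv/= andbT ltrNl; apply: le_lt_trans (truncnS_gt _).
  by rewrite -normrN ler_norm.
- move=> _ [x ->].
  have fin : m2 `]-oo, x]%classic \is a fin_num.
    rewrite ge0_fin_numE// -m12le; apply: le_lt_trans m1T.
    by apply: le_measure; rewrite ?inE.
  rewrite -[LHS](addeK _ fin) -[RHS](addeK _ fin).
  by rewrite -{1}m12le -!split_ray m12T.
- by move=> n; apply: le_lt_trans m1T; apply: le_measure; rewrite ?inE.
Qed.

End moments.

(** * Palm's formula for negative binomial points *)

Section difference_quotient.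
Context {R : realType}.
Local Open Scope ereal_scope.

Lemma measurable_expeR : measurable_fun [set: \bar R] (@expeR R).
Proof.
rewrite (_ : @expeR R = fun x => if x == +oo then +oo else
    if x == -oo then 0 else (expR (fine x))%:E); last first.
  by apply/funext => -[r| |].
have meq (y : \bar R) : measurable_fun setT (fun x : \bar R => x == y).
  apply: (@measurable_fun_bool _ _ _ _ true); rewrite setTI.
  rewrite (_ : _ @^-1` _ = [set y]); first exact: emeasurable_set1.
  by apply/seteqP; split => x /= /eqP.
apply: measurable_fun_ifT => //; apply: measurable_fun_ifT => //.
apply/measurable_EFinP; apply: (measurableT_comp (@measurable_expR R)).
exact: fine_measurable.
Qed.

Lemma expeRN_le1 (s : \bar R) : 0 <= s -> expeR (- s) <= 1.
Proof. by move=> s0; rewrite -expeR0 lee_expeR oppe_le0. Qed.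

Lemma expeRN_fin (s : \bar R) : 0 <= s -> expeR (- s) \is a fin_num.
Proof.
move=> s0; rewrite ge0_fin_numE ?expeR_ge0//.
exact: le_lt_trans (expeRN_le1 s0) (ltry _).
Qed.

(* Along the steps 2^-n these difference quotients of - e^{- s} at 0 are       *)
(* nondecreasing in n, so that monotone convergence applies to them.          *)
Definition dq (n : nat) (s : \bar R) : \bar R :=
  (2 ^+ n)%:E * (1 - expeR (- ((2 ^- n)%:E * s))).

Lemma dqE n (r : R) :
  dq n r%:E = (2 ^+ n * (1 - expR (- (2 ^- n * r))))%:E.
Proof. by []. Qed.

Lemma dq_oo n : dq n +oo = (2 ^+ n)%:E.
Proof.
by rewrite /dq gt0_muley ?lte_fin ?invr_gt0//= sube0 mule1.
Qed.

Lemma dq_ge0 n s : 0 <= s -> 0 <= dq n s.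
Proof.
move=> s0; have s0' : 0 <= (2 ^- n)%:E * s by rewrite mule_ge0// lee_fin invr_ge0 ltW.
apply: mule_ge0; first by rewrite lee_fin ltW.
by rewrite sube_ge0 ?expeRN_fin// expeRN_le1.
Qed.

Lemma dq_leS n s : 0 <= s -> dq n s <= dq n.+1 s.
Proof.
case: s => [r| |]//; last by rewrite !dq_oo lee_fin ler_eXn2l ?ltr1n.
rewrite !dqE !lee_fin => r0.
set e := expR (- (2 ^- n.+1 * r)).
have -> : (2 ^- n * r = 2 ^- n.+1 * r + 2 ^- n.+1 * r)%R.
  by rewrite exprS invfM; field; rewrite gt_eqF.
rewrite opprD expRD -/e exprS -[leRHS]mulrA [leRHS]mulrCA ler_pM2l//.
have e0 : (0 <= e)%R by exact: expR_ge0.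
have e1 : (e <= 1)%R.
  by rewrite -expR0 ler_expR oppr_le0 mulr_ge0// invr_ge0 ltW.
by nra.
Qed.

Lemma dq_homo s : 0 <= s -> nondecreasing_seq (dq ^~ s).
Proof. by move=> s0; apply/nondecreasing_seqP => n; exact: dq_leS. Qed.

Lemma dq_le n s : 0 <= s -> dq n s <= s.
Proof.
case: s => [r| |]//; last by move=> _; exact: leey.
rewrite dqE !lee_fin => r0; rewrite -ler_pdivlMl//.
by rewrite lerBlDr -lerBlDl; exact: expR_ge1Dx.
Qed.

Lemma cvg_dq s : 0 <= s -> dq n s @[n --> \oo] --> s.
Proof.
case: s => [r| |]// s0; last first.
  under eq_fun do rewrite dq_oo.
  apply/cvgeryP/cvgryPge => A; near=> n.
  apply: (@le_trans _ _ n%:R); last by rewrite -natrX ler_nat ltnW// ltn_expl.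
  apply: le_trans (ler_norm _) _; apply: le_trans (ltW (truncnS_gt _)) _.
  by rewrite ler_nat; near: n; exact: nbhs_infty_ge.
have r0 : (0 <= r)%R by rewrite -lee_fin.
under eq_fun do rewrite dqE.
apply: cvg_EFin; first exact: nearW.
have c2 : (2 ^- n)%R @[n --> \oo] --> (0 : R)%R.
  under eq_fun do rewrite -exprVn.
  by apply: cvg_expr; rewrite gtr0_norm ?invr_gt0// invf_lt1// ltr1n.
apply: (@squeeze_cvgr _ _ _ _ (fun n => r * expR (- (2 ^- n * r)))%R (cst r)).
- apply: nearW => n /=; apply/andP; split; last first.
    by have := @dq_le n r%:E s0; rewrite dqE lee_fin.
  set u := (2 ^- n * r)%R.
  have -> : r = (2 ^+ n * u)%R by rewrite /u mulrA mulfV ?mul1r ?gt_eqF.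
  rewrite -mulrA ler_pM2l//.
  have h1 := expR_ge1Dx u; have h2 := expR_gt0 (- u)%R.
  have h3 : (expR u * expR (- u) = 1)%R by rewrite -expRD subrr expR0.
  by nra.
- have cu : (- (2 ^- n * r))%R @[n --> \oo] --> (0 : R)%R.
    have -> : (0 = - (0 * r) :> R)%R by rewrite mul0r oppr0.
    by apply: cvgN; apply: cvgM => //; exact: cvg_cst.
  have ce : expR (- (2 ^- n * r)) @[n --> \oo] --> (1 : R)%R.
    by have := continuous_cvg _ (@continuous_expR R 0%R) cu; rewrite expR0; apply.
  have cr : r @[n --> \oo] --> r by exact: cvg_cst.
  by have h := cvgM cr ce; rewrite mulr1 in h; exact: h.
- exact: cvg_cst.
Unshelve. all: by end_near. Qed.

End difference_quotient.

Section powR_quotient.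
Context {R : realType}.

(** Derivative of the power -q at A along the increments [b n], by the mean value theorem. *)
Lemma cvg_powR_quotient (A q gamma : R) (b w : nat -> R) : 0 < A ->
  (forall n, 0 <= b n) -> b n @[n --> \oo] --> 0 ->
  w n * b n @[n --> \oo] --> gamma ->
  w n * (A `^ (- q) - (A + b n) `^ (- q)) @[n --> \oo] -->
    q * A `^ (- (q + 1)) * gamma.
Proof.
move=> A0 b0 cb cwb.
have mvt n : exists x, A <= x <= A + b n /\
    A `^ (- q) - (A + b n) `^ (- q) = q * x `^ (- (q + 1)) * b n.
  have [|x xA||x] := @MVT_segment R (fun x => x `^ (- q))
      (fun x => - q * x `^ (- q - 1)) A (A + b n).
  - by rewrite lerDl.
  - move: xA; rewrite in_itv/= => /andP[Ax _].
    exact: is_derive1_powR (lt_trans A0 Ax).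
  - apply: continuous_in_subspaceT => y; rewrite mem_setE in_itv/= => /andP[Ay _].
    exact: continuous_powR_pos (lt_le_trans A0 Ay).
  - rewrite in_itv/= => Ax h; exists x; split => //.
    rewrite -opprB h (addrC A) addrK opprD; ring.
have [x hx] := choice mvt.
have cx : x n @[n --> \oo] --> A.
  apply: (@squeeze_cvgr _ _ _ _ (cst A) (fun n => A + b n)).
  - by apply: nearW => n; have [] := hx n.
  - exact: cvg_cst.
  - have cA : A @[n --> \oo] --> A by exact: cvg_cst.
    by have h := cvgD cA cb; rewrite addr0 in h; exact: h.
under eq_cvg => n do rewrite (hx n).2 mulrCA.
apply: cvgM => //; apply: cvgM; first exact: cvg_cst.
apply: (continuous_cvg _ (continuous_powR_pos (a := - (q + 1)) A0) cx).
Qed.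

End powR_quotient.

Section point_sum.
Context {R : realType}.
Local Open Scope ereal_scope.

Definition point_sum (f : R -> R) (x : rseq R) : \bar R :=
  \sum_(i <oo) (f (x i))%:E.

(** Removes a point without renumbering the others. *)
Definition zero_at (i : nat) (x : rseq R) : rseq R :=
  fun j => if j == i then 0%R else x j.

(* Test functions vanish off (0, +oo), so that coordinates equal to 0 do not  *)
(* count as points.                                                           *)
Definition test_fun (f : R -> R) : Prop :=
  [/\ measurable_fun setT f, forall x, (0 <= f x)%R &
      forall x, (x <= 0)%R -> f x = 0%R].

Lemma measurable_zero_at i : measurable_fun setT (zero_at i).
Proof.
apply: measurable_to_rseq => j; rewrite /zero_at.
by case: eqVneq => _; [exact: measurable_cst|exact: measurable_coord].
Qed.

Lemma point_sum_ge0 f x : test_fun f -> 0 <= point_sum f x.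
Proof. by move=> [_ f0 _]; apply: nneseries_ge0 => i _ _; rewrite lee_fin. Qed.

Lemma measurable_point_sum f : test_fun f -> measurable_fun setT (point_sum f).
Proof.
move=> [mf f0 _]; apply: ge0_emeasurable_sum => [k x _ _|k _].
  by rewrite lee_fin.
apply/measurable_EFinP; apply: (measurableT_comp mf); exact: measurable_coord.
Qed.

Lemma point_sum_zero_at f i x : test_fun f ->
  point_sum f x = (f (x i))%:E + point_sum f (zero_at i x).
Proof.
move=> [_ f0 fneg]; rewrite /point_sum (nneseriesD1 (n := i))//; last first.
  by move=> k _; rewrite lee_fin.
congr (_ + _); rewrite eseries_mkcond; apply: eq_eseriesr => j _.
by rewrite /zero_at; case: eqVneq => //= _; rewrite fneg.
Qed.

Lemma point_sumD f g x : test_fun f -> test_fun g ->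
  point_sum (f \+ g)%R x = point_sum f x + point_sum g x.
Proof.
move=> [_ f0 _] [_ g0 _]; rewrite /point_sum -nneseriesD//.
- by move=> i _ _; rewrite lee_fin.
- by move=> i _ _; rewrite lee_fin.
Qed.

Lemma point_sumZ f c x : test_fun f ->
  point_sum (fun y => c * f y)%R x = c%:E * point_sum f x.
Proof.
move=> [_ f0 _]; rewrite /point_sum -nneseriesZl// => i _.
by rewrite lee_fin.
Qed.

Lemma test_funD f g : test_fun f -> test_fun g -> test_fun (f \+ g)%R.
Proof.
move=> [mf f0 fn] [mg g0 gn]; split.
- exact: measurable_funD.
- by move=> x; rewrite addr_ge0.
- by move=> x x0; rewrite /= fn// gn// addr0.
Qed.

Lemma test_funZ c f : (0 <= c)%R -> test_fun f ->
  test_fun (fun y => c * f y)%R.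
Proof.
move=> c0 [mf f0 fn]; split.
- exact: measurable_funM.
- by move=> x; rewrite mulr_ge0.
- by move=> x x0; rewrite /= fn// mulr0.
Qed.

Lemma test_fun_exp f g : test_fun f -> test_fun g ->
  test_fun (fun y => g y * expR (f y))%R.
Proof.
move=> [mf f0 fn] [mg g0 gn]; split.
- by apply: measurable_funM => //; exact: (measurableT_comp (@measurable_expR R)).
- by move=> x; rewrite mulr_ge0 ?expR_ge0.
- by move=> x x0; rewrite /= gn// mul0r.
Qed.

End point_sum.

Section palm.
Context {R : realType}.
Local Open Scope ereal_scope.
Variable Lambda : {measure set (measurableTypeR R) -> \bar R}.

(* M is c times the law of the points of a negative binomial process          *)
(* BN(q, Lambda), listed in an arbitrary order and possibly padded with       *)
(* nonpositive entries.                                                       *)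
Definition negbin_points (M : {measure set (rseq R) -> \bar R}) (c q : R) :=
  forall f, test_fun f -> \int[Lambda]_x (1 - expR (- f x))%:E < +oo ->
  \int[M]_x expeR (- point_sum f x) =
  (c * (1 + fine (\int[Lambda]_x (1 - expR (- f x))%:E)) `^ (- q))%:E.

Lemma lee_mul2l (x y z : \bar R) : 0 <= x -> y <= z -> x * y <= x * z.
Proof. by move=> x0 yz; rewrite lee_wpmul2l. Qed.

Lemma one_sub_expN_ge0 (r : R) : (0 <= r)%R -> (0 <= 1 - expR (- r))%R.
Proof. by move=> r0; rewrite subr_ge0 -expR0 ler_expR oppr_le0. Qed.

Lemma measurable_one_sub_expN (f : R -> R) : measurable_fun setT f ->
  measurable_fun setT (fun x => 1 - expR (- f x))%R.
Proof.
move=> mf; apply: measurable_funB => //.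
by apply: (measurableT_comp (@measurable_expR R)); exact: measurable_funN.
Qed.

Variables (M : {measure set (rseq R) -> \bar R}) (c q : R).
Hypothesis MNB : negbin_points M c q.

(** Differentiate the Laplace functional at f in the direction k = g e^f, chosen so that e^{-f} k =
    g. Both sides are limits of difference quotients between f and f + 2^{-n} k: the left by
    monotone convergence, the right by [cvg_powR_quotient]. *)
Lemma palm_integral (f g : R -> R) : test_fun f -> test_fun g ->
  \int[Lambda]_x (1 - expR (- f x))%:E < +oo ->
  \int[Lambda]_x (g x)%:E < +oo ->
  \int[M]_x (expeR (- point_sum f x) *
             point_sum (fun y => g y * expR (f y))%R x) =
  (c * q * fine (\int[Lambda]_x (g x)%:E) *
   (1 + fine (\int[Lambda]_x (1 - expR (- f x))%:E)) `^ (- (q + 1)))%:E.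
Proof.
move=> tf tg fin_f fin_g.
pose k y := (g y * expR (f y))%R.
have tk : test_fun k by exact: test_fun_exp.
have [mf f0 _] := tf; have [mg g0 _] := tg; have [mk k0 _] := tk.
pose fn n := (f \+ (fun y => 2 ^- n * k y))%R.
have p0 n : (0 <= 2 ^- n :> R)%R by rewrite invr_ge0 exprn_ge0.
have pp n : (0 < 2 ^+ n :> R)%R by rewrite exprn_gt0.
have tfn n : test_fun (fn n) by apply: test_funD => //; exact: test_funZ.
pose A := (1 + fine (\int[Lambda]_x (1 - expR (- f x))%:E))%R.
pose gam := fine (\int[Lambda]_x (g x)%:E).
have mdq n : measurable_fun [set: \bar R] (dq n).
  rewrite /dq; apply: measurable_funeM; apply: emeasurable_funB => //.
  apply: (measurableT_comp measurable_expeR).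
  by apply: measurableT_comp => //; exact: measurable_funeM.
(* 2^n (e^{-f} - e^{-f_n}) increases to e^{-f} k = g. *)
pose G n (x : R) := (expR (- f x))%:E * dq n (k x)%:E.
have G0 n x : 0 <= G n x.
  by apply: mule_ge0; [rewrite lee_fin expR_ge0|apply: dq_ge0; rewrite lee_fin].
have mG n : measurable_fun [set: measurableTypeR R] (G n).
  apply: emeasurable_funM.
    apply/measurable_EFinP; apply: (measurableT_comp (@measurable_expR R)).
    exact: measurable_funN.
  by apply: (measurableT_comp (mdq n)); exact/measurable_EFinP.
have Gg n x : G n x <= (g x)%:E.
  rewrite /G (_ : g x = (expR (- f x) * k x)%R); last first.
    by rewrite /k mulrCA -expRD addNr expR0 mulr1.
  rewrite [leRHS]EFinM; apply: lee_mul2l; first by rewrite lee_fin expR_ge0.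
  by apply: dq_le; rewrite lee_fin.
have cvG : \int[Lambda]_x G n x @[n --> \oo] --> \int[Lambda]_x (g x)%:E.
  have -> : \int[Lambda]_x (g x)%:E = \int[Lambda]_x limn (G ^~ x).
    apply: eq_integral => x _; apply/esym/cvg_lim => //.
    rewrite (_ : (g x)%:E = (expR (- f x))%:E * (k x)%:E); last first.
      by rewrite -EFinM /k mulrCA -expRD addNr expR0 mulr1.
    by apply: cvgeZl => //; apply: cvg_dq; rewrite lee_fin.
  apply: cvg_monotone_convergence => //.
  move=> x _ m n mn; apply: lee_mul2l; first by rewrite lee_fin expR_ge0.
  by apply: dq_homo => //; rewrite lee_fin.
have intG_fin n : \int[Lambda]_x G n x \is a fin_num.
  rewrite ge0_fin_numE// ?integral_ge0//; apply: le_lt_trans fin_g.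
  by apply: ge0_le_integral => //; exact/measurable_EFinP.
have intfE n : \int[Lambda]_x (1 - expR (- fn n x))%:E =
    \int[Lambda]_x (1 - expR (- f x))%:E + (2 ^- n)%:E * \int[Lambda]_x G n x.
  rewrite -ge0_integralZl//.
  rewrite -ge0_integralD//.
  - apply: eq_integral => x _; rewrite /G dqE -!EFinM -EFinD; congr EFin.
    rewrite /fn/= opprD expRD; field; rewrite gt_eqF//.
  - by move=> x _; rewrite lee_fin one_sub_expN_ge0.
  - by apply/measurable_EFinP; exact: measurable_one_sub_expN.
  - by move=> x _; rewrite mule_ge0// lee_fin.
  - exact: measurable_funeM.
have fin_f' : \int[Lambda]_x (1 - expR (- f x))%:E \is a fin_num.
  rewrite ge0_fin_numE// integral_ge0// => x _.
  by rewrite lee_fin one_sub_expN_ge0.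
pose b n := (2 ^- n * fine (\int[Lambda]_x G n x))%R.
have LfnE n : (1 + fine (\int[Lambda]_x (1 - expR (- fn n x))%:E) = A + b n)%R.
  by rewrite intfE fineD ?fin_numM// fineM// addrA.
have fin_fn n : \int[Lambda]_x (1 - expR (- fn n x))%:E < +oo.
  by rewrite intfE lte_add_pinfty// ltey_eq fin_numM.
have b0 n : (0 <= b n)%R by rewrite mulr_ge0// fine_ge0// integral_ge0.
have wb : (2 ^+ n * b n)%R @[n --> \oo] --> gam.
  have -> : (fun n => 2 ^+ n * b n)%R = fun n => fine (\int[Lambda]_x G n x).
    by apply/funext => n; rewrite /b mulrA mulfV ?mul1r// gt_eqF.
  apply: (@fine_cvg _ _ _ _ (fun n => \int[Lambda]_x G n x)).
  rewrite fineK; first exact: cvG.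
  by rewrite ge0_fin_numE ?integral_ge0// => x _; rewrite lee_fin.
have cb : b n @[n --> \oo] --> (0 : R)%R.
  have c2 : (2 ^- n)%R @[n --> \oo] --> (0 : R)%R.
    under eq_fun do rewrite -exprVn.
    by apply: cvg_expr; rewrite gtr0_norm ?invr_gt0// invf_lt1// ltr1n.
  have h := cvgM c2 wb; rewrite mul0r in h.
  have -> : b = (fun n => 2 ^- n * (2 ^+ n * b n))%R; last exact: h.
  by apply/funext => n; rewrite mulrA mulVf ?mul1r// gt_eqF.
have A0 : (0 < A)%R.
  rewrite ltr_wpDr// fine_ge0// integral_ge0// => x _.
  by rewrite lee_fin one_sub_expN_ge0.
have cquot := cvg_powR_quotient (q := q) A0 b0 cb wb.
pose H n (x : rseq R) := expeR (- point_sum f x) * dq n (point_sum k x).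
have H0 n x : 0 <= H n x.
  by apply: mule_ge0; [exact: expeR_ge0|apply: dq_ge0; exact: point_sum_ge0].
have me h : test_fun h ->
    measurable_fun [set: rseq R] (fun x => expeR (- point_sum h x)).
  move=> th; apply: (measurableT_comp measurable_expeR).
  by apply: measurableT_comp => //; exact: measurable_point_sum.
have mH n : measurable_fun [set: rseq R] (H n).
  apply: emeasurable_funM; first exact: me.
  by apply: (measurableT_comp (mdq n)); exact: measurable_point_sum.
have cvH : \int[M]_x H n x @[n --> \oo] -->
    \int[M]_x (expeR (- point_sum f x) * point_sum k x).
  have -> : \int[M]_x (expeR (- point_sum f x) * point_sum k x) =
      \int[M]_x limn (H ^~ x).
    apply: eq_integral => x _; apply/esym/cvg_lim => //.
    apply: cvgeZl; first by apply: expeRN_fin; exact: point_sum_ge0.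
    by apply: cvg_dq; exact: point_sum_ge0.
  apply: cvg_monotone_convergence => //.
  move=> x _ m n mn; apply: lee_mul2l; first exact: expeR_ge0.
  by apply: dq_homo => //; exact: point_sum_ge0.
(* The identity is first proved as a sum, because only a finite term can be moved across in the
   extended reals. *)
have HE n : \int[M]_x H n x =
    (2 ^+ n * (c * A `^ (- q) - c * (A + b n) `^ (- q)))%:E.
  have e1 := MNB tf fin_f; have e2 := MNB (tfn n) (fin_fn n).
  rewrite LfnE in e2.
  have : \int[M]_x H n x + (2 ^+ n)%:E * \int[M]_x expeR (- point_sum (fn n) x) =
      (2 ^+ n)%:E * \int[M]_x expeR (- point_sum f x).
    have hZ h : test_fun h -> (2 ^+ n)%:E * \int[M]_x expeR (- point_sum h x) =
        \int[M]_x ((2 ^+ n)%:E * expeR (- point_sum h x)).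
      move=> th; apply/esym/ge0_integralZl_EFin => //.
      - by move=> x _; exact: expeR_ge0.
      - exact: me.
    rewrite !hZ//.
    rewrite -ge0_integralD//; last 2 first.
    - by move=> x _; apply: mule_ge0; [rewrite lee_fin ltW|exact: expeR_ge0].
    - by apply: measurable_funeM; exact: me.
    apply: eq_integral => x _; rewrite /H /dq.
    rewrite point_sumD//; last exact: test_funZ.
    rewrite point_sumZ//.
    have s0 := point_sum_ge0 x tf; have s1 := point_sum_ge0 x tk.
    have s2 : 0 <= (2 ^- n)%:E * point_sum k x by rewrite mule_ge0// lee_fin.
    rewrite oppeD ?expeRD; last by rewrite ge0_adde_def// inE.
    have := expeRN_fin s2; have := expeRN_fin s0.
    set u := expeR (- point_sum f x); set v := expeR _ => ufin vfin.
    rewrite -(fineK ufin) -(fineK vfin).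
    by rewrite -!EFinM; congr EFin; ring.
  rewrite e1 e2 -!EFinM => h.
  have fin : (2 ^+ n * (c * (A + b n) `^ (- q)))%:E \is a fin_num by [].
  by rewrite -[LHS](addeK _ fin) h -EFinB mulrBr.
have cvH2 : \int[M]_x H n x @[n --> \oo] -->
    (c * q * gam * A `^ (- (q + 1)))%:E.
  under eq_cvg => n do rewrite HE.
  apply: cvg_EFin; first exact: nearW.
  under eq_cvg => n do rewrite /= -mulrBr mulrCA.
  have -> : (c * q * gam * A `^ (- (q + 1)) = c * (q * A `^ (- (q + 1)) * gam))%R.
    by ring.
  by apply: cvgM => //; exact: cvg_cst.
exact: cvg_unique cvH cvH2.
Qed.

End palm.

(** * The law of the total mass *)

Section total_mass.
Context {R : realType}.
Local Open Scope ereal_scope.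

Definition pos (x : R) : R := Num.max x 0%R.

Lemma pos_ge0 x : (0 <= pos x)%R. Proof. by rewrite le_max lexx orbT. Qed.

Lemma measurable_pos : measurable_fun setT pos.
Proof. exact: measurable_maxr. Qed.

Lemma test_fun_pos : test_fun pos.
Proof.
split; [exact: measurable_pos|exact: pos_ge0|].
by move=> x x0; apply/max_idPr.
Qed.

Definition mass (x : rseq R) : \bar R := point_sum pos x.

Lemma mass_ge0 x : 0 <= mass x.
Proof. exact: point_sum_ge0 test_fun_pos. Qed.

Lemma measurable_mass : measurable_fun setT mass.
Proof. exact: measurable_point_sum test_fun_pos. Qed.

Definition rtotal (x : rseq R) : R := fine (mass x).

Lemma measurable_rtotal : measurable_fun setT rtotal.
Proof. by apply: measurableT_comp; [exact: fine_measurable|exact: measurable_mass]. Qed.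

Lemma rtotal_ge0 x : (0 <= rtotal x)%R.
Proof. by rewrite fine_ge0// mass_ge0. Qed.

Lemma mass_zero_at i x : mass x = (pos (x i))%:E + mass (zero_at i x).
Proof. exact: point_sum_zero_at test_fun_pos. Qed.

Lemma rtotal_zero_at i x : mass x \is a fin_num ->
  rtotal x = (pos (x i) + rtotal (zero_at i x))%R.
Proof.
rewrite /rtotal (mass_zero_at i) fin_numD => /andP[_ h].
by rewrite fineD.
Qed.

Variable alpha : R.
Hypotheses (alpha_gt0 : (0 < alpha)%R) (alpha_lt1 : (alpha < 1)%R).
Local Notation Lambda := (Pi alpha_gt0 alpha_lt1).
Variables (M : {measure set (rseq R) -> \bar R}) (c q : R).
Hypotheses (c_ge0 : (0 <= c)%R) (q_gt0 : (0 < q)%R)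
  (MNB : negbin_points Lambda M c q).

Let aq_gt0 : (0 < alpha * q)%R. Proof. exact: mulr_gt0. Qed.

(** With f = k x the exponent is (1 + k)^alpha - 1. Integers k suffice: these are the moments of
    e^{-mass}. *)
Lemma laplace_mass k :
  \int[M]_x expeR (- (k%:R%:E * mass x)) =
  (c * (1 + k%:R) `^ (- (alpha * q)))%:E.
Proof.
have tk : test_fun (fun y => k%:R * pos y)%R.
  by apply: test_funZ => //; exact: test_fun_pos.
have lap := laplace_Pi alpha_gt0 alpha_lt1 (ler0n R k).
have := MNB tk; rewrite lap ltry => /(_ isT).
have -> : \int[M]_x expeR (- point_sum (fun y => k%:R * pos y)%R x) =
    \int[M]_x expeR (- (k%:R%:E * mass x)).
  by apply: eq_integral => x _; rewrite point_sumZ//; exact: test_fun_pos.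
move=> ->; rewrite /= addrC subrK; congr (c * _)%:E.
by rewrite -powRrM mulrN.
Qed.

Lemma negbin_points_setT : M setT = c%:E.
Proof.
have := laplace_mass 0; rewrite addr0 powR1 mulr1 => <-.
under eq_integral do rewrite mul0e oppe0 expeR0.
by rewrite integral_cst// mul1e.
Qed.

Let coef_ge0 : (0 <= c / Gamma_fun (alpha * q))%R.
Proof. by rewrite divr_ge0// ltW// Gamma_fun_gt0. Qed.

Let M' : {measure set (measurableTypeR R) -> \bar R} :=
  mscale (NngNum coef_ge0) (gam (alpha * q)).

(** The exponential maps the total into [0, 1], where moments determine laws; an infinite mass
    becomes the value 0. *)
Let Y (x : rseq R) : R := fine (expeR (- mass x)).
Let Y' (t : measurableTypeR R) : R := expR (- pos t).

Let YE x : (Y x)%:E = expeR (- mass x).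
Proof. by rewrite fineK// expeRN_fin// mass_ge0. Qed.

Let Y01 : unit_valued Y.
Proof.
split.
  apply: measurableT_comp; first exact: fine_measurable.
  apply: (measurableT_comp measurable_expeR).
  by apply: measurableT_comp => //; exact: measurable_mass.
move=> x; rewrite -!lee_fin YE expeR_ge0/= expeRN_le1//; exact: mass_ge0.
Qed.

Let Y'01 : unit_valued Y'.
Proof.
split.
  apply: (measurableT_comp (@measurable_expR R)).
  by apply: measurable_funN; exact: measurable_pos.
by move=> x; rewrite expR_ge0/= -expR0 ler_expR oppr_le0 pos_ge0.
Qed.

Let M'T : M' setT = c%:E.
Proof.
rewrite /M'/= /mscale/= -EFin_Gamma_fun// -EFinM; congr EFin.
by field; rewrite gt_eqF// Gamma_fun_gt0.
Qed.

Let eqm : same_moments M M' Y Y'.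
Proof.
move=> k; transitivity (\int[M]_x expeR (- (k%:R%:E * mass x))).
  apply: eq_integral => x _; rewrite EFin_expe YE.
  elim: k => [|k IH]; first by rewrite mul0e oppe0 expeR0.
  rewrite expeS IH -expeRD -natr1 EFinD ge0_muleDl ?lee_fin// mul1e.
  by rewrite addeC oppeD// ge0_adde_def// inE ?mule_ge0 ?lee_fin// mass_ge0.
rewrite laplace_mass /M' ge0_integral_mscale//; last 2 first.
- apply/measurable_EFinP; apply: measurable_funX; exact: Y'01.1.
- by move=> x _; rewrite lee_fin exprn_ge0// expR_ge0.
transitivity ((c / Gamma_fun (alpha * q))%:E *
    \int[gam (alpha * q)]_x (expR (- (k%:R * x)))%:E).
  rewrite laplace_gam// -EFin_Gamma_fun// -!EFinM; congr EFin.
  by field; rewrite gt_eqF// Gamma_fun_gt0.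
congr (_ * _); rewrite !integral_gam.
- apply: eq_integral => x _; rewrite /Y' /pos -expRM_natl.
  rewrite /gamma_weight; case: ifPn => x0; last by rewrite !mule0.
  by rewrite (max_idPl (ltW x0)) mulrN.
- by move=> x; rewrite lee_fin exprn_ge0// expR_ge0.
- apply/measurable_EFinP; apply: measurable_funX; exact: Y'01.1.
- by move=> x; rewrite lee_fin expR_ge0.
- apply/measurable_EFinP; apply: (measurableT_comp (@measurable_expR R)).
  by apply: measurable_funN; exact: measurable_funM.
Qed.

Let same_law_Y A : measurable A -> M (Y @^-1` A) = M' (Y' @^-1` A).
Proof.
apply: moments_determine => //.
- by rewrite negbin_points_setT ltry.
- by rewrite M'T ltry.
Qed.

(** The mass is infinite exactly where [Y] is 0, and [Y'], which has the same law, never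
    vanishes. *)
Lemma negbin_mass_infty : M [set x | mass x = +oo] = 0.
Proof.
have -> : [set x | mass x = +oo] = Y @^-1` [set 0%R].
  apply/seteqP; split => x /= h.
    by apply: EFin_inj; rewrite YE h.
  by have : expeR (- mass x) == 0; [rewrite -YE h|rewrite expeR_eq0 eqe_oppLR => /eqP].
rewrite same_law_Y// (_ : _ @^-1` _ = set0) ?measure0//.
by apply/seteqP; split => // t /= /eqP; rewrite gt_eqF ?expR_gt0.
Qed.

Lemma negbin_rtotal_law L : measurable L ->
  M (rtotal @^-1` L) = (c / Gamma_fun (alpha * q))%:E * gam (alpha * q) L.
Proof.
move=> mL.
(* The image of L under t |-> e^{-t}; the value 0, which stands for infinite mass, is left out. *)
pose B : set R := [set y | (0 < y)%R /\ L (- ln y)%R].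
have mB : measurable B.
  rewrite (_ : B = `]0%R, +oo[%classic `&` (fun y => - ln y)%R @^-1` L).
    apply: measurableI => //; rewrite -[X in measurable X]setTI.
    have mln : measurable_fun [set: R] (fun y : R => - ln y)%R.
      by apply: measurable_funN; exact: measurable_ln.
    exact: (mln measurableT L mL).
  by apply/seteqP; split => y; rewrite /B /= in_itv/= andbT.
have mpre : measurable (rtotal @^-1` L).
  by rewrite -[X in measurable X]setTI; exact: (measurable_rtotal measurableT mL).
have moo : measurable [set x | mass x = +oo].
  rewrite -[X in measurable X]setTI.
  exact: (measurable_mass measurableT (emeasurable_set1 _)).
have BE : rtotal @^-1` L `\` [set x | mass x = +oo] = Y @^-1` B.
  apply/seteqP; split => x /=; rewrite /B /= /Y /rtotal.
    move=> [+ +]; case: (mass x) (mass_ge0 x) => [r| |]//= r0 Lr _.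
    by rewrite expR_gt0 expRK opprK.
  case: (mass x) (mass_ge0 x) => [r| |]//= r0; last by rewrite ltxx => -[].
  by rewrite expRK opprK => -[_ Lr].
transitivity (M (rtotal @^-1` L `\` [set x | mass x = +oo])).
  rewrite (measureDI M mpre moo) [X in _ + X](_ : _ = 0) ?adde0//.
  apply/eqP; rewrite -measure_le0 -negbin_mass_infty le_measure ?inE//.
  exact: measurableI.
rewrite BE same_law_Y//.
have -> : Y' @^-1` B = pos @^-1` L.
  apply/seteqP; split => t /=; rewrite /B /= /Y' expRK opprK.
    by move=> [].
  by rewrite expR_gt0.
rewrite /M'/= /mscale/=; congr (_ * _); rewrite !gamE.
rewrite integral_mkcond [RHS]integral_mkcond; apply: eq_integral => x _.
have [x0|x0] := ltP 0%R x.
  rewrite !patchE; congr (if _ then _ else _).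
  by apply/idP/idP; rewrite !inE /= /pos (max_idPl (ltW x0)).
have w0 : gamma_weight (alpha * q) x = 0%R by rewrite /gamma_weight ltNge x0.
by rewrite !patchE w0; case: ifPn; case: ifPn.
Qed.

End total_mass.

Section rectangles.
Local Open Scope ereal_scope.
Context d1 d2 (X : measurableType d1) (Y : measurableType d2) (R : realType).
Variables (m1 : {measure set X -> \bar R}) (m2 : {measure set Y -> \bar R})
  (m' : {measure set (X * Y) -> \bar R}).

Lemma integral_of_rectangles (phi : X * Y -> \bar R) :
  m1 setT < +oo -> m2 setT < +oo ->
  (forall A B, measurable A -> measurable B -> m' (A `*` B) = m1 A * m2 B) ->
  (forall z, 0 <= phi z) -> measurable_fun setT phi ->
  \int[m']_z phi z = \int[m1]_x \int[m2]_y phi (x, y).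
Proof.
move=> m1fin m2fin m'E phi0 mphi.
(* Restricting to the whole space equips [m1] with the finite-measure structure that products
   require. *)
pose F1 : {finite_measure set X -> \bar R} := mfrestr measurableT m1fin.
pose F2 : {finite_measure set Y -> \bar R} := mfrestr measurableT m2fin.
have F1E A : F1 A = m1 A by rewrite /F1/= /mfrestr /mrestr setIT.
have F2E A : F2 A = m2 A by rewrite /F2/= /mfrestr /mrestr setIT.
transitivity (\int[F1 \x F2]_z phi z).
  apply: eq_measure_integral => A mA _; apply/esym.
  by apply: product_measure_unique => // B C mB mC; rewrite (m'E _ _ mB mC) -F1E -F2E.
rewrite (fubini_tonelli1 (m1 := F1) (m2 := F2) _ mphi phi0).
transitivity (\int[F1]_x \int[m2]_y phi (x, y)).
  by apply: eq_integral => x _; apply: eq_measure_integral => B mB _; exact: F2E.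
by apply: eq_measure_integral => B mB _; exact: F1E.
Qed.

End rectangles.

(** * Successive size-biased picks *)

Section beta_ratio.
Context {R : realType}.
Local Notation mu := (@lebesgue_measure R).
Local Open Scope ereal_scope.

Definition beta_int (a b : R) (A : set R) : \bar R :=
  \int[mu]_(u in A `&` `]0%R, 1%R[) (beta_weight a b u)%:E.

Lemma beta_int_ge0 a b A : 0 <= beta_int a b A.
Proof. by apply: integral_ge0 => u _; rewrite lee_fin beta_weight_ge0. Qed.

Lemma beta_intE a b A : measurable A ->
  \int[mu]_(u in `]0%R, 1%R[) ((\1_A u)%:E * (beta_weight a b u)%:E) =
  beta_int a b A.
Proof.
move=> mA; rewrite /beta_int [RHS]integral_mkcondl; apply: eq_integral => u _.
by rewrite patchE indicE; case: ifPn => _; rewrite ?mul1e ?mul0e.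
Qed.

(** [integral_gam_gam] with constant functions. It is stated in the extended reals, since finiteness
    of the beta integral is deduced from it. *)
Lemma beta_int_gamma (a b : R) : (0 < a)%R -> (0 < b)%R ->
  (Gamma_fun a * Gamma_fun b)%:E = beta_int a b setT * (Gamma_fun (a + b))%:E.
Proof.
move=> a0 b0; rewrite EFinM (EFin_Gamma_fun a0) (EFin_Gamma_fun b0).
rewrite (EFin_Gamma_fun (addr_gt0 a0 b0)) -(beta_intE a b (@measurableT _ R)).
pose F u := (\1_[set: R] u)%:E : \bar R.
have F1 u : F u = 1 by rewrite /F indicE in_setT.
have mF : measurable_fun [set: R] F.
  by apply/measurable_EFinP; exact: measurable_indic.
have F0 u : 0 <= F u by rewrite F1.
have h : \int[gam a]_x \int[gam b]_t (F (x / (x + t))%R * cst 1 (x + t)%R) =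
    gam a setT * gam b setT.
  transitivity (\int[gam a]_x (cst (gam b setT) x)).
    apply: eq_integral => x _; transitivity (\int[gam b]_t (cst 1 t)).
      by apply: eq_integral => t _; rewrite F1 mul1e.
    by rewrite integral_cst// mul1e.
  by rewrite integral_cst; [exact: muleC|exact: measurableT].
rewrite -h.
have -> := @integral_gam_gam R a b F (cst 1) F0 mF (fun=> lee01) (measurable_cst _).
congr (_ * _); rewrite (integral_cst (gam (a + b))); last exact: measurableT.
exact: mul1e.
Qed.

Lemma beta_int_fin (a b : R) A : (0 < a)%R -> (0 < b)%R -> measurable A ->
  beta_int a b A \is a fin_num.
Proof.
move=> a0 b0 mA; rewrite ge0_fin_numE ?beta_int_ge0//.
apply: (@le_lt_trans _ _ (beta_int a b setT)).
  apply: ge0_subset_integral => //.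
  - exact: measurableI.
  - by rewrite setTI.
  - apply: measurable_funTS; apply/measurable_EFinP.
    exact: measurable_beta_weight.
  - by move=> u _; rewrite lee_fin beta_weight_ge0.
  - by move=> u [_ ?]; split.
(* An infinite beta integral would make the finite product of the two Gamma values infinite. *)
have := beta_int_gamma a0 b0; have := beta_int_ge0 a b setT.
case: (beta_int a b setT) => [r| |]//; first by rewrite ltry.
by rewrite gt0_mulye// lte_fin Gamma_fun_gt0// addr_gt0.
Qed.

Definition beta_ratio a b A : R :=
  (fine (beta_int a b A) / fine (beta_int a b setT))%R.

Lemma beta_ratio_ge0 a b A : (0 <= beta_ratio a b A)%R.
Proof. by rewrite divr_ge0// fine_ge0// beta_int_ge0. Qed.

Lemma beta_normalization (a b : R) : (0 < a)%R -> (0 < b)%R ->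
  (Gamma_fun a * Gamma_fun b = fine (beta_int a b setT) * Gamma_fun (a + b))%R.
Proof.
move=> a0 b0; apply: EFin_inj; rewrite (beta_int_gamma a0 b0) EFinM.
by rewrite (fineK (beta_int_fin a0 b0 (@measurableT _ R))).
Qed.

Lemma beta_intT_gt0 (a b : R) : (0 < a)%R -> (0 < b)%R ->
  (0 < fine (beta_int a b setT))%R.
Proof.
move=> a0 b0; have := beta_normalization a0 b0 => e.
have : (0 < Gamma_fun a * Gamma_fun b)%R by rewrite mulr_gt0 ?Gamma_fun_gt0.
by rewrite e pmulr_lgt0// Gamma_fun_gt0// addr_gt0.
Qed.

Lemma beta_ratioT (a b : R) : (0 < a)%R -> (0 < b)%R ->
  beta_ratio a b setT = 1%R.
Proof. by move=> a0 b0; rewrite /beta_ratio divff// gt_eqF// beta_intT_gt0. Qed.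

End beta_ratio.

Section successive_picks.
Context {R : realType}.
Local Open Scope ereal_scope.

(* rtotal x = 0 when the mass of x is infinite; all shares are then 0.        *)
Definition share (x : rseq R) (i : nat) : R := (pos (x i) / rtotal x)%R.

Lemma share_ge0 x i : (0 <= share x i)%R.
Proof. by rewrite divr_ge0 ?pos_ge0 ?rtotal_ge0. Qed.

Lemma measurable_pos_coord i : measurable_fun [set: rseq R] (fun x => pos (x i)).
Proof. exact: (measurableT_comp measurable_pos (measurable_coord i)). Qed.

Lemma measurable_share i : measurable_fun [set: rseq R] (share ^~ i).
Proof.
apply: measurable_funM; first exact: measurable_pos_coord.
by apply: measurable_funV; exact: measurable_rtotal.
Qed.

(* Conditional probability, given the points x, that the successive           *)
(* size-biased picks x_{s_0}, x_{s_1}, ... have ratios to the mass remaining  *)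
(* before the pick in A_0, A_1, ...                                           *)
Fixpoint pick_law (As : seq (set R)) (x : rseq R) : \bar R :=
  if As is A :: Bs then
    \sum_(i <oo) ((share x i * \1_A (share x i))%:E * pick_law Bs (zero_at i x))
  else 1.

Definition all_measurable (As : seq (set R)) :=
  forall k, measurable (nth setT As k).

Lemma all_measurable_cons A As : all_measurable (A :: As) ->
  measurable A /\ all_measurable As.
Proof. by move=> mAs; split=> [|k]; [exact: (mAs 0%N)|exact: (mAs k.+1)]. Qed.

Lemma pick_law_ge0 As x : 0 <= pick_law As x.
Proof.
elim: As x => [|A As IH] x //=.
apply: nneseries_ge0 => i _ _; apply: mule_ge0; last exact: IH.
by rewrite lee_fin mulr_ge0// share_ge0.
Qed.

Lemma measurable_pick_law As : all_measurable As ->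
  measurable_fun setT (pick_law As).
Proof.
elim: As => [|A As IH] /= mAs; first exact: measurable_cst.
have [mA /IH mK] := all_measurable_cons mAs.
apply: ge0_emeasurable_sum => [i x _ _|i _].
  by apply: mule_ge0; [rewrite lee_fin mulr_ge0// share_ge0|exact: pick_law_ge0].
apply: emeasurable_funM.
  apply/measurable_EFinP; apply: measurable_funM; first exact: measurable_share.
  apply: (measurableT_comp _ (measurable_share i)); exact: measurable_indic.
by apply: (measurableT_comp mK); exact: measurable_zero_at.
Qed.

Variable alpha : R.
Hypotheses (alpha_gt0 : (0 < alpha)%R) (alpha_lt1 : (alpha < 1)%R).
Local Notation Lambda := (Pi alpha_gt0 alpha_lt1).

(** Each pick turns BN(q) into BN(q + 1), so q grows by 1 along the list. *)
Fixpoint betas (q : R) (As : seq (set R)) : R :=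
  if As is A :: Bs then
    (beta_ratio (1 - alpha) (alpha * (q + 1)) A * betas (q + 1) Bs)%R
  else 1%R.

Lemma betas_ge0 q As : (0 <= betas q As)%R.
Proof.
by elim: As q => [|A As IH] q //=; rewrite mulr_ge0// beta_ratio_ge0.
Qed.

Let a := (1 - alpha)%R.
Let a_gt0 : (0 < a)%R. Proof. by rewrite subr_gt0. Qed.

Definition pos_on (C : set R) (y : R) : R := (pos y * \1_C y)%R.

Lemma test_fun_pos_on C : measurable C -> test_fun (pos_on C).
Proof.
move=> mC; have [mp p0 pn] := @test_fun_pos R; split.
- by apply: measurable_funM => //; exact: measurable_indic.
- by move=> x; rewrite mulr_ge0// p0.
- by move=> x x0; rewrite /pos_on pn// mul0r.
Qed.

Lemma integral_Pi_pos_on C : measurable C ->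
  \int[Lambda]_y (pos_on C y)%:E = (alpha / Gamma_fun a)%:E * gam a C.
Proof.
move=> mC; under eq_integral do rewrite /pos_on EFinM.
rewrite integral_Pi_id//; last first.
  by apply/measurable_EFinP; exact: measurable_indic.
by congr (_ * _); rewrite integral_indic// setIT.
Qed.

Lemma gam_lty (b : R) D : (0 < b)%R -> measurable D -> gam b D < +oo.
Proof.
move=> b0 mD; apply: le_lt_trans (gamT_lty b0).
by apply: le_measure; rewrite ?inE.
Qed.

Lemma gam_fin (b : R) D : (0 < b)%R -> measurable D -> gam b D \is a fin_num.
Proof. by move=> b0 mD; rewrite ge0_fin_numE// gam_lty. Qed.

Section palm_measure.
Variables (M : {measure set (rseq R) -> \bar R}) (c q : R) (g : R -> R).
Hypotheses (MNB : negbin_points Lambda M c q) (tg : test_fun g).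

Let g0 (i : nat) (x : rseq R) : 0 <= (g (x i))%:E.
Proof. by have [_ h _] := tg; rewrite lee_fin. Qed.

Let mg (i : nat) : measurable_fun setT (fun x : rseq R => (g (x i))%:E).
Proof.
have [mg' _ _] := tg; apply/measurable_EFinP.
by apply: (measurableT_comp mg'); exact: measurable_coord.
Qed.

(** Pick a point with weight [g] and delete it; the picked index is forgotten. *)
Definition palm_measure : {measure set (rseq R) -> \bar R} :=
  mixture M g0 mg (@measurable_zero_at R).

Lemma integral_palm_measure (F : rseq R -> \bar R) : (forall x, 0 <= F x) ->
  measurable_fun setT F ->
  \int[palm_measure]_x F x =
  \int[M]_x \sum_(i <oo) (F (zero_at i x) * (g (x i))%:E).
Proof. by move=> F0 mF; rewrite /palm_measure integral_mixture. Qed.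

(* Removing a point picked with weight g turns BN(q) into BN(q + 1). *)
Lemma negbin_points_palm : \int[Lambda]_x (g x)%:E < +oo ->
  negbin_points Lambda palm_measure
    (c * q * fine (\int[Lambda]_x (g x)%:E)) (q + 1).
Proof.
move=> gfin f tf ffin; rewrite -(palm_integral MNB tf tg ffin gfin).
rewrite integral_palm_measure; last 2 first.
- by move=> x; exact: expeR_ge0.
- apply: (measurableT_comp measurable_expeR).
  by apply: measurableT_comp => //; exact: measurable_point_sum.
apply: eq_integral => x _.
have [_ f0 _] := tf; have [_ gg0 _] := tg.
have s0 := point_sum_ge0 x tf.
have kE : point_sum (fun y => g y * expR (f y))%R x =
  \sum_(i <oo) (g (x i) * expR (f (x i)))%:E by [].
rewrite kE -(fineK (expeRN_fin s0)) -nneseriesZl//; last first.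
  by move=> i _; rewrite lee_fin mulr_ge0 ?expR_ge0.
apply: eq_eseriesr => i _; rewrite fineK ?expeRN_fin//.
rewrite (point_sum_zero_at i x tf) oppeD//.
rewrite expeRD /= (muleC (expR _)%:E) -muleA; congr (_ * _).
by rewrite -EFinM mulrCA -expRD addNr expR0 mulr1.
Qed.

End palm_measure.

End successive_picks.

Section laws_of_picks.
Context {R : realType}.
Local Open Scope ereal_scope.
Variable alpha : R.
Hypotheses (alpha_gt0 : (0 < alpha)%R) (alpha_lt1 : (alpha < 1)%R).
Local Notation Lambda := (Pi alpha_gt0 alpha_lt1).
Let a := (1 - alpha)%R.
Let a_gt0 : (0 < a)%R. Proof. by rewrite subr_gt0. Qed.

(** Palm's formula weights a pick by its size, a size-biased pick by size over total. This restores
    the factor 1 / s, which lowers Gamma(b + 1) to Gamma(b). *)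
Let weight_inv (L : set R) (s : R) : \bar R := (\1_L s * (pos s)^-1)%:E.

Let weight_inv_ge0 L s : 0 <= weight_inv L s.
Proof. by rewrite lee_fin mulr_ge0// invr_ge0 pos_ge0. Qed.

Let measurable_weight_inv L : measurable L -> measurable_fun setT (weight_inv L).
Proof.
move=> mL; apply/measurable_EFinP; apply: measurable_funM.
  exact: measurable_indic.
by apply: measurable_funV; exact: measurable_pos.
Qed.

Let integral_weight_inv (b : R) L : measurable L ->
  \int[gam (b + 1)]_s weight_inv L s = gam b L.
Proof.
move=> mL; rewrite integral_gam//; last exact: measurable_weight_inv.
rewrite gamE [RHS]integral_mkcond; apply: eq_integral => s _.
rewrite /weight_inv gamma_weightS -EFinM patchE indicE.
have [s0|s0] := ltP 0%R s; last first.
  by rewrite mul0r mulr0 /gamma_weight ltNge s0/=; case: ifP.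
rewrite /pos (max_idPl (ltW s0)) mulrA mulrVK ?unitfE ?gt_eqF//.
by case: ifP => _; rewrite ?mul1r ?mul0r.
Qed.

Section step.
Variables (M : {measure set (rseq R) -> \bar R}) (c q : R) (A L : set R)
  (As : seq (set R)).
Hypotheses (c_ge0 : (0 <= c)%R) (q_gt0 : (0 < q)%R)
  (MNB : negbin_points Lambda M c q)
  (mA : measurable A) (mL : measurable L) (mAs : all_measurable As).

Let b := (alpha * (q + 1))%R.
Let b_gt0 : (0 < b)%R.
Proof. by apply: mulr_gt0 => //; apply: addr_gt0. Qed.

(** [pick_law_integral] for the shorter list. It must hold for every measure and constant, because
    the Palm measure depends on the set [C] to which the picked size is restricted. *)
Hypothesis IH : forall (M' : {measure set (rseq R) -> \bar R}) (c' : R) D,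
  (0 <= c')%R -> negbin_points Lambda M' c' (q + 1) -> measurable D ->
  \int[M']_x ((\1_D (rtotal x))%:E * pick_law As x) =
  (c' / Gamma_fun b * betas alpha (q + 1) As)%:E * gam b D.

Let g (i : nat) (x : rseq R) : \bar R := (pos (x i))%:E * pick_law As (zero_at i x).

Let g0 i x : 0 <= g i x.
Proof. by apply: mule_ge0; [rewrite lee_fin pos_ge0|exact: pick_law_ge0]. Qed.

Let mg i : measurable_fun setT (g i).
Proof.
apply: emeasurable_funM; first by apply/measurable_EFinP; exact: measurable_pos_coord.
apply: (measurableT_comp (measurable_pick_law mAs)).
exact: measurable_zero_at.
Qed.

Let z (i : nat) (x : rseq R) : measurableTypeR R * measurableTypeR R :=
  (x i, rtotal (zero_at i x)).

Let mz i : measurable_fun setT (z i).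
Proof.
apply: measurable_fun_pair; first exact: measurable_coord.
by apply: (measurableT_comp measurable_rtotal); exact: measurable_zero_at.
Qed.

Let mA' : {measure set (measurableTypeR R * measurableTypeR R)%type -> \bar R} :=
  mixture M g0 mg mz.

Let kappa : R :=
  (c * q * (alpha / Gamma_fun a) / Gamma_fun b * betas alpha (q + 1) As)%R.

Let kappa_ge0 : (0 <= kappa)%R.
Proof.
have Ga : (0 <= Gamma_fun a)%R by apply/ltW/Gamma_fun_gt0.
have Gb : (0 <= Gamma_fun b)%R by apply/ltW/Gamma_fun_gt0.
have al : (0 <= alpha)%R by exact: ltW.
have q0 : (0 <= q)%R by exact: ltW.
apply: mulr_ge0; last exact: betas_ge0.
by rewrite divr_ge0// mulr_ge0 ?divr_ge0// mulr_ge0.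
Qed.

(* The factors are the sizes of the picked point and of the remaining mass.   *)
Let rectangle C D : measurable C -> measurable D ->
  mA' (C `*` D) = gam a C * (mscale (NngNum kappa_ge0) (gam b)) D.
Proof.
move=> mC mD.
have tC := test_fun_pos_on mC.
have PC := integral_Pi_pos_on alpha_gt0 alpha_lt1 mC.
have Pfin : \int[Lambda]_y (pos_on C y)%:E < +oo.
  rewrite PC; apply: lte_mul_pinfty => //; last exact: gam_lty.
  by rewrite lee_fin; exact: levy_coef_ge0.
have Pge0 : 0 <= \int[Lambda]_y (pos_on C y)%:E.
  by apply: integral_ge0 => y _; have [_ h _] := tC; rewrite lee_fin.
have := IH (mulr_ge0 (mulr_ge0 c_ge0 (ltW q_gt0)) (fine_ge0 Pge0))
  (negbin_points_palm MNB tC Pfin) mD.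
have mF : measurable_fun [set: rseq R]
    (fun x => (\1_D (rtotal x))%:E * pick_law As x).
  apply: emeasurable_funM; last exact: measurable_pick_law.
  apply/measurable_EFinP; apply: (measurableT_comp _ measurable_rtotal).
  exact: measurable_indic.
rewrite integral_palm_measure//; last first.
  by move=> x; apply: mule_ge0; [rewrite lee_fin|exact: pick_law_ge0].
have -> : \int[M]_x \sum_(i <oo) ((\1_D (rtotal (zero_at i x)))%:E *
    pick_law As (zero_at i x) * (pos_on C (x i))%:E) = mA' (C `*` D).
  rewrite -[RHS]mul1e -(integral_cst mA')//; last exact: measurableX.
  rewrite [RHS]integral_mkcond integral_mixture.
  - apply: eq_integral => x _; apply: eq_eseriesr => i _.
    rewrite patchE /z /g /pos_on !indicE in_setX /=.
    case: (x i \in C); case: (rtotal _ \in D);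
      rewrite /= ?mulr1 ?mulr0 ?mul1e ?mul0e ?mule0//.
    exact: muleC.
  - by move=> y; rewrite patchE; case: ifP.
  - by apply/(measurable_restrictT _ _).1 => //; exact: measurableX.
move=> ->; rewrite PC /mscale/=.
have Cfin := gam_fin a_gt0 mC; have Dfin := gam_fin b_gt0 mD.
rewrite -(fineK Cfin) -(fineK Dfin) -!EFinM; congr EFin.
by rewrite /kappa /=; ring.
Qed.

Let phi (y : measurableTypeR R * measurableTypeR R) : \bar R :=
  (\1_A (y.1 / (y.1 + y.2)))%:E * weight_inv L (y.1 + y.2)%R.

Let mind : measurable_fun [set: R] (fun u : R => (\1_A u)%:E : \bar R).
Proof. by apply/measurable_EFinP; exact: measurable_indic. Qed.

Let phi_ge0 y : 0 <= phi y.
Proof. by rewrite /phi mule_ge0// lee_fin. Qed.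

Let measurable_phi : measurable_fun setT phi.
Proof.
have ms : measurable_fun
      [set: measurableTypeR R * measurableTypeR R] (fun y => y.1 + y.2 : R)%R.
  by apply: measurable_funD; [exact: measurable_fst|exact: measurable_snd].
apply: emeasurable_funM; last exact: (measurableT_comp (measurable_weight_inv mL)).
apply: (measurableT_comp mind); apply: measurable_funM; first exact: measurable_fst.
exact: measurable_funV.
Qed.

Let integral_phi : \int[mA']_y phi y =
  (c / Gamma_fun (alpha * q) * betas alpha q (A :: As))%:E * gam (alpha * q) L.
Proof.
have m2fin : mscale (NngNum kappa_ge0) (gam b) setT < +oo.
  rewrite /mscale /=; apply: lte_mul_pinfty; [exact: kappa_ge0|by []|].
  exact: gamT_lty.
rewrite (@integral_of_rectangles _ _ _ _ R (gam a)
  (mscale (NngNum kappa_ge0) (gam b)) mA' phi (gamT_lty a_gt0) m2fin rectangle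
  phi_ge0 measurable_phi).
have mphi2 x : measurable_fun [set: R] (fun t => phi (x, t)).
  exact: (measurable_fun_pair2 x measurable_phi).
have mint : measurable_fun [set: measurableTypeR R]
    (fun x => \int[gam b]_t phi (x, t)).
  rewrite (_ : (fun x => _) = fun x =>
      \int[lebesgue_measure]_t (phi (x, t) * (gamma_weight b t)%:E)); last first.
    by apply/funext => x; rewrite integral_gam.
  pose h (y : measurableTypeR R * measurableTypeR R) :=
    phi y * (gamma_weight b y.2)%:E.
  apply: (measurable_fun_fubini_tonelli_F (m2 := lebesgue_measure) h).
    apply: emeasurable_funM => //; apply/measurable_EFinP.
    by apply: (measurableT_comp (measurable_gamma_weight b)); exact: measurable_snd.
  by move=> y; apply: mule_ge0; rewrite ?phi_ge0// lee_fin gamma_weight_ge0.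
transitivity (kappa%:E * \int[gam a]_x \int[gam b]_t phi (x, t)).
  rewrite -(@ge0_integralZl _ _ _ (gam a) _ measurableT _ mint); last 2 first.
  - by move=> x _; exact: integral_ge0.
  - by rewrite lee_fin.
  apply: eq_integral => x _; rewrite ge0_integral_mscale//.
  exact: mphi2.
rewrite (integral_gam_gam a b (F := fun u => (\1_A u)%:E) (G := weight_inv L))//.
- rewrite beta_intE//.
  have -> : (a + b = alpha * q + 1)%R by rewrite /a /b; ring.
  rewrite integral_weight_inv// muleA; congr (_ * _).
  rewrite -(fineK (beta_int_fin a_gt0 b_gt0 mA)) -EFinM; congr EFin.
  (* As a + b = alpha q + 1, the functional equation gives Gamma(a) Gamma(b) = B(a, b) alpha q
     Gamma(alpha q). This absorbs the factor alpha q that Palm's formula and the density put into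
     [kappa]. *)
  have e := beta_normalization a_gt0 b_gt0.
  rewrite (_ : a + b = alpha * q + 1)%R in e; last by rewrite /a /b; ring.
  rewrite Gamma_funS ?mulr_gt0// in e.
  rewrite /= -/a -/b /beta_ratio /kappa.
  have Ga := Gamma_fun_gt0 a_gt0; have Gb := Gamma_fun_gt0 b_gt0.
  have Gq : (0 < Gamma_fun (alpha * q))%R by rewrite Gamma_fun_gt0 ?mulr_gt0.
  have B0 := beta_intT_gt0 a_gt0 b_gt0.
  have -> : (Gamma_fun a = fine (beta_int a b setT) *
      (alpha * q * Gamma_fun (alpha * q)) / Gamma_fun b)%R.
    by rewrite -e; field; rewrite gt_eqF.
  by field; rewrite !gt_eqF.
- exact: measurable_weight_inv.
Qed.

Lemma pick_law_step :
  \int[M]_x ((\1_L (rtotal x))%:E * pick_law (A :: As) x) =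
  (c / Gamma_fun (alpha * q) * betas alpha q (A :: As))%:E * gam (alpha * q) L.
Proof.
rewrite -integral_phi integral_mixture//.
apply: ge0_ae_eq_integral => //.
- apply: emeasurable_funM; last first.
    apply: measurable_pick_law => -[|k] /=; [exact: mA|exact: mAs].
  apply/measurable_EFinP; apply: (measurableT_comp _ measurable_rtotal).
  exact: measurable_indic.
- apply: ge0_emeasurable_sum => [i x _ _|i _]; first by rewrite mule_ge0.
  by apply: emeasurable_funM => //; exact: (measurableT_comp measurable_phi).
- by move=> x _; apply: mule_ge0; [rewrite lee_fin|exact: pick_law_ge0].
- by move=> x _; apply: nneseries_ge0 => i _ _; rewrite mule_ge0.
(* On this null set [rtotal] is 0 and does not split into the picked point and the rest. *)
exists [set x : rseq R | mass x = +oo]; split.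
- rewrite -[X in measurable X]setTI.
  exact: (measurable_mass measurableT (emeasurable_set1 _)).
- exact: (negbin_mass_infty c_ge0 q_gt0 MNB).
move=> x /= hx; apply: contrapT => xoo; apply: hx => _.
rewrite -nneseriesZl; last first.
  move=> i _; apply: mule_ge0; last exact: pick_law_ge0.
  by rewrite lee_fin mulr_ge0// share_ge0.
apply: eq_eseriesr => i _.
have xfin : mass x \is a fin_num.
  by rewrite ge0_fin_numE ?mass_ge0// ltey; exact/eqP.
have xi := rtotal_zero_at i xfin.
rewrite /phi /g /z /weight_inv /share /=.
have [x0|x0] := ltP 0%R (x i); last first.
  have -> : pos (x i) = 0%R by apply/max_idPr.
  by rewrite !mul0r !mul0e !mule0.
have px : pos (x i) = x i by apply/max_idPl/ltW.
rewrite px in xi *; rewrite -xi.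
have -> : pos (rtotal x) = rtotal x by apply/max_idPl; exact: rtotal_ge0.
rewrite !muleA -!EFinM; congr (_%:E * _).
by ring.
Qed.

End step.

(** The set L is carried along because the first fraction involves the mass left after the pick: the
    induction needs that mass jointly with the later fractions. *)
Theorem pick_law_integral As (M : {measure set (rseq R) -> \bar R}) (c q : R) L :
  (0 <= c)%R -> (0 < q)%R -> negbin_points Lambda M c q -> measurable L ->
  all_measurable As ->
  \int[M]_x ((\1_L (rtotal x))%:E * pick_law As x) =
  (c / Gamma_fun (alpha * q) * betas alpha q As)%:E * gam (alpha * q) L.
Proof.
elim: As M c q L => [|A As IH] M c q L c0 q0 MNB mL mAs.
  rewrite /= mulr1 -(negbin_rtotal_law c0 q0 MNB)//.
  under eq_integral do rewrite mule1.
  rewrite -[RHS]mul1e -(integral_cst M); last first.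
    rewrite -[X in measurable X]setTI; exact: (measurable_rtotal measurableT mL).
  rewrite [RHS]integral_mkcond; apply: eq_integral => x _.
  rewrite patchE indicE.
  have -> : (x \in rtotal @^-1` L) = (rtotal x \in L) by apply/idP/idP; rewrite !inE.
  by case: (_ \in _).
have [mA mAs'] := all_measurable_cons mAs.
apply: pick_law_step => // M' c' D c'0 M'NB mD.
by apply: IH => //; rewrite addr_gt0.
Qed.

End laws_of_picks.

(** * Uniqueness of the Poisson-Dirichlet law *)

Section ae_facts.
Context d (T : measurableType d) (R : realType).
Local Open Scope ereal_scope.

Lemma measure_ae_eq (P : {measure set T -> \bar R}) (A B : set T) :
  measurable A -> measurable B -> {ae P, forall w, A w <-> B w} -> P A = P B.
Proof.
move=> mA mB [N [mN N0 sN]].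
have le C D : measurable C -> measurable D ->
    (forall w, ~ N w -> C w -> D w) -> P C <= P D.
  move=> mC mD CD; apply: (@le_trans _ _ (P (D `|` N))).
    apply: le_measure; rewrite ?inE//; first exact: measurableU.
    move=> w Cw; have [Nw|Nw] := pselect (N w); first by right.
    by left; exact: CD.
  by rewrite -[leRHS]adde0 -N0 measureU2.
have AB w : ~ N w -> A w <-> B w.
  by move=> Nw; apply: contrapT => h; apply: Nw; exact: sN.
by apply/le_anti/andP; split; apply: le => // w /AB[].
Qed.

End ae_facts.

Lemma sum_uniq_le (R : realType) (v : nat -> R) (h : seq nat) :
  (forall i, 0 <= v i)%R -> uniq h ->
  ((\sum_(j <- h) v j)%:E <= \sum_(0 <= i <oo) (v i)%:E)%E.
Proof.
move=> v0 uh; pose N := (\max_(j <- h) j).+1.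
apply: (@le_trans _ _ (\sum_(0 <= i < N) (v i)%:E)%E); last first.
  by apply: nneseries_lim_ge => i _ _; rewrite lee_fin.
rewrite sumEFin lee_fin.
have ph : perm_eq h [seq j <- index_iota 0 N | j \in h].
  apply: uniq_perm => //; first by rewrite filter_uniq ?iota_uniq.
  move=> j; rewrite mem_filter mem_index_iota /=.
  by case: (boolP (j \in h)) => //= jh; rewrite /N ltnS leq_bigmax_seq.
rewrite (perm_big _ ph) big_filter /= [leLHS]big_mkcond.
by apply: ler_sum => j _; case: ifP.
Qed.

(** * A size-biased permutation exhausts the indices *)

Section size_biased_bijection.
Context {R : realType} d (T : measurableType d) (P : probability T R).
Local Open Scope ereal_scope.
Variables (V : T -> rseq R) (s : nat -> {RV P >-> nat}).
Hypotheses (mV : measurable_fun setT V)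
  (Vpart : {ae P, forall w, decreasing_partition_of_unity (V w)})
  (sbo : size_biased_order V s).

Let picks w n := mkseq (fun k => s k w) n.

Let sE k j : measurable [set w | s k w = j].
Proof.
have := @measurable_funPT _ _ _ _ (s k) measurableT [set j] I.
by rewrite setTI.
Qed.

Let measurable_picks (h : seq nat) : measurable [set w | picks w (size h) = h].
Proof.
rewrite (_ : [set w | _] =
    \bigcap_(k in `I_(size h)) [set w | s k w = nth 0%N h k]); last first.
  apply/seteqP; split => w /=.
    by move=> hE k /= kh; rewrite -[in RHS]hE nth_mkseq.
  move=> hE; apply: (@eq_from_nth _ 0%N); rewrite size_mkseq// => k kh.
  by rewrite nth_mkseq//; exact: hE.
by apply: bigcap_measurableType => k _; exact: sE.
Qed.

Let E (h : seq nat) (A : set (rseq R)) :=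
  [set w | V w \in A /\ picks w (size h) = h].

Let measurable_E h A : measurable A -> measurable (E h A).
Proof.
move=> mA; rewrite (_ : E h A = V @^-1` A `&` [set w | picks w (size h) = h]).
  apply: measurableI => //; rewrite -[X in measurable X]setTI; exact: mV.
by apply/seteqP; split => w /=; rewrite /E /= inE.
Qed.

Let repeat_null (h : seq nat) (i : nat) : i \in h ->
  P (E h setT `&` [set w | s (size h) w = i]) = 0.
Proof.
by move=> ih; rewrite sbo// integral0_eq// => w _; rewrite ih.
Qed.

(** Picking an index again has conditional probability 0, and there are countably many pairs of a
    history and an index. *)
Lemma size_biased_inj : {ae P, forall w, injective (fun k => s k w)}.
Proof.
pose F (m : nat) : set T := if unpickle m is Some (h, i) then
  if i \in (h : seq nat) then E h setT `&` [set w | s (size h) w = i] else set0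
  else set0.
have : P.-negligible (\bigcup_m F m).
  apply: negligible_bigcup => m; rewrite /F.
  case: unpickle => [[h i]|]; last exact: negligible_set0.
  case: ifPn => [ih|_]; last exact: negligible_set0.
  apply/negligibleP; last exact: repeat_null.
  by apply: measurableI; [exact: measurable_E|exact: sE].
apply: negligibleS => w /= ninj; apply: contrapT => nF; apply: ninj.
have key m n : (m < n)%N -> s m w <> s n w.
  move=> mn smn; apply: nF.
  exists (pickle (picks w n, s n w)) => //; rewrite /F pickleK.
  have -> : s n w \in picks w n.
    by apply/mapP; exists m; rewrite ?mem_iota// smn.
  by split; [split; [rewrite in_setT|rewrite size_mkseq]|rewrite /= size_mkseq].
move=> m n /= smn; case: (ltngtP m n) => // h.
  by have := key _ _ h.
by have := key _ _ h; rewrite smn.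
Qed.

Let B (i : nat) (e : R) (n : nat) :=
  [set w | (e <= V w i)%R /\ i \notin picks w n].

Let A_ (i : nat) (e : R) : set (rseq R) := [set v | (e <= v i)%R].

Let mA_ i e : measurable (A_ i e).
Proof.
rewrite (_ : A_ i e = (fun v : rseq R => v i) @^-1` `[e, +oo[).
  rewrite -[X in measurable X]setTI.
  exact: (@measurable_coord R i measurableT `[e, +oo[%classic (measurable_itv _)).
by apply/seteqP; split => v; rewrite /A_ /= in_itv/= andbT.
Qed.

(** [B i e n] split by the history with code m, so that [size_biased_order] applies to each
    piece. *)
Let Fh (i : nat) (e : R) (n m : nat) : set T :=
  if @pickle_inv (seq nat) m is Some h then
    if (size h == n) && (i \notin h) then E h (A_ i e) else set0
  else set0.

Let mFh i e n m : measurable (Fh i e n m).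
Proof.
rewrite /Fh; case: pickle_inv => // h; case: ifP => // _.
exact: measurable_E.
Qed.

Let trivFh i e n : trivIset setT (Fh i e n).
Proof.
apply/trivIsetP => m1 m2 _ _ m12; rewrite -subset0 => w [].
have := @pickle_invK (seq nat) m1; have := @pickle_invK (seq nat) m2.
rewrite /Fh; case: pickle_inv => [h2|]//= pm2; case: pickle_inv => [h1|]//= pm1.
case: ifP => // /andP[/eqP s1 _] [_ p1]; case: ifP => // /andP[/eqP s2 _] [_ p2].
by move: m12; rewrite -pm1 -pm2 -p1 -p2 s1 s2 eqxx.
Qed.

Let BE i e n : B i e n = \bigcup_m Fh i e n m.
Proof.
apply/seteqP; split => w.
  move=> [ew iw]; exists (pickle (picks w n)) => //.
  by rewrite /Fh pickleK_inv size_mkseq eqxx iw /=; split; rewrite ?inE ?size_mkseq.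
move=> [m _]; rewrite /Fh; case: pickle_inv => [h|]//.
case: ifP => // /andP[/eqP <- ih] [].
by rewrite inE /B /= => ? ->.
Qed.

Let mB i e n : measurable (B i e n).
Proof. by rewrite BE; apply: bigcup_measurable => m _; exact: mFh. Qed.

Let B_S i e n : B i e n.+1 = \bigcup_m (Fh i e n m `\` [set w | s n w = i]).
Proof.
transitivity (B i e n `\` [set w | s n w = i]); last by rewrite BE setD_bigcupl.
apply/seteqP; split => w; rewrite /B /picks /= mkseqS mem_rcons inE negb_or.
  by move=> [ei /andP[/eqP h iw]]; split => // h'; apply: h.
by move=> [[ei iw] h]; split => //; rewrite iw andbT; apply/eqP => h'; apply: h.
Qed.

Let pick_prob i e h : (0 < e)%R -> i \notin h ->
  e%:E * P (E h (A_ i e)) <= P (E h (A_ i e) `&` [set w | s (size h) w = i]).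
Proof.
move=> e0 ih; have mEh := measurable_E h (mA_ i e).
rewrite sbo; last exact: mA_.
rewrite -/(E h (A_ i e)) (negbTE ih).
have mVj j : measurable_fun setT (fun w => V w j).
  exact: (measurableT_comp (@measurable_coord R j) mV).
have mf : measurable_fun (E h (A_ i e))
    (fun w => (V w i / (1 - \sum_(j <- h) V w j))%R).
  apply: measurable_funTS; apply: measurable_funM => //.
  apply: measurable_funV; apply: measurable_funB => //.
  exact: measurable_sum.
have mmax : measurable_fun (E h (A_ i e))
    (fun w => (Num.max (V w i / (1 - \sum_(j <- h) V w j)) e)%:E).
  by apply/measurable_EFinP; apply: measurable_maxr => //; exact: measurable_cst.
(* The remaining mass is at most 1, so the quotient is at least e, but only almost surely; the
   maximum with e makes the bound pointwise. Distinctness of the picked indices keeps the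
   denominator positive. *)
rewrite (@ae_eq_integral _ _ _ P (E h (A_ i e))
  (fun w => (Num.max (V w i / (1 - \sum_(j <- h) V w j)) e)%:E)) //.
- rewrite -integral_cst//; apply: ge0_le_integral => //.
  + by move=> w _; rewrite lee_fin ltW.
  + by move=> w _; rewrite lee_fin le_max lexx orbT.
- exact/measurable_EFinP.
apply: filterS2 Vpart size_biased_inj => w [V0 Vd V1] inj [].
rewrite inE => eV hE.
have uh : uniq (i :: h).
  by rewrite /= ih -hE map_inj_uniq ?iota_uniq.
have := sum_uniq_le (fun j => ltW (V0 j)) uh.
rewrite V1 big_cons lee_fin => S1.
have S0 : (0 <= \sum_(j <- h) V w j)%R by apply: sumr_ge0 => j _; exact: ltW.
have Vi := V0 i.
congr EFin; apply/esym/max_idPl; rewrite ler_pdivlMr; last by lra.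
by move: eV; rewrite /A_ /=; nra.
Qed.

(* As long as a term of size at least e has not been picked, each pick takes  *)
(* it with conditional probability at least e.                                *)
Let B_decay i e n : (0 < e <= 1)%R -> P (B i e n) <= ((1 - e) ^+ n)%:E.
Proof.
move=> /andP[e0 e1]; have e1' : (0 <= 1 - e)%R by rewrite subr_ge0.
elim: n => [|n IH]; first by rewrite expr0; exact: probability_le1.
apply: (@le_trans _ _ ((1 - e)%:E * P (B i e n))); last first.
  by rewrite exprS EFinM lee_wpmul2l ?lee_fin.
have mF m : measurable (Fh i e n m `\` [set w | s n w = i]).
  by apply: measurableD => //; exact: sE.
have tF : trivIset setT (fun m => Fh i e n m `\` [set w | s n w = i]).
  move=> m1 m2 _ _ [w [[F1 _] [F2 _]]].
  by apply: (trivFh (i := i) (e := e) (n := n)) => //; exists w.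
rewrite B_S BE !measure_bigcup// -nneseriesZl//.
apply: lee_nneseries => // m _.
rewrite (measureD (mFh i e n m) (sE n i)); last first.
  exact: le_lt_trans (probability_le1 _ (mFh i e n m)) (ltry 1).
have fin : P (Fh i e n m) \is a fin_num by exact: fin_num_measure.
rewrite EFinB muleBl ?mul1e//.
rewrite leeB// /Fh; case: pickle_inv => [h|]; last by rewrite measure0 mule0.
case: ifP => [/andP[/eqP <- ih]|_]; last by rewrite measure0 mule0.
exact: pick_prob.
Qed.

(** V_i is at least some 1 / (m + 1), and then i escapes n picks with probability at most (1 - 1 /
    (m + 1))^n, which tends to 0. *)
Lemma size_biased_surj : {ae P, forall w i, exists k, s k w = i}.
Proof.
have Bnull i (m : nat) : P.-negligible (\bigcap_n B i m.+1%:R^-1 n).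
  have e01 : (0 < (m.+1%:R^-1 : R) <= 1)%R.
    by rewrite invr_gt0 ltr0n/= invf_le1 ?ltr0n// ler1n.
  have mBn : measurable (\bigcap_n B i m.+1%:R^-1 n).
    by apply: bigcap_measurableType => n _; exact: mB.
  apply/negligibleP => //; apply/le_anti/andP; split => //.
  apply: (cvge_ge (f := fun n => ((1 - m.+1%:R^-1) ^+ n : R)%:E) (F := \oo)).
    apply: nearW => n; apply: le_trans (B_decay i n e01).
    by apply: le_measure; rewrite ?inE// => w; apply.
  apply: cvg_EFin; first exact: nearW.
  apply: cvg_expr; move: e01 => /andP[e0 e1].
  by rewrite ger0_norm ?subr_ge0// ltrBlDr ltrDl.
have : P.-negligible (\bigcup_i \bigcup_m \bigcap_n B i m.+1%:R^-1 n).
  by apply: negligible_bigcup => i; apply: negligible_bigcup => m; exact: Bnull.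
move=> nB; pose bad := \bigcup_i \bigcup_m \bigcap_n B i m.+1%:R^-1 n.
have {}nB : {ae P, forall w, ~ bad w}.
  by apply: negligibleS nB => w /= /contrapT.
apply: filterS2 Vpart nB => w [V0 _ _] Bw.
apply: contrapT => nw; apply: Bw.
have /existsNP[i hi] := nw.
exists i => //; exists (Num.truncn (V w i)^-1) => // n _; split.
  rewrite invf_ple ?posrE ?V0// ltW//; exact: truncnS_gt.
by apply/negP => /mapP[k _ ki]; apply: hi; exists k.
Qed.

End size_biased_bijection.

(** * Recovering the decreasing sequence from its sticks *)

Section stick_breaking.
Context {R : realType}.

Definition stick (u : nat -> R) (n : nat) : R := u n * \prod_(i < n) (1 - u i).

(* Invariant under reordering of v, and equivalent to x < v i when v is       *)
(* nonincreasing.                                                             *)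
Definition many_above (i : nat) (x : \bar R) (v : nat -> R) : Prop :=
  exists l : seq nat,
    [/\ uniq l, (i < size l)%N & forall j, j \in l -> (x < (v j)%:E)%E].

Lemma many_above_nonincreasing (v : nat -> R) i x :
  (forall j, v j.+1 <= v j) -> many_above i x v <-> (x < (v i)%:E)%E.
Proof.
move=> vd; have vd' : {homo v : m n / (m <= n)%N >-> n <= m}.
  by apply: homo_leq => // a b c h1 h2; exact: le_trans h2 h1.
split=> [[l [ul il xl]]|xi].
  (* More than i distinct indices cannot all be below i. *)
  have /hasP[j jl ij] : has (leq i) l.
    apply: contraT => /hasPn nh.
    suff : (size l <= size (iota 0 i))%N by rewrite size_iota leqNgt il.
    apply: uniq_leq_size => // j /nh; rewrite -ltnNge mem_iota//.
  by apply: lt_le_trans (xl _ jl) _; rewrite lee_fin; exact: vd'.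
exists (iota 0 i.+1); split; [exact: iota_uniq|by rewrite size_iota|].
move=> j; rewrite mem_iota add0n ltnS => ji.
by apply: lt_le_trans xi _; rewrite lee_fin; exact: vd'.
Qed.

Lemma many_above_reindex (v u : nat -> R) (s : nat -> nat) i x :
  injective s -> (forall j, exists k, s k = j) -> (forall n, v (s n) = u n) ->
  many_above i x v <-> many_above i x u.
Proof.
move=> inj surj vs; split=> [] [l [ul il xl]].
  have [g gs] := choice surj; exists (map g l); split.
  - by rewrite map_inj_uniq//; exact: can_inj gs.
  - by rewrite size_map.
  - by move=> _ /mapP[j jl ->]; rewrite -vs gs; exact: xl.
exists (map s l); split.
- by rewrite map_inj_uniq.
- by rewrite size_map.
- by move=> _ /mapP[j jl ->]; rewrite vs; exact: xl.
Qed.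

(** The event that the decreasing rearrangement of the sticks lies in [ray_box k x], written without
    constructing that rearrangement. *)
Definition stick_box (k : nat) (x : nat -> \bar R) : set (rseq R) :=
  [set u | forall i, (i < k)%N -> many_above i (x i) (stick u)].

Lemma measurable_stick n : measurable_fun [set: rseq R] (stick ^~ n).
Proof.
apply: measurable_funM; first exact: measurable_coord.
apply: measurable_prod => i _; apply: measurable_funB => //.
exact: measurable_coord.
Qed.

Lemma measurable_stick_box k x : measurable (stick_box k x).
Proof.
(* [many_above] is a countable union over the codes of finite lists. *)
pose F i m : set (rseq R) := if @pickle_inv (seq nat) m is Some l then
  if uniq l && (i < size l)%N then
    \bigcap_(j in [set` l]) [set u | (x i < (stick u j)%:E)%E] else set0
  else set0.
rewrite (_ : stick_box k x = \bigcap_(i in `I_k) \bigcup_m F i m); last first.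
  apply/seteqP; split => u /= H i ik; have := H i ik.
    move=> [l [ul il xl]]; exists (pickle l) => //.
    by rewrite /F pickleK_inv ul il /= => j /=; exact: xl.
  move=> [m _]; rewrite /F; case: pickle_inv => [l|]//.
  by case: ifP => // /andP[ul il] h; exists l.
apply: bigcap_measurableType => i _; apply: bigcup_measurable => m _.
rewrite /F; case: pickle_inv => [l|]//; case: ifP => // _.
apply: bigcap_measurableType => j _.
rewrite (_ : [set u | _] = (fun u => (stick u j)%:E) @^-1` `]x i, +oo[); last first.
  by apply/seteqP; split => u /=; rewrite ?in_itv/= ?andbT.
rewrite -[X in measurable X]setTI.
have : measurable_fun [set: rseq R] (fun u => (stick u j)%:E).
  by apply/measurable_EFinP; exact: measurable_stick.
by apply => //; exact: emeasurable_itv.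
Qed.

End stick_breaking.

Section uniqueness.
Context {R : realType}.
Variables alpha theta : R.
Local Open Scope ereal_scope.

Section law.
Context d (T : measurableType d) (P : probability T R)
  (V : T -> rseq R) (s : nat -> {RV P >-> nat}) (U : nat -> {RV P >-> R}).
Hypotheses (mV : measurable_fun setT V)
  (Vpart : {ae P, forall w, decreasing_partition_of_unity (V w)})
  (sbo : size_biased_order V s)
  (indU : mutually_independent U)
  (betaU : forall i,
     beta_distributed (U i) (1 - alpha)%R (theta + i.+1%:R * alpha)%R)
  (stickU : {ae P, forall w, forall n,
     V w (s n w) = (U n w * \prod_(i < n) (1 - U i w))%R}).

Definition joint (w : T) : rseq R := fun i => U i w.

Lemma measurable_joint : measurable_fun setT joint.
Proof. by apply: measurable_to_rseq => i; exact: measurable_funPT. Qed.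

Lemma ray_box_stick_box k x :
  P (V @^-1` ray_box k x) = P (joint @^-1` stick_box k x).
Proof.
apply: measure_ae_eq.
- by rewrite -[X in measurable X]setTI; apply: mV => //; exact: measurable_ray_box.
- rewrite -[X in measurable X]setTI; apply: measurable_joint => //.
  exact: measurable_stick_box.
apply: filterS2 stickU (filterI (size_biased_inj mV sbo)
  (filterI Vpart (size_biased_surj mV Vpart sbo))).
move=> w st [inj [[_ Vd _] surj]].
by split=> h i /h{h}; rewrite -(many_above_nonincreasing i (x i) Vd);
  apply (many_above_reindex i (x i) inj surj st).
Qed.

Lemma joint_ray_box k x : P (joint @^-1` ray_box k x) =
  \prod_(i <- iota 0 k) (beta_int (1 - alpha) (theta + i.+1%:R * alpha) 
    [set y | x i < y%:E] / beta_int (1 - alpha) (theta + i.+1%:R * alpha) setT).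
Proof.
pose A i := [set y : R | x i < y%:E].
have mA i : measurable (A i).
  rewrite (_ : A i = EFin @^-1` `]x i, +oo[); last first.
    by apply/seteqP; split => u /=; rewrite ?in_itv/= ?andbT.
  rewrite -[X in measurable X]setTI; apply: (@EFin_measurable R setT) => //.
  exact: emeasurable_itv.
have := indU (iota_uniq 0 k) mA.
rewrite (_ : \bigcap_(i in _) _ = joint @^-1` ray_box k x); last first.
  by apply/seteqP; split => w /= h i /=; rewrite ?mem_iota => ik; apply: h => /=;
    rewrite ?mem_iota.
by move=> ->; apply: eq_bigr => i _; rewrite betaU// /beta_int setTI.
Qed.

End law.

(** The two realisations may live on different sample spaces, so the fractions are compared through
    their image measures on the sequence space; these agree on ray boxes by independence, hence on
    stick boxes. *)
Lemma PD_law_unique (nu nu' : probability (rseq R) R) :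
  PD_law alpha theta nu -> PD_law alpha theta nu' -> same_law nu nu'.
Proof.
move=> [d [T [P [V [s [U [[mV lV] part sbo [ind bet] st]]]]]]].
move=> [d' [T' [P' [V' [s' [U' [[mV' lV'] part' sbo' [ind' bet'] st']]]]]]].
suff box k x : nu (ray_box k x) = nu' (ray_box k x).
  apply: rseq_measure_unique => //.
  exact: le_lt_trans (probability_le1 nu measurableT) (ltry 1).
 rewrite lV; last exact: measurable_ray_box.
rewrite lV'; last exact: measurable_ray_box.
rewrite (ray_box_stick_box _ part sbo st)// (ray_box_stick_box _ part' sbo' st')//.
have mD := measurable_stick_box k x.
rewrite -(image_measureE P (measurable_joint U) mD).
rewrite -(image_measureE P' (measurable_joint U') mD).
apply: rseq_measure_unique => //.
- by rewrite image_measureE// preimage_setT (le_lt_trans (probability_le1 P _))// ltry.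
- move=> l y; have mB := measurable_ray_box l y.
  rewrite !image_measureE//; transitivity (P (joint U @^-1` ray_box l y)) => //.
  by rewrite (joint_ray_box ind bet) -(joint_ray_box ind' bet').
Qed.

End uniqueness.

(** * Realisation of the size-biased permutation *)

Lemma measurable_nat_select d1 d2 (X : measurableType d1) (Y : measurableType d2)
    (N : X -> nat) (f : nat -> X -> Y) :
  (forall i, measurable [set x | N x = i]) ->
  (forall i, measurable_fun setT (f i)) ->
  measurable_fun setT (fun x => f (N x) x).
Proof.
move=> mN mf _ B mB; rewrite setTI.
rewrite (_ : _ @^-1` B = \bigcup_i ([set x | N x = i] `&` f i @^-1` B)).
  apply: bigcup_measurable => i _; apply: measurableI => //.
  by rewrite -[X in measurable X]setTI; exact: mf.
by apply/seteqP; split => x /= => [h|[i _ [<-]]]; [exists (N x)|].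
Qed.

Section sampling.
Context {R : realType}.
Local Open Scope ereal_scope.
Local Notation mu := (@lebesgue_measure R).

(* A state (v, u) consists of the remaining terms and of a uniform variable.  *)
(* The blocks [cum v i, cum v i.+1) partition [0, 1) into lengths share v i;  *)
(* the block of u gives the picked index, and the rescaled position of u in   *)
(* its block is again uniform and independent of the index.                   *)
Definition cum (v : rseq R) (i : nat) : R := (\sum_(j < i) share v j)%R.

(** The default 0 is taken when the second component lies in no block. *)
Definition sel (w : rseq R * R) : nat :=
  xget 0%N [set i | (cum w.1 i <= w.2 < cum w.1 i.+1)%R].

Definition step (w : rseq R * R) : rseq R * R :=
  (zero_at (sel w) w.1, (w.2 - cum w.1 (sel w)) / share w.1 (sel w))%R.

Definition picked (n : nat) (w : rseq R * R) : nat := sel (iter n step w).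

Definition fraction (n : nat) (w : rseq R * R) : R :=
  share (iter n step w).1 (picked n w).

(** Stable under removing a term, and enough for the total to stay positive and finite after any
    number of picks. *)
Definition plentiful (v : rseq R) : Prop :=
  mass v \is a fin_num /\ forall m, exists2 j, (m <= j)%N & (0 < v j)%R.

Lemma plentiful_zero_at i v : plentiful v -> plentiful (zero_at i v).
Proof.
move=> [vfin vinf]; split.
  by move: vfin; rewrite (mass_zero_at i) fin_numD => /andP[].
move=> m; have [j mj vj] := vinf (maxn m i.+1).
exists j; first exact: leq_trans (leq_maxl _ _) mj.
by rewrite /zero_at gtn_eqF// (leq_trans _ mj)// leq_maxr.
Qed.

Lemma rtotal_gt0 v : plentiful v -> (0 < rtotal v)%R.
Proof.
move=> [vfin vinf]; have [j _ vj] := vinf 0%N.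
rewrite (rtotal_zero_at j)// ltr_pwDl ?rtotal_ge0//.
by rewrite /pos lt_max vj.
Qed.

Lemma cumS v i : cum v i.+1 = (cum v i + share v i)%R.
Proof. by rewrite /cum big_ord_recr. Qed.

Lemma cum_homo v : {homo cum v : i j / (i <= j)%N >-> (i <= j)%R}.
Proof.
apply: homo_leq => // [a b c h1 h2|i]; first exact: le_trans h1 h2.
by rewrite cumS lerDl share_ge0.
Qed.

Lemma cvg_cum v : plentiful v -> cum v i @[i --> \oo] --> (1 : R)%R.
Proof.
move=> gv; have T0 := rtotal_gt0 gv; have [vfin _] := gv.
have h : (\sum_(0 <= j < i) pos (v j))%R @[i --> \oo] --> rtotal v.
  apply: (@fine_cvg _ _ _ _ (fun i => (\sum_(0 <= j < i) pos (v j))%:E)).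
  under eq_fun do rewrite -sumEFin.
  rewrite fineK//; apply: is_cvg_nneseries => i _ _; rewrite lee_fin.
  exact: pos_ge0.
rewrite (_ : cum v = fun i => (\sum_(0 <= j < i) pos (v j) / rtotal v)%R).
  rewrite -(mulfV (lt0r_neq0 T0)); under eq_fun do rewrite -mulr_suml.
  exact: cvgM h (cvg_cst _).
by apply/funext => i; rewrite big_mkord.
Qed.

Lemma sel_unique v u i : (cum v i <= u < cum v i.+1)%R -> sel (v, u) = i.
Proof.
move=> iu; apply: (xget_unique 0%N); first exact: iu.
move=> j /= ju; case/andP: iu => i1 i2; case/andP: ju => j1 j2.
case: (ltngtP i j) => // ij.
  by have := lt_le_trans i2 (le_trans (cum_homo v ij) j1); rewrite ltxx.
by have := lt_le_trans j2 (le_trans (cum_homo v ij) i1); rewrite ltxx.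
Qed.

Lemma selP v u : plentiful v -> (0 <= u < 1)%R ->
  (cum v (sel (v, u)) <= u < cum v (sel (v, u)).+1)%R.
Proof.
move=> gv /andP[u0 u1].
have [n un] : exists n, (u < cum v n)%R.
  have /(_ _)/filter_ex := cvgr_gt _ (cvg_cum gv) _ u1.
  by move=> [n un]; exists n.
have exn : exists n, (u < cum v n)%R by exists n.
case: (ex_minnP exn) => [[|m]].
  by rewrite /cum big_ord0 ltNge u0.
move=> um min; rewrite (sel_unique (i := m)) um andbT leNgt;
  by apply/negP => /min; rewrite ltnn.
Qed.

Lemma share_sel_gt0 v u : plentiful v -> (0 <= u < 1)%R ->
  (0 < share v (sel (v, u)))%R.
Proof.
by move=> gv /(selP gv) /andP[h1 h2]; have := le_lt_trans h1 h2; rewrite cumS ltrDl.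
Qed.

Lemma step_unit v u : plentiful v -> (0 <= u < 1)%R ->
  (0 <= (step (v, u)).2 < 1)%R.
Proof.
move=> gv u01; have s0 := share_sel_gt0 gv u01; have := selP gv u01.
rewrite cumS => /andP[h1 h2]; rewrite /step /= divr_ge0 ?subr_ge0 ?(ltW s0)//=.
by rewrite ltr_pdivrMr// mul1r ltrBlDl.
Qed.

Lemma measurable_cum i : measurable_fun setT (cum ^~ i).
Proof. by apply: measurable_sum => j; exact: measurable_share. Qed.

Lemma measurable_sel i : measurable [set w | sel w = i].
Proof.
have mC j : measurable [set w : rseq R * R | (cum w.1 j <= w.2 < cum w.1 j.+1)%R].
  rewrite (_ : [set w | _] = [set w | (cum w.1 j <= w.2)%R] `&`
      [set w | (w.2 < cum w.1 j.+1)%R]); last first.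
    by apply/seteqP; split => w /= => [/andP//|[-> ->]].
  apply: measurableI; rewrite -[X in measurable X]setTI.
  - apply: measurable_fun_ler => //; exact: (measurableT_comp (measurable_cum j)).
  - apply: measurable_fun_ltr => //; exact: (measurableT_comp (measurable_cum j.+1)).
(* The default value 0 does not interfere with positive indices; index 0 is obtained as the
   complement of the others. *)
have selC j : (0 < j)%N -> [set w | sel w = j] =
    [set w : rseq R * R | (cum w.1 j <= w.2 < cum w.1 j.+1)%R].
  move=> j0; apply/seteqP; split => [[v u] /=|[v u] /=]; last exact: sel_unique.
  rewrite /sel; case: xgetP => [k -> /= ? <-//|_ j00].
  by rewrite -j00 in j0.
case: i => [|i]; last by rewrite selC.
rewrite (_ : [set w | _] = ~` \bigcup_j [set w | sel w = j.+1]).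
  by apply: measurableC; apply: bigcup_measurable => j _; rewrite selC.
apply/seteqP; split => w /=; first by move=> s0 [j _ /=]; rewrite s0.
by case E : (sel w) => [//|m] h; exfalso; apply: h; exists m.
Qed.

Lemma measurable_step : measurable_fun setT step.
Proof.
pose f i (w : rseq R * R) : rseq R * R :=
  (zero_at i w.1, (w.2 - cum w.1 i) / share w.1 i)%R.
rewrite (_ : step = fun w => f (sel w) w)//.
apply: measurable_nat_select => i; first exact: measurable_sel.
apply: measurable_fun_pair.
  exact: (measurableT_comp (measurable_zero_at i)).
apply: measurable_funM.
  by apply: measurable_funB => //; exact: (measurableT_comp (measurable_cum i)).
apply: measurable_funV; exact: (measurableT_comp (measurable_share i)).
Qed.

Lemma measurable_iter_step n : measurable_fun setT (iter n step).
Proof.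
elim: n => [|n IH]; first exact: measurable_id.
exact: (measurableT_comp measurable_step IH).
Qed.

Lemma measurable_picked n i : measurable [set w | picked n w = i].
Proof.
have := measurable_iter_step n measurableT (measurable_sel i).
by rewrite setTI.
Qed.

Lemma measurable_fraction n : measurable_fun setT (fraction n).
Proof.
rewrite (_ : fraction n = fun w => share (iter n step w).1 (picked n w))//.
apply: (measurable_nat_select (f := fun i w => share (iter n step w).1 i)) => i.
  exact: measurable_picked.
apply: (measurableT_comp (measurable_share i)).
exact: (measurableT_comp measurable_fst (measurable_iter_step n)).
Qed.

End sampling.

Section sampling_law.
Context {R : realType}.
Local Open Scope ereal_scope.
Local Notation mu := (@lebesgue_measure R).
Local Notation unit_itv := (`[0%R, 1%R[%classic : set (measurableTypeR R)).

Lemma unit_itv_cum (v : rseq R) : plentiful v ->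
  `[0%R, 1%R[%classic = \bigcup_i `[cum v i, cum v i.+1[%classic.
Proof.
move=> gv; apply/seteqP; split => u /=; rewrite in_itv/=.
  by move=> u01; exists (sel (v, u)) => //=; rewrite in_itv/=; exact: selP.
move=> [i _] /=; rewrite in_itv/= => /andP[iu ui].
have c0 : (0 <= cum v i)%R by apply: sumr_ge0 => j _; exact: share_ge0.
rewrite (le_trans c0 iu)/=; apply: lt_le_trans ui _.
have cv := cvg_cum gv; rewrite -(cvg_lim (@Rhausdorff R) cv).
apply: nondecreasing_cvgn_le; first exact: cum_homo.
by apply/cvg_ex; exists 1%R.
Qed.

(** [0, 1) is cut into the blocks, and block i is mapped onto [0, 1) by an affine substitution with
    factor [share v i]. The result is the recursion that defines [pick_law]. *)
Lemma integral_step v (G : nat -> rseq R * R -> \bar R) : plentiful v ->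
  (forall i w, 0 <= G i w) -> (forall i, measurable_fun setT (G i)) ->
  \int[mu]_(u in unit_itv) G (sel (v, u)) (step (v, u)) =
  \sum_(i <oo) (share v i)%:E * \int[mu]_(u in unit_itv) G i (zero_at i v, u).
Proof.
move=> gv G0 mG.
rewrite (unit_itv_cum gv) ge0_integral_bigcup//=; first last.
- apply/trivIsetP => i j _ _ ij; rewrite -subset0 => u [] /=.
  rewrite !in_itv/= => iu ju; move: ij.
  by rewrite -(sel_unique iu) -(sel_unique ju) eqxx.
- apply: measurable_funTS.
  apply: (measurableT_comp (f := fun w => G (sel w) (step w)));
    last exact: pair1_measurable.
  apply: (measurable_nat_select (f := fun i w => G i (step w))) => i.
    exact: measurable_sel.
  exact: (measurableT_comp (mG i) measurable_step).
apply: eq_eseriesr => i _; rewrite -(unit_itv_cum gv).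
pose F (u : R) := G i (zero_at i v, (u - cum v i) / share v i)%R.
transitivity (\int[mu]_(u in `[cum v i, cum v i.+1[) F u).
  by apply: eq_integral => u; rewrite inE/= in_itv/= => iu; rewrite /F /step (sel_unique iu).
have mGz : measurable_fun [set: R] (fun u => G i (zero_at i v, u)).
  exact: (measurableT_comp (mG i) (pair1_measurable _)).
have mF : measurable_fun [set: R] F.
  apply: (measurableT_comp mGz); apply: measurable_funM => //.
  exact: measurable_funB.
(* A zero share gives an empty block, where the rescaling would divide by 0. *)
have := share_ge0 v i; rewrite le_eqVlt => /predU1P[s0|s0].
  by rewrite cumS -s0 addr0 set_itvco0 integral_set0 mul0e.
rewrite integral_mkcond (integral_affine (cum v i) s0).
- rewrite [in RHS]integral_mkcond -ge0_integralZl//.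
  + apply: eq_integral => x _; rewrite !patchE muleC !mem_setE !in_itv/= cumS.
    rewrite lerDr addrC ltrD2l pmulr_rge0// gtr_pMr// /F.
    by rewrite addrC addrK mulrAC mulfV ?mul1r// gt_eqF.
  + by apply/(measurable_restrictT _ (measurable_itv _)); exact: measurable_funTS.
  + by move=> x _; apply: erestrict_ge0.
  + by rewrite lee_fin ltW.
- by move=> x; apply: erestrict_ge0 => y _; exact: G0.
- by apply/(measurable_restrictT _ (measurable_itv _)); exact: measurable_funTS.
Qed.

Fixpoint hits (As : seq (set R)) (w : rseq R * R) : \bar R :=
  if As is A :: Bs then (\1_A (fraction 0 w))%:E * hits Bs (step w) else 1.

Lemma hitsE As w : hits As w =
  (\prod_(k < size As) \1_(nth setT As k) (fraction k w))%:E.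
Proof.
elim: As w => [|A As IH] w; first by rewrite big_ord0.
rewrite /= IH big_ord_recl EFinM; congr (_ * _%:E).
by apply: eq_bigr => k _; rewrite /fraction /picked /= !add0n -!iterSr.
Qed.

Lemma hits_ge0 As w : 0 <= hits As w.
Proof. by elim: As w => [//|A As IH] w /=; rewrite mule_ge0// lee_fin. Qed.

Lemma measurable_hits As : all_measurable As -> measurable_fun setT (hits As).
Proof.
elim: As => [|A As IH] /=; first by move=> _; exact: measurable_cst.
move=> /all_measurable_cons[mA mAs].
apply: emeasurable_funM; last exact: (measurableT_comp (IH mAs) measurable_step).
have m1 : measurable_fun [set: R] (fun u => \1_A u : R) by exact: measurable_indic.
by apply/measurable_EFinP; exact: (measurableT_comp m1 (measurable_fraction 0)).
Qed.

Lemma integral_hits v As : plentiful v -> all_measurable As ->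
  \int[mu]_(u in unit_itv) hits As (v, u) = pick_law As v.
Proof.
elim: As v => [|A As IH] v gv /= mAs.
  by rewrite integral_cst//= lebesgue_measure_itv/= lte_fin ltr01 mul1e sube0.
have [mA mB] := all_measurable_cons mAs.
rewrite -/(fraction 0) (integral_step
  (G := fun i w => (\1_A (share v i))%:E * hits As w))//.
- apply: eq_eseriesr => i _; rewrite ge0_integralZl//.
  + by rewrite IH//; [rewrite EFinM muleA|exact: plentiful_zero_at].
  + apply: measurable_funTS.
    exact: (measurableT_comp (measurable_hits mB) (pair1_measurable _)).
  + by move=> u _; exact: hits_ge0.
- by move=> i w; apply: mule_ge0; rewrite ?lee_fin ?hits_ge0.
- by move=> i; apply: measurable_funeM; exact: measurable_hits.
Qed.

(** Conditional probability, given v, that the first picked indices are h. *)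
Fixpoint index_law (h : seq nat) (v : rseq R) : R :=
  if h is i :: h' then share v i * index_law h' (zero_at i v) else 1.

Definition erase (h : seq nat) (v : rseq R) : rseq R :=
  foldl (fun v' i => zero_at i v') v h.

Lemma index_law_rcons h i v :
  index_law (rcons h i) v = (index_law h v * share (erase h v) i)%R.
Proof. by elim: h v => [|j h IH] v /=; rewrite ?mulr1 ?mul1r// IH mulrA. Qed.

Fixpoint picks (h : seq nat) (w : rseq R * R) : \bar R :=
  if h is i :: h' then (sel w == i)%:R%:E * picks h' (step w) else 1.

Lemma picksE h w :
  picks h w = (mkseq (picked ^~ w) (size h) == h)%:R%:E.
Proof.
elim: h w => [|i h IH] w //=; rewrite IH -EFinM -natrM mulnb.
congr (_%:R%:E); rewrite /mkseq /= -[1%N]/(1 + 0)%N iotaDl -map_comp eqseq_cons.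
by congr (_ && (_ == _)); apply: eq_map => k /=; rewrite /picked -iterSr.
Qed.

Lemma measurable_picks h : measurable_fun setT (picks h).
Proof.
elim: h => [|i h IH] /=; first exact: measurable_cst.
apply: emeasurable_funM; last exact: (measurableT_comp IH measurable_step).
apply/measurable_EFinP.
apply: (measurable_nat_select (f := fun j (_ : rseq R * R) => (j == i)%:R : R)) => j.
  exact: measurable_sel.
exact: measurable_cst.
Qed.

Lemma picks_ge0 h w : 0 <= picks h w.
Proof. by rewrite picksE lee_fin. Qed.

Lemma integral_picks v h : plentiful v ->
  \int[mu]_(u in unit_itv) picks h (v, u) = (index_law h v)%:E.
Proof.
elim: h v => [|i h IH] v gv /=.
  by rewrite integral_cst//= lebesgue_measure_itv/= lte_fin ltr01 mul1e sube0.
rewrite (integral_step (G := fun j w => (j == i)%:R%:E * picks h w))//.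
- rewrite (nneseriesD1 (n := i))//=; last first.
    move=> k _; apply: mule_ge0; rewrite ?lee_fin ?share_ge0//.
    by apply: integral_ge0 => u _; apply: mule_ge0; rewrite ?lee_fin ?picks_ge0.
  rewrite eseries0 ?adde0; last first.
    move=> j _ /= ji; rewrite integral0_eq ?mule0// => u _.
    by rewrite (negbTE ji) mul0e.
  transitivity ((share v i)%:E * (index_law h (zero_at i v))%:E) => //.
  rewrite -IH; last exact: plentiful_zero_at.
  by congr (_ * _); apply: eq_integral => u _; rewrite eqxx mul1e.
- by move=> j w; apply: mule_ge0; rewrite ?lee_fin ?picks_ge0.
- by move=> j; apply: measurable_funeM; exact: measurable_picks.
Qed.

End sampling_law.

Section sampling_paths.
Context {R : realType}.
Local Open Scope ereal_scope.

Definition history (n : nat) (w : rseq R * R) : seq nat := mkseq (picked ^~ w) n.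

Lemma eraseE h (v : rseq R) j : erase h v j = if j \in h then 0%R else v j.
Proof.
elim/last_ind: h => [//|h i IH]; rewrite /erase foldl_rcons -/(erase h v).
by rewrite /zero_at mem_rcons inE IH; case: eqP.
Qed.

Lemma plentiful_erase h (v : rseq R) : plentiful v -> plentiful (erase h v).
Proof. by elim: h v => [//|i h IH] v gv; apply: IH; exact: plentiful_zero_at. Qed.

Lemma rtotal_erase h (v : rseq R) : mass v \is a fin_num -> uniq h ->
  rtotal (erase h v) = (rtotal v - \sum_(j <- h) pos (v j))%R.
Proof.
move=> vfin; elim/last_ind: h => [|h i IH]; first by rewrite big_nil subr0.
rewrite rcons_uniq => /andP[ih uh].
have hfin : mass (erase h v) \is a fin_num.
  elim: (h) {IH ih uh} v vfin => [//|j l IHl] v vfin; apply: IHl.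
  by move: vfin; rewrite (mass_zero_at j) fin_numD => /andP[].
have := rtotal_zero_at i hfin; rewrite eraseE (negbTE ih) IH//.
rewrite /erase foldl_rcons -/(erase h v) big_rcons/= => e.
by lra.
Qed.

Variables (v : rseq R) (u : R).
Hypotheses (gv : plentiful v) (u01 : (0 <= u < 1)%R).
Local Notation w := (v, u).

Lemma iter_step1 n : (iter n step w).1 = erase (history n w) v.
Proof.
elim: n => [//|n IH].
by rewrite iterS /history mkseqS /erase foldl_rcons -/(erase _ v) -IH.
Qed.

Lemma iter_step_unit n : (0 <= (iter n step w).2 < 1)%R.
Proof.
elim: n => [//|n IH]; rewrite iterS.
have := step_unit (plentiful_erase (history n w) gv) IH.
by rewrite -iter_step1; case: (iter n step w).
Qed.

Lemma fraction_gt0 n : (0 < fraction n w)%R.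
Proof.
have := share_sel_gt0 (plentiful_erase (history n w) gv) (iter_step_unit n).
by rewrite -iter_step1 /fraction /picked; case: (iter n step w).
Qed.

Lemma picked_pos_gt0 n : (0 < pos (erase (history n w) v (picked n w)))%R.
Proof.
have := fraction_gt0 n; rewrite /fraction /share iter_step1.
by rewrite pmulr_lgt0// invr_gt0 rtotal_gt0//; exact: plentiful_erase.
Qed.

Lemma picked_notin_history n : picked n w \notin history n w.
Proof.
apply/negP => h; have := picked_pos_gt0 n.
by rewrite eraseE h /pos maxxx ltxx.
Qed.

Lemma history_uniq n : uniq (history n w).
Proof.
elim: n => [//|n IH]; rewrite /history mkseqS rcons_uniq IH andbT.
exact: picked_notin_history.
Qed.

Lemma rtotal_iter_step n :
  rtotal (iter n step w).1 = (rtotal v * \prod_(i < n) (1 - fraction i w))%R.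
Proof.
elim: n => [|n IH]; first by rewrite big_ord0 mulr1.
rewrite big_ord_recr/= mulrA -IH /fraction /share.
have gn : plentiful (iter n step w).1 by rewrite iter_step1; exact: plentiful_erase.
rewrite -/(picked n w) mulrBr mulr1 mulrCA mulfV ?mulr1 ?gt_eqF ?rtotal_gt0//.
by rewrite (rtotal_zero_at (picked n w) gn.1) addrC addKr.
Qed.

Lemma picked_stick n :
  pos (v (picked n w)) =
  (fraction n w * \prod_(i < n) (1 - fraction i w) * rtotal v)%R.
Proof.
have gn : plentiful (iter n step w).1 by rewrite iter_step1; exact: plentiful_erase.
rewrite -mulrA [(_ * rtotal v)%R]mulrC -rtotal_iter_step /fraction /share.
rewrite divfK ?gt_eqF ?rtotal_gt0// iter_step1 eraseE.
by rewrite (negbTE (picked_notin_history n)).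
Qed.

End sampling_paths.

Section partitions.
Context {R : realType}.
Variable v : rseq R.
Hypothesis pv : decreasing_partition_of_unity v.
Local Open Scope ereal_scope.

Lemma partition_pos i : pos (v i) = v i.
Proof. by have [v0 _ _] := pv; apply/max_idPl; exact: ltW. Qed.

Lemma partition_mass : mass v = 1.
Proof.
have [_ _ <-] := pv; apply: eq_eseriesr => i _.
by rewrite partition_pos.
Qed.

Lemma partition_rtotal : rtotal v = 1%R.
Proof. by rewrite /rtotal partition_mass. Qed.

Lemma partition_plentiful : plentiful v.
Proof.
split; first by rewrite partition_mass.
by move=> m; exists m => //; have [v0 _ _] := pv.
Qed.

Lemma share_erase_partition h i : uniq h ->
  share (erase h v) i = (if i \in h then 0 else v i / (1 - \sum_(j <- h) v j))%R.
Proof.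
move=> uh; rewrite /share eraseE rtotal_erase// ?partition_mass// partition_rtotal.
rewrite (eq_bigr v) => [|j _]; last exact: partition_pos.
by case: ifP; rewrite ?partition_pos// /pos maxxx mul0r.
Qed.

End partitions.

Lemma measurable_picked_fun (R : realType) (n : nat) :
  measurable_fun setT (@picked R n).
Proof.
apply: (measurable_nat_select (N := picked n) (f := fun i _ => i)) => // i.
exact: measurable_picked.
Qed.

Lemma measurable_erase (R : realType) h : measurable_fun setT (@erase R h).
Proof.
elim: h => [|i h IH]; first exact: measurable_id.
exact: (measurableT_comp IH (measurable_zero_at i)).
Qed.

Lemma measurable_share_erase (R : realType) h i :
  measurable_fun setT (fun v => share (@erase R h v) i).
Proof. exact: (measurableT_comp (measurable_share i) (measurable_erase h)). Qed.

Lemma measurable_index_law (R : realType) h : measurable_fun setT (@index_law R h).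
Proof.
elim: h => [|i h IH] /=; first exact: measurable_cst.
apply: measurable_funM; first exact: measurable_share.
exact: (measurableT_comp IH (measurable_zero_at i)).
Qed.

Section unit_uniform.
Context (R : realType).
Local Open Scope ereal_scope.

Let idR : measurableTypeR R -> R := idfun.

Let measurable_idR : measurable_fun setT idR.
Proof. exact: (@measurable_id _ (measurableTypeR R)). Qed.

Definition unit_uniform : set R -> \bar R :=
  image_measure (uniform_prob (@ltr01 R)) measurable_idR.

HB.instance Definition _ := Measure.on unit_uniform.

Lemma integral_unit_uniform (f : R -> \bar R) :
  (forall u, 0 <= f u) -> measurable_fun setT f ->
  \int[unit_uniform]_u f u = \int[lebesgue_measure]_(u in `[0%R, 1%R[) f u.
Proof.
move=> f0 mf; rewrite integral_image_measure//.
rewrite integral_uniform// subr0 invr1 mul1e.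
by rewrite integral_itv_bndo_bndc//; exact: measurable_funTS.
Qed.

Let unit_uniform_setT : unit_uniform setT = 1.
Proof.
rewrite -[LHS]mul1e -integral_cst// integral_unit_uniform//.
by rewrite integral_cst//= lebesgue_measure_itv/= lte_fin ltr01 mul1e sube0.
Qed.

HB.instance Definition _ :=
  Measure_isProbability.Build _ _ _ unit_uniform unit_uniform_setT.

End unit_uniform.

(** * The sample space of a sequence and a uniform variable *)

Section sampling_probability.
Context {R : realType}.
Local Open Scope ereal_scope.
Variable mu : probability (rseq R) R.

Definition sampling : probability (rseq R * R)%type R :=
  mu \x @unit_uniform R.

Definition fraction_rv (n : nat) : {RV sampling >-> R} :=
  mfun_Sub (mem_set (@measurable_fraction R n)).

Definition picked_rv (n : nat) : {RV sampling >-> nat} :=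
  mfun_Sub (mem_set (@measurable_picked_fun R n)).

Lemma integral_sampling (F : rseq R * R -> \bar R) : (forall w, 0 <= F w) ->
  measurable_fun setT F ->
  \int[sampling]_w F w =
  \int[mu]_v \int[lebesgue_measure]_(u in `[0%R, 1%R[) F (v, u).
Proof.
move=> F0 mF.
transitivity (\int[mu]_v \int[@unit_uniform R]_u F (v, u)).
  exact: fubini_tonelli1.
apply: eq_integral => v _; apply: integral_unit_uniform => //.
exact: (measurableT_comp mF (pair1_measurable v)).
Qed.

Lemma sampling_ae (Q : rseq R -> R -> Prop) :
  {ae mu, forall v, forall u, (0 <= u < 1)%R -> Q v u} ->
  {ae sampling, forall w, Q w.1 w.2}.
Proof.
move=> [N [mN N0 sN]].
have mI : measurable (~` `[0%R, 1%R[ : set R) by exact: measurableC.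
have n1 : sampling.-negligible (N `*` setT).
  apply/negligibleP; first exact: measurableX.
  transitivity (mu N * @unit_uniform R setT); last by rewrite N0 mul0e.
  exact: product_measure1E.
have n2 : sampling.-negligible (setT `*` ~` `[0%R, 1%R[).
  apply/negligibleP; first exact: measurableX.
  transitivity (mu setT * @unit_uniform R (~` `[0%R, 1%R[)).
    exact: product_measure1E.
  suff -> : @unit_uniform R (~` `[0%R, 1%R[) = 0 by rewrite mule0.
  have m1 : measurable_fun setT (fun u : R => (\1_(~` `[0%R, 1%R[) u)%:E : \bar R).
    by apply/measurable_EFinP; exact: measurable_indic.
  transitivity (\int[@unit_uniform R]_u (\1_(~` `[0%R, 1%R[) u)%:E).
    by rewrite integral_indic// setIT.
  rewrite integral_unit_uniform//.
  apply: integral0_eq => u u01; rewrite indicE memNset; [by []|].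
  by move=> /(_ u01).
apply: negligibleS (negligibleU n1 n2).
move=> [v u] /= nQ; have [Nv|Nv] := pselect (N v); [by left|right; split => //].
rewrite /= in_itv/= => u01; apply: nQ.
have : ~ ~ (forall u, (0 <= u < 1)%R -> Q v u) by move=> h; apply: Nv; exact: sN.
by move=> /contrapT; apply.
Qed.

Hypothesis mu_partition : {ae mu, forall v, decreasing_partition_of_unity v}.

Lemma integral_sampling_plentiful (F : rseq R * R -> \bar R) (G : rseq R -> \bar R) :
  (forall w, 0 <= F w) -> measurable_fun setT F -> measurable_fun setT G ->
  (forall v, plentiful v ->
     \int[lebesgue_measure]_(u in `[0%R, 1%R[) F (v, u) = G v) ->
  \int[sampling]_w F w = \int[mu]_v G v.
Proof.
move=> F0 mF mG FG; rewrite integral_sampling//; apply: ae_eq_integral => //.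
  have -> : (fun v => \int[lebesgue_measure]_(u in `[0%R, 1%R[) F (v, u)) =
      fubini_F (@unit_uniform R) F.
    apply/funext => v; rewrite /fubini_F integral_unit_uniform//.
    exact: (measurableT_comp mF (pair1_measurable v)).
  exact: measurable_fun_fubini_tonelli_F.
have FF := ae_filter_ringOfSetsType mu.
by apply: filterS mu_partition => v /partition_plentiful gv _; exact: FG.
Qed.

Lemma sampling_partition :
  {ae sampling, forall w, decreasing_partition_of_unity w.1 /\ (0 <= w.2 < 1)%R}.
Proof.
apply: (sampling_ae (Q := fun v u => decreasing_partition_of_unity v /\ (0 <= u < 1)%R)).
by have F := ae_filter_ringOfSetsType mu; apply: filterS mu_partition => v pv u.
Qed.

(** Given v, appending i to the history h multiplies its probability by the share of i once h is
    erased ([index_law_rcons]); for a partition of unity this share is the required quotient. *)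
Lemma sampling_size_biased :
  @size_biased_order R _ _ sampling fst picked_rv.
Proof.
move=> h i A mA E.
have mE (l : seq nat) : measurable [set w : rseq R * R | history (size l) w = l].
  rewrite (_ : [set w | _] = picks l @^-1` [set 1]).
    rewrite -[X in measurable X]setTI; exact: measurable_picks.
  apply/seteqP; split => w /=; rewrite picksE /history.
    by move=> ->; rewrite eqxx.
  by case: eqP => // _ [] /eqP; rewrite eq_sym oner_eq0.
have mfA : measurable (fst @^-1` A : set (rseq R * R)).
  by rewrite -[X in measurable X]setTI; exact: measurable_fst.
have EE : E = fst @^-1` A `&` [set w | history (size h) w = h].
  by apply/seteqP; split => w; rewrite /E /= inE.
have key (F : rseq R -> \bar R) l : (forall v, 0 <= F v) -> measurable_fun setT F ->
    \int[sampling]_(w in fst @^-1` A `&` [set w | history (size l) w = l]) F w.1 =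
    \int[mu]_(v in A) (F v * (index_law l v)%:E).
  move=> F0 mF; rewrite integral_mkcond [RHS]integral_mkcond.
  pose FA := F \_ A.
  have FA0 v : 0 <= FA v by exact: erestrict_ge0.
  have mFA : measurable_fun setT FA.
    by apply/(measurable_restrictT _ mA); exact: measurable_funTS.
  transitivity (\int[sampling]_w (FA w.1 * picks l w)).
    apply: eq_integral => w _; rewrite /FA !patchE picksE.
    rewrite in_setI [in RHS](_ : (w.1 \in A) = (w \in fst @^-1` A)); last first.
      by apply/idP/idP; rewrite !inE.
    case: ifP => [/andP[-> ]|]; rewrite ?inE /=.
      by rewrite /history => ->; rewrite eqxx mule1.
    move=> /negbT; rewrite negb_and => /orP[/negbTE -> |]; first by rewrite mul0e.
    by rewrite notin_setE /= => /eqP/negbTE; rewrite /history => ->; rewrite mule0.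
  rewrite (integral_sampling_plentiful (G := fun v => FA v * (index_law l v)%:E)).
  - apply: eq_integral => v _; rewrite /FA !patchE; case: ifP => //.
    by rewrite mul0e.
  - by move=> w; rewrite mule_ge0 ?picks_ge0.
  - apply: emeasurable_funM; last exact: measurable_picks.
    exact: (measurableT_comp mFA).
  - apply: emeasurable_funM => //; apply/measurable_EFinP.
    exact: measurable_index_law.
  - move=> v gv; rewrite /= ge0_integralZl//.
    + by rewrite integral_picks.
    + apply: measurable_funTS.
      exact: (measurableT_comp (measurable_picks l) (pair1_measurable v)).
    + by move=> u _; exact: picks_ge0.
transitivity (\int[mu]_(v in A) (index_law (rcons h i) v)%:E).
  rewrite (eq_integral (fun v => cst 1 v * (index_law (rcons h i) v)%:E)); last first.
    by move=> v _; rewrite mul1e.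
  rewrite -key//= integral_cst//; last first.
    by apply: measurableI => //; exact: mE.
  rewrite mul1e; apply: (congr1 sampling); rewrite EE -setIA; congr (_ `&` _).
  apply/seteqP; split => w /=; rewrite size_rcons /history mkseqS.
    by move=> [-> ->].
  by move=> /rcons_inj[].
transitivity (\int[sampling]_(w in E) (share (erase h w.1) i)%:E).
  rewrite EE (key (fun v => (share (erase h v) i)%:E)); first last.
  - by apply/measurable_EFinP; exact: measurable_share_erase.
  - by move=> v; rewrite lee_fin share_ge0.
  by apply: eq_integral => v _; rewrite index_law_rcons muleC.
apply: ae_eq_integral.
- rewrite EE; exact: measurableI.
- apply: measurable_funTS; apply/measurable_EFinP.
  exact: (measurableT_comp (measurable_share_erase h i)).
- apply: measurable_funTS; apply/measurable_EFinP.
  case: (i \in h) => /=; first exact: measurable_cst.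
  apply: measurable_funM; first exact: (measurableT_comp (@measurable_coord R i)).
  apply: measurable_funV; apply: measurable_funB => //.
  apply: measurable_sum => j; exact: (measurableT_comp (@measurable_coord R j)).
have FS := ae_filter_ringOfSetsType sampling.
apply: filterS sampling_partition => -[v u] /= [pv u01] [_ /= hE].
rewrite share_erase_partition// -hE; apply: history_uniq => //.
exact: partition_plentiful.
Qed.

End sampling_probability.

Section sampled_PD_law.
Context {R : realType}.
Local Open Scope ereal_scope.
Variables alpha q : R.
Hypotheses (alpha_gt0 : (0 < alpha)%R) (alpha_lt1 : (alpha < 1)%R)
  (q_gt0 : (0 < q)%R).

Let a_gt0 : (0 < 1 - alpha)%R. Proof. by rewrite subr_gt0. Qed.

Let b_gt0 (k : nat) : (0 < alpha * (q + k.+1%:R))%R.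
Proof. by rewrite mulr_gt0// addr_gt0// ltr0n. Qed.

Lemma betasE (r : R) As : betas alpha r As =
  (\prod_(k < size As)
     beta_ratio (1 - alpha) (alpha * (r + k.+1%:R)) (nth setT As k))%R.
Proof.
elim: As r => [|A As IH] r; first by rewrite big_ord0.
rewrite /= IH big_ord_recl/=; congr (_ * _)%R.
by apply: eq_bigr => k _; rewrite -addrA nat1r.
Qed.

Variable mu : probability (rseq R) R.
Hypotheses (mu_partition : {ae mu, forall v, decreasing_partition_of_unity v})
  (mu_picks : forall As, all_measurable As ->
     \int[mu]_v pick_law As v = (betas alpha q As)%:E).

Lemma fractions_prob (s : seq nat) (A : nat -> set R) : uniq s ->
  (forall i, measurable (A i)) ->
  sampling mu (\bigcap_(i in [set` s]) (fraction_rv mu i @^-1` A i)) =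
  (\prod_(i <- s) beta_ratio (1 - alpha) (alpha * (q + i.+1%:R)) (A i))%:E.
Proof.
move=> us mA; pose n := (\max_(i <- s) i).+1.
(* Picks outside [s] are left unconstrained; each contributes a factor 1 by [beta_ratioT]. *)
pose As := mkseq (fun k => if k \in s then A k else setT) n.
have nthAs k : (k < n)%N -> nth setT As k = if k \in s then A k else setT.
  by move=> kn; rewrite nth_mkseq.
have sn k : k \in s -> (k < n)%N by move=> ks; rewrite ltnS leq_bigmax_seq.
have mAs : all_measurable As.
  move=> k; have [kn|kn] := ltnP k n; last by rewrite nth_default ?size_mkseq.
  by rewrite nthAs//; case: ifP.
have mB : measurable (\bigcap_(i in [set` s]) (fraction_rv mu i @^-1` A i)).
  apply: bigcap_measurableType => i _; rewrite -[X in measurable X]setTI.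
  exact: (measurable_fraction i).
transitivity (\int[sampling mu]_w hits As w).
  set B := \bigcap_(i in _) _ in mB *.
  transitivity (\int[sampling mu]_w (\1_B w)%:E).
    by rewrite integral_indic// setIT.
  apply: eq_integral => w _.
  rewrite hitsE indicE size_mkseq; congr EFin; have [wB|wB] := pselect (B w).
    rewrite mem_set// big1// => k _; rewrite (nthAs _ (ltn_ord k)) indicE mem_set//.
    by case: ifPn => // ks; exact: wB.
  have /existsNP[k /not_implyP[ks nA]] := wB.
  rewrite memNset// (bigD1 (Ordinal (sn _ ks)))//= nthAs ?sn// ks indicE memNset ?mul0r//.
rewrite (integral_sampling_plentiful mu_partition (G := pick_law As)).
- rewrite mu_picks// betasE size_mkseq; congr EFin.
  rewrite (eq_bigr (fun k : 'I_n => if (k : nat) \in s then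
    beta_ratio (1 - alpha) (alpha * (q + (k : nat).+1%:R)) (A k) else 1%R)); last first.
    move=> k _; rewrite (nthAs _ (ltn_ord k)); case: (val k \in s) => //.
    exact: (beta_ratioT a_gt0 (b_gt0 k)).
  rewrite -big_mkcond/= -(big_mkord (fun k => k \in s)
    (fun k => beta_ratio (1 - alpha) (alpha * (q + k.+1%:R)) (A k))).
  rewrite -big_filter; apply: perm_big; apply: uniq_perm => //.
    by rewrite filter_uniq ?iota_uniq.
  move=> k; rewrite mem_filter mem_index_iota /=.
  by case: (boolP (k \in s)) => // /sn ->.
- exact: hits_ge0.
- exact: measurable_hits.
- exact: measurable_pick_law.
- by move=> v gv; exact: integral_hits.
Qed.

Lemma PD_law_of_pick_law : PD_law alpha (alpha * q) mu.
Proof.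
exists _, _, (sampling mu), fst, (picked_rv mu), (fraction_rv mu).
have one i A : measurable A -> sampling mu (fraction_rv mu i @^-1` A) =
    (beta_ratio (1 - alpha) (alpha * (q + i.+1%:R)) A)%:E.
  move=> mA; have := fractions_prob (s := [:: i]) isT (fun=> mA).
  rewrite big_seq1 => <-; congr (sampling mu _); apply/seteqP.
  split=> w /= => [h j /=|]; first by rewrite inE => /eqP ->.
  by apply; rewrite /= inE.
split.
- split=> [|A mA]; first exact: measurable_fst.
  transitivity (mu A * @unit_uniform R setT).
    by rewrite [X in _ * X]probability_setT mule1.
  rewrite (_ : fst @^-1` A = A `*` setT); last first.
    by apply/seteqP; split => w /= => [|[]].
  exact/esym/product_measure1E.
- by have FS := ae_filter_ringOfSetsType (sampling mu);
    apply: filterS (sampling_partition mu_partition) => w [].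
- exact: sampling_size_biased.
- split=> [s A us mA|i A mA].
    rewrite fractions_prob// -prodEFin; apply: eq_bigr => i _.
    by rewrite one.
  rewrite one// (_ : (alpha * q + i.+1%:R * alpha)%R = (alpha * (q + i.+1%:R))%R).
    rewrite -/(beta_int _ _ A) [X in _ / X](_ : _ =
      beta_int (1 - alpha) (alpha * (q + i.+1%:R)) setT); last by rewrite /beta_int setTI.
    rewrite /beta_ratio -[in RHS](fineK (beta_int_fin a_gt0 (b_gt0 i) mA)).
    rewrite -[in RHS](fineK (beta_int_fin a_gt0 (b_gt0 i) measurableT)).
    by rewrite inver gt_eqF ?beta_intT_gt0// EFinM.
  by ring.
have FS := ae_filter_ringOfSetsType (sampling mu).
apply: filterS (sampling_partition mu_partition) => -[v u] /= [pv u01] n.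
have := picked_stick (partition_plentiful pv) u01 n.
by rewrite partition_pos// partition_rtotal// mulr1.
Qed.

End sampled_PD_law.

(** * From Poisson-Kingman to Poisson-Dirichlet *)

Section scale_invariance.
Context {R : realType}.
Local Open Scope ereal_scope.
Variable c : R.
Hypothesis c_gt0 : (0 < c)%R.

Lemma pos_scale x : pos (c * x) = (c * pos x)%R.
Proof. by rewrite /pos -[in LHS](mulr0 c) -maxr_pMr ?ltW. Qed.

Lemma mass_scale (v : rseq R) : mass (fun i => c * v i)%R = c%:E * mass v.
Proof.
rewrite /mass /point_sum -nneseriesZl; last first.
  by move=> i _; rewrite lee_fin pos_ge0.
by apply: eq_eseriesr => i _; rewrite pos_scale.
Qed.

Lemma rtotal_scale (v : rseq R) : rtotal (fun i => c * v i)%R = (c * rtotal v)%R.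
Proof.
rewrite /rtotal mass_scale; case: (mass v) => [r| |] //.
  by rewrite gt0_muley ?lte_fin// mulr0.
by rewrite gt0_muleNy ?lte_fin// mulr0.
Qed.

Lemma share_scale (v : rseq R) i : share (fun i => c * v i)%R i = share v i.
Proof.
rewrite /share rtotal_scale pos_scale invfM mulrACA divff ?mul1r//.
by rewrite gt_eqF.
Qed.

(** Allows the fractions of the normalised sequence to be computed on the points themselves, where
    the negative binomial structure is available. *)
Lemma pick_law_scale As (v : rseq R) :
  pick_law As (fun i => c * v i)%R = pick_law As v.
Proof.
elim: As v => [//|A As IH] v /=; apply: eq_eseriesr => i _.
rewrite share_scale -(IH (zero_at i v)); congr (_ * pick_law _ _).
by apply/funext => j; rewrite /zero_at; case: eqP; rewrite ?mulr0.
Qed.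

End scale_invariance.

Section Poisson_Kingman_points.
Context {R : realType}.
Local Open Scope ereal_scope.
Variables alpha q : R.
Hypotheses (alpha_gt0 : (0 < alpha)%R) (alpha_lt1 : (alpha < 1)%R)
  (q_gt0 : (0 < q)%R).
Variable mu : probability (rseq R) R.
Context d (T : measurableType d) (P : probability T R)
  (B : R.-ker T ~> measurableTypeR R) (J : nat -> {RV P >-> R}).
Hypotheses (BN : negative_binomial_process P q (rho_G alpha) B)
  (BJ : ordered_points B J)
  (muJ : has_law P (fun w i => J i w / fine (total_mass (fun k => J k w)))%R mu).

Let points (w : T) : rseq R := fun i => J i w.

Let measurable_points : measurable_fun setT points.
Proof. by apply: measurable_to_rseq => i; exact: measurable_funPT. Qed.

Let M := image_measure P measurable_points.

Lemma integral_points (f : R -> R) : test_fun f ->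
  {ae P, forall w,
    \int[B w]_(x in `]0%R, +oo[) (f x)%:E = point_sum f (points w)}.
Proof.
move=> [mf f0 fn]; apply: filterS BJ => w [J0 _ BwJ].
have mfE : measurable_fun [set: measurableTypeR R] (fun x => (f x)%:E).
  exact/measurable_EFinP.
pose m i : {measure set (measurableTypeR R) -> \bar R} :=
  @dirac _ (measurableTypeR R) (J i w) R.
rewrite (eq_measure_integral (mseries m 0)); last by move=> A mA _; rewrite BwJ.
rewrite ge0_integral_measure_series//.
- apply: eq_eseriesr => i _; rewrite integral_dirac//; last exact: measurable_funTS.
  by rewrite diracE mem_set ?mul1e//= in_itv/= andbT.
- by move=> x _; rewrite lee_fin.
- exact: measurable_funTS.
Qed.

(** Almost surely the integral of a test function against [B w] is its sum over the listed points,
    so the Laplace functional passes to the law of the sequence; a finite exponent turns the inverse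
    [poweR] into the real power -q. *)
Lemma negbin_points_image : negbin_points (Pi alpha_gt0 alpha_lt1) M 1 q.
Proof.
move=> f tf fin_f; have [mf f0 fn] := tf.
have mS : measurable_fun [set: rseq R] (fun v => expeR (- point_sum f v)).
  apply: (measurableT_comp measurable_expeR).
  by apply: measurableT_comp => //; exact: measurable_point_sum.
rewrite integral_image_measure//; last by move=> v; exact: expeR_ge0.
have <- : \int[P]_w expeR (- \int[B w]_(x in `]0%R, +oo[) (f x)%:E) =
    \int[P]_w expeR (- point_sum f (points w)).
  apply: ae_eq_integral => //.
  - apply: (measurableT_comp measurable_expeR); apply: measurableT_comp => //.
    have -> : (fun w => \int[B w]_(x in `]0%R, +oo[) (f x)%:E) =
        fun w => \int[B w]_x (f x)%:E.
      apply/funext => w; rewrite integral_mkcond; apply: eq_integral => x _.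
      rewrite patchE; case: ifPn => //; rewrite notin_setE/= in_itv/= andbT.
      by move=> /negP; rewrite -leNgt => /fn ->.
    apply: measurable_fun_integral_kernel.
    + by move=> U mU; exact: measurable_kernel.
    + by move=> x; rewrite lee_fin.
    + exact/measurable_EFinP.
  - exact: (measurableT_comp mS measurable_points).
  - by apply: filterS (integral_points tf) => w -> _.
have [_ ->] := BN => //.
have g0 x : (0 <= 1 - expR (- f x))%R by exact: one_sub_expN_ge0.
rewrite -(integral_Pi_rho alpha_gt0 alpha_lt1 g0); last exact: measurable_one_sub_expN.
set L := \int[_]_x _ in fin_f *.
have L0 : 0 <= L by apply: integral_ge0 => x _; rewrite lee_fin.
have Lfin : L \is a fin_num by rewrite ge0_fin_numE.
rewrite -(fineK Lfin) -EFinD poweR_EFin mul1r powRN inver gt_eqF// powR_gt0//.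
by rewrite ltr_pwDl// fine_ge0.
Qed.

Let mass_points_fin : {ae P, forall w, mass (points w) \is a fin_num}.
Proof.
have := negbin_mass_infty ler01 q_gt0 negbin_points_image.
have mI : measurable [set x : rseq R | mass x = +oo].
  rewrite -[X in measurable X]setTI.
  exact: (@measurable_mass R measurableT [set +oo] (emeasurable_set1 _)).
rewrite image_measureE// => N0; exists (points @^-1` [set x | mass x = +oo]).
split=> //; first by rewrite -[X in measurable X]setTI; exact: measurable_points.
move=> w /= nf; apply: contrapT => h; apply: nf.
rewrite ge0_fin_numE ?mass_ge0// ltey; exact/eqP.
Qed.

Let V (w : T) : rseq R :=
  fun i => (J i w / fine (total_mass (fun k => J k w)))%R.

Let good : {ae P, forall w, [/\ plentiful (points w),
  V w = (fun i => (rtotal (points w))^-1 * points w i)%R &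
  decreasing_partition_of_unity (V w)]}.
Proof.
apply: filterS2 BJ mass_points_fin => w [J0 Jd _] fin.
have gw : plentiful (points w).
  by split=> [|m]; [exact: fin|exists m => //; exact: J0].
have T0 := rtotal_gt0 gw.
have VE : V w = (fun i => (rtotal (points w))^-1 * points w i)%R.
  apply/funext => i; rewrite /V mulrC; congr (_^-1 * _)%R.
  congr fine; apply: eq_eseriesr => k _.
  by congr EFin; apply/esym/max_idPl; exact: ltW (J0 k).
split=> //; rewrite VE; have T0' : (0 < (rtotal (points w))^-1)%R by rewrite invr_gt0.
split=> [i|i|].
- exact: mulr_gt0 T0' (J0 i).
- by rewrite ler_pM2l ?Jd.
- transitivity (mass (fun i => (rtotal (points w))^-1 * points w i)%R).
    apply: eq_eseriesr => k _; congr EFin; apply/esym/max_idPl.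
    exact: ltW (mulr_gt0 T0' (J0 k)).
  by rewrite mass_scale// -(fineK fin) -EFinM mulVf// gt_eqF.
Qed.

Lemma PK_partition : {ae mu, forall v, decreasing_partition_of_unity v}.
Proof.
(* The partition property phrased with [mass], which is known to be measurable, so that the almost
   sure statement can be moved through the law of [V]. *)
pose G := [set v : rseq R |
  [/\ forall i, (0 < v i)%R, forall i, (v i.+1 <= v i)%R & mass v = 1]].
have mc i : measurable_fun [set: rseq R] (fun v => v i) by exact: measurable_coord.
have mG : measurable G.
  rewrite (_ : G = \bigcap_i [set v : rseq R | (0 < v i)%R] `&`
      \bigcap_i [set v : rseq R | (v i.+1 <= v i)%R] `&` mass @^-1` [set 1]).
    apply: measurableI; [apply: measurableI; apply: bigcap_measurableType => i _|].
    - by rewrite -[X in measurable X]setTI; apply: measurable_fun_ltr.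
    - by rewrite -[X in measurable X]setTI; apply: measurable_fun_ler.
    - rewrite -[X in measurable X]setTI.
      exact: (@measurable_mass R measurableT _ (emeasurable_set1 _)).
  apply/seteqP; split => v [].
    by move=> v0 vd v1; split => //; split => i _; [exact: v0|exact: vd].
  by move=> [v0 vd] v1; split => // i; [exact: v0|exact: vd].
have [mV lV] := muJ.
exists (~` G); split; first exact: measurableC.
  rewrite lV; last exact: measurableC.
  apply: measure_negligible.
    by rewrite -[X in measurable X]setTI; apply: mV => //; exact: measurableC.
  apply: negligibleS good => w /= nG [_ _ pV]; apply: nG.
  have [V0 Vd _] := pV; split => //; exact: partition_mass.
move=> v /= nv [v0 vd v1]; apply: nv; split=> //.
rewrite -v1; apply: eq_eseriesr => k _; congr EFin.
by apply/esym/max_idPl; exact: ltW.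
Qed.

(** The case L = [setT], c = 1 of [pick_law_integral], where the Gamma(alpha q) normalisation
    cancels. *)
Lemma PK_pick_law As : all_measurable As ->
  \int[mu]_v pick_law As v = (betas alpha q As)%:E.
Proof.
move=> mAs; have [mV lV] := muJ.
have mK := measurable_pick_law mAs; have K0 := @pick_law_ge0 R As.
transitivity (\int[image_measure P mV]_v pick_law As v).
  by apply: eq_measure_integral => A mA _; rewrite image_measureE//; exact: lV.
rewrite integral_image_measure//.
transitivity (\int[M]_v pick_law As v).
  rewrite integral_image_measure//; apply: ae_eq_integral => //.
  - exact: (measurableT_comp mK mV).
  - exact: (measurableT_comp mK measurable_points).
  apply: filterS good => w [gw VE _] _; rewrite -/(V w) VE pick_law_scale//.
  by rewrite invr_gt0 rtotal_gt0.
transitivity (\int[M]_v ((\1_setT (rtotal v))%:E * pick_law As v)).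
  by apply: eq_integral => v _; rewrite indicE in_setT mul1e.
rewrite (pick_law_integral ler01 q_gt0 negbin_points_image (@measurableT _ R) mAs).
have aq0 : (0 < alpha * q)%R by exact: mulr_gt0.
rewrite -EFin_Gamma_fun// -EFinM mul1r mulrAC mulVf ?mul1r//.
by rewrite gt_eqF// Gamma_fun_gt0.
Qed.

Lemma PD_law_of_PK : PD_law alpha (alpha * q) mu.
Proof.
exact: (PD_law_of_pick_law alpha_gt0 alpha_lt1 q_gt0 PK_partition PK_pick_law).
Qed.

End Poisson_Kingman_points.

Theorem mainTheorem6 (R : realType) (alpha theta : R)
    (alpha_gt0 : 0 < alpha) (alpha_lt1 : alpha < 1) (theta_gt0 : 0 < theta)
    (mu : probability (rseq R) R)
    (mu_PK : PK_law (theta / alpha) (rho_G alpha) mu) :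
  forall nu : probability (rseq R) R, PD_law alpha theta nu <-> same_law nu mu.
Proof.
have PDmu : PD_law alpha theta mu.
  case: mu_PK => d [T [P [B [J [BN BJ muJ]]]]].
  have := PD_law_of_PK alpha_gt0 alpha_lt1 (divr_gt0 theta_gt0 alpha_gt0) BN BJ muJ.
  by rewrite mulrC divfK ?gt_eqF.
(* Conversely, the realisation found for [mu] serves every [nu] with the same law, since [PD_law]
   sees [nu] only through its values on measurable sets. *)
move=> nu; split=> [PDnu|numu]; first exact: PD_law_unique PDnu PDmu.
case: PDmu => d [T [P [V [s [U [[mV muV] part sbo beta stick]]]]]].
exists d, T, P, V, s, U; split=> //; split=> // A mA.
by rewrite numu// muV.
Qed.
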